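(* The set $\mathcal C_n=\{m_{\mathfrak s\mathfrak t}:\lambda\in\mathrm{Par}^1_{l,n},\ \mathfrak s,\mathfrak t\in\mathrm{Std}(\lambda)\}$ is linearly independent over $F$, and hence it is an $F$-basis of the generalized blob algebra $B_n$.
   Context: **Combinatorics.** A one-column $l$-multipartition of $n$ is a tuple $\lambda=((1^{a_1}),\dots,(1^{a_l}))$ with integers $a_m\ge 0$, $\sum_m a_m=n$; its diagram is $[\lambda]=\{(r,1,m):1\le m\le l,\ 1\le r\le a_m\}$. $\mathrm{Par}^1_{l,n}$ is the set of all of them. Nodes are totally ordered by: $(r,1,m)\lhd(r',1,m')$ iff $r>r'$, or $r=r'$ and $m>m'$. A $\lambda$-tableau is a bijection $\mathfrak t:\{1,\dots,n\}\to[\lambda]$; it is standard if its entries increase from top to bottom in every component. $\mathrm{Tab}(\lambda)$, $\mathrm{Std}(\lambda)$: all, resp. standard, $\lambda$-tableaux. $\mathfrak t^\lambda$ is the $\lambda$-tableau with $\mathfrak t^\lambda(1)\rhd\cdots\rhd\mathfrak t^\lambda(n)$ (numbers filled in along rows). $S_n$ acts on the right on $\mathrm{Tab}(\lambda)$ by $\mathfrak t w=\mathfrak t\circ w$ (so $\mathfrak t s_k$, $s_k=(k,k+1)$, interchanges entries $k,k+1$), and $\mathfrak t^\lambda d(\mathfrak t)=\mathfrak t$ defines $d(\mathfrak t)\in S_n$. **Algebra.** Fix integers $e,l,n>1$, a field $F$ and a primitive $e$-th root of unity $q\in F\setminus\{1\}$; $I_e=\mathbb Z/e\mathbb Z$;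 $S_n$ acts on $I_e^n$ by permuting coordinates. Fix $\hat\kappa\in\mathbb Z^l$; $\kappa_m\in I_e$ is the image of $\hat\kappa_m$, also identified with its representative in $\{0,\dots,e-1\}$. $\hat\kappa$ is strongly adjacency-free: (i) $\hat\kappa_{m+1}-\hat\kappa_m\ge n$; (ii) $\kappa_i-\kappa_j\not\equiv 0,\pm1\bmod e$ for $i\ne j$; (iii) $\kappa_1\not\equiv\kappa_l+2\bmod e$; (iv) $\kappa_1<\dots<\kappa_l$. The generalized blob algebra $B_n$ is the unital associative $F$-algebra with generators $\psi_1,\dots,\psi_{n-1},y_1,\dots,y_n,e(\boldsymbol i)$ ($\boldsymbol i\in I_e^n$) and relations: $e(\boldsymbol i)e(\boldsymbol j)=\delta_{\boldsymbol i\boldsymbol j}e(\boldsymbol i)$; $\sum_{\boldsymbol i}e(\boldsymbol i)=1$; $e(\boldsymbol i)=0$ if $i_1\notin\{\kappa_1,\dots,\kappa_l\}$; $e(\boldsymbol i)=0$ if $i_1\in\{\kappa_1,\dots,\kappa_l\}$ and $i_2=i_1+1$; $y_1e(\boldsymbol i)=0$ if $i_1\in\{\kappa_1,\dots,\kappa_l\}$; $y_re(\boldsymbol i)=e(\boldsymbol i)y_r$; $\psi_re(\boldsymbol i)=e(s_r\cdot\boldsymbol i)\psi_r$; $y_ry_s=y_sy_r$; $\psi_ry_s=y_s\psi_r$ if $s\ne r,r+1$; $\psi_r\psi_s=\psi_s\psi_r$ if $|r-s|>1$; $\psi_ry_{r+1}e(\boldsymbol i)=(y_r\psi_r-\delta_{i_r,i_{r+1}})e(\boldsymbol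 i)$; $y_{r+1}\psi_re(\boldsymbol i)=(\psi_ry_r-\delta_{i_r,i_{r+1}})e(\boldsymbol i)$; $\psi_r^2e(\boldsymbol i)$ equals $0$ if $i_r=i_{r+1}$, $e(\boldsymbol i)$ if $i_r\ne i_{r+1},i_{r+1}\pm1$, $(y_{r+1}-y_r)e(\boldsymbol i)$ if $i_{r+1}=i_r+1$, $(y_r-y_{r+1})e(\boldsymbol i)$ if $i_{r+1}=i_r-1$; $\psi_r\psi_{r+1}\psi_re(\boldsymbol i)=(\psi_{r+1}\psi_r\psi_{r+1}+\alpha)e(\boldsymbol i)$ with $\alpha=-1$ if $i_{r+2}=i_r=i_{r+1}-1$, $\alpha=1$ if $i_{r+2}=i_r=i_{r+1}+1$, $\alpha=0$ otherwise. $*$ is the anti-involution of $B_n$ fixing all generators. **The elements $m_{\mathfrak s\mathfrak t}$.** The residue of $(r,1,m)$ is $\mathrm{res}=\kappa_m+1-r\in I_e$; $\boldsymbol i^\lambda=(\mathrm{res}(\mathfrak t^\lambda(1)),\dots,\mathrm{res}(\mathfrak t^\lambda(n)))$. For each $w\in S_n$ a reduced expression $w=s_{i_1}\cdots s_{i_N}$ is chosen once and for all and $\psi_w:=\psi_{i_1}\cdots\psi_{i_N}$. For $\mathfrak s,\mathfrak t\in\mathrm{Tab}(\lambda)$, $m_{\mathfrak s\mathfrak t}:=\psi_{d(\mathfrak s)}^*e(\boldsymbol i^\lambda)\psi_{d(\mathfrak t)}\in B_n$. *)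

(* Defs.v *)
From HB Require Import structures.
From mathcomp Require Import all_boot all_order all_algebra all_fingroup.
From mathcomp Require Import generic_quotient ring_quotient.
From mathcomp Require Import finmap boolp zify.
From mathcomp.multinomials Require Import monalg.

Set Implicit Arguments.
Unset Strict Implicit.
Unset Printing Implicit Defensive.

Import GRing.Theory.
Local Open Scope ring_scope.

Section Basis.
Variables (F : fieldType) (V : lmodType F) (I : finType).

Definition lin_indep (v : I -> V) : Prop :=
  forall c : I -> F, \sum_i c i *: v i = 0 -> forall i, c i = 0.

Definition is_basis (v : I -> V) : Prop :=
  lin_indep v /\ forall x : V, exists c : I -> F, x = \sum_i c i *: v i.
End Basis.

Definition word (X : choiceType) : Type := seq X.

HB.instance Definition _ (X : choiceType) := Choice.on (word X).

Section Word.
Variable X : choiceType.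

Fact word_unit (u v : word X) : u ++ v = [::] -> u = [::] /\ v = [::].
Proof. by case: u. Qed.

HB.instance Definition _ :=
  Choice_isMonomialDef.Build (word X) (@catA X) (@cat0s X) (@cats0 X) word_unit.
End Word.

Notation freeAlg F X := {malg F[word X]}.

HB.lock Definition letter (F : fieldType) (X : choiceType) (x : X) : freeAlg F X :=
  << ([:: x] : word X) >>.

Section FreeAlg.
Variables (F : fieldType) (X : choiceType).
Local Notation A := (freeAlg F X).

Definition revA (g : A) : A :=
  \sum_(w <- msupp g) << g@_w *g (rev w : word X) >>.

Lemma revAE (g : A) (w : word X) : (revA g)@_w = g@_(rev w : word X).
Proof.
rewrite /revA raddf_sum /=.
under eq_bigr do rewrite mcoeffU.
case: (msuppP g (rev w : word X)) => [h|h].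
  rewrite (big_fsetD1 (rev w : word X)) //= revK eqxx mulr1n.
  rewrite big1_fset ?addr0 // => v; rewrite in_fsetD1 => /andP[vw _] _.
  by case: (eqVneq (rev v) w) vw => // <-; rewrite revK eqxx.
rewrite big1_fset // => v vg _; case: (eqVneq (rev v) w) => // vw.
by move: h; rewrite -vw revK vg.
Qed.

Lemma revA_is_linear : linear revA.
Proof. by move=> c g h; apply/malgP=> w; rewrite revAE !(mcoeffD, mcoeffZ) !revAE. Qed.

HB.instance Definition _ := GRing.isLinear.Build F A A *:%R revA revA_is_linear.

Lemma revAK : involutive revA.
Proof. by move=> g; apply/malgP=> w; rewrite !revAE revK. Qed.

Lemma revAU c (w : word X) : revA << c *g w >> = << c *g (rev w : word X) >>.
Proof.
by apply/malgP=> v; rewrite revAE !mcoeffU -(inj_eq (can_inj (@revK X))) revK.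
Qed.

Lemma revA_letter x : revA (letter F x) = letter F x.
Proof. by rewrite letter.unlock revAU. Qed.

Lemma revA1 : revA 1 = 1.
Proof. exact: revAU. Qed.

Lemma revA_sum I (r : seq I) (f : I -> A) :
  revA (\sum_(i <- r) f i) = \sum_(i <- r) revA (f i).
Proof. exact: (raddf_sum (revA : {linear A -> A})). Qed.

Lemma revAM (g h : A) : revA (g * h) = revA h * revA g.
Proof.
rewrite [g]monalgE mulr_suml !revA_sum mulr_sumr; apply: eq_bigr => u _.
rewrite [h]monalgE mulr_sumr !revA_sum mulr_suml; apply: eq_bigr => v _.
by rewrite !revAU !malgM_def !fgmulUU revAU mulrC /= rev_cat.
Qed.

End FreeAlg.

Section PresAlg.
Variables (F : fieldType) (A : lalgType F) (rel : A -> A -> Prop).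

(* The two-sided ideal generated by the differences [u - v], [rel u v]. *)
Inductive in_ideal : A -> Prop :=
| IdealRel u v of rel u v : in_ideal (u - v)
| Ideal0 : in_ideal 0
| IdealD u v of in_ideal u & in_ideal v : in_ideal (u + v)
| IdealMl a u of in_ideal u : in_ideal (a * u)
| IdealMr a u of in_ideal u : in_ideal (u * a).

Definition rel_ideal : {pred A} := fun x => `[< in_ideal x >].

Lemma rel_idealP x : reflect (in_ideal x) (x \in rel_ideal).
Proof. exact: asboolP. Qed.

Fact rel_ideal_zmod : zmod_closed rel_ideal.
Proof.
split=> [|u v /rel_idealP hu /rel_idealP hv]; apply/rel_idealP; first exact: Ideal0.
by apply: IdealD => //; rewrite -mulN1r; apply: IdealMl.
Qed.

HB.instance Definition _ := GRing.isZmodClosed.Build A rel_ideal rel_ideal_zmod.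

(* The presented algebra. It is not known to be nontrivial, so it is a [pzRingType] and an
   [lmodType F]; the library's [lalgType] and [algType] require [1 != 0].
   Compatibility of the two structures is [presAlg_scalerAl] and
   [presAlg_scalerAr]. *)
Definition presAlg := {ideal_quot rel_ideal}.

HB.instance Definition _ := GRing.Zmodule.on presAlg.

End PresAlg.

HB.lock Definition pr (F : fieldType) (A : lalgType F) (rel : A -> A -> Prop)
  (x : A) : presAlg rel := (\pi_(presAlg rel) x)%qT.

HB.lock Definition pmul (F : fieldType) (A : lalgType F) (rel : A -> A -> Prop)
  (x x' : presAlg rel) : presAlg rel := pr rel (repr x * repr x').

HB.lock Definition pscale (F : fieldType) (A : lalgType F)
  (rel : A -> A -> Prop) (c : F) (x : presAlg rel) : presAlg rel :=
  pr rel (c *: repr x).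

Section PresAlgTheory.
Variables (F : fieldType) (A : lalgType F) (rel : A -> A -> Prop).
Local Notation presAlg := (presAlg rel).
Local Notation pr := (pr rel).
Local Notation in_ideal := (in_ideal rel).
Local Notation pmul := (@pmul F A rel).
Local Notation pscale := (@pscale F A rel).

Lemma pr_surj (x : presAlg) : exists u, x = pr u.
Proof. by exists (repr x); rewrite pr.unlock reprK. Qed.

Lemma prP u v : pr u = pr v <-> in_ideal (u - v).
Proof.
rewrite pr.unlock; split=> [/eqP|h]; last apply/eqP.
  by rewrite -Quotient.idealrBE => /rel_idealP.
by rewrite -Quotient.idealrBE; apply/rel_idealP.
Qed.

Lemma pr_rel u v : rel u v -> pr u = pr v.
Proof. by move=> h; apply/prP/IdealRel. Qed.

Lemma prD u v : pr (u + v) = pr u + pr v.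
Proof. rewrite pr.unlock; exact: raddfD. Qed.
Lemma prN u : pr (- u) = - pr u.
Proof. rewrite pr.unlock; exact: raddfN. Qed.
Lemma prB u v : pr (u - v) = pr u - pr v.
Proof. by rewrite prD prN. Qed.
Lemma pr0 : pr 0 = 0.
Proof. rewrite pr.unlock; exact: raddf0. Qed.

Definition pone : presAlg := pr 1.

Lemma repr_pr u : in_ideal (repr (pr u) - u).
Proof. by apply/prP; rewrite pr.unlock reprK. Qed.

Lemma prMdef u v : pmul (pr u) (pr v) = pr (u * v).
Proof.
rewrite pmul.unlock; apply/prP; have hu := repr_pr u; have hv := repr_pr v.
set a := repr _ in hu *; set b := repr _ in hv *.
have -> : a * b - u * v = (a - u) * b + u * (b - v).
  by rewrite mulrBl mulrBr addrA subrK.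
by apply: IdealD; [apply: IdealMr | apply: IdealMl].
Qed.

Lemma prZdef c u : pscale c (pr u) = pr (c *: u).
Proof.
rewrite pscale.unlock; apply/prP; have hu := repr_pr u; set a := repr _ in hu *.
by rewrite -scalerBr -[a - u]mul1r scalerAl; apply: IdealMl.
Qed.

Fact pmulA : associative pmul.
Proof.
move=> x y z; have [[u ->] [[v ->] [w ->]]] := (pr_surj x, (pr_surj y, pr_surj z)).
by rewrite !prMdef mulrA.
Qed.
Fact pmul1 : left_id pone pmul.
Proof. by move=> x; have [u ->] := pr_surj x; rewrite prMdef mul1r. Qed.
Fact p1mul : right_id pone pmul.
Proof. by move=> x; have [u ->] := pr_surj x; rewrite prMdef mulr1. Qed.
Fact pmulDl : left_distributive pmul +%R.
Proof.
move=> x y z; have [[u ->] [[v ->] [w ->]]] := (pr_surj x, (pr_surj y, pr_surj z)).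
by rewrite -prD !prMdef mulrDl prD.
Qed.
Fact pmulDr : right_distributive pmul +%R.
Proof.
move=> x y z; have [[u ->] [[v ->] [w ->]]] := (pr_surj x, (pr_surj y, pr_surj z)).
by rewrite -prD !prMdef mulrDr prD.
Qed.

HB.instance Definition _ := GRing.Zmodule_isPzRing.Build presAlg
  pmulA pmul1 p1mul pmulDl pmulDr.

Fact pscaleA a b x : pscale a (pscale b x) = pscale (a * b) x.
Proof. by have [u ->] := pr_surj x; rewrite !prZdef scalerA. Qed.
Fact pscale1 : left_id 1 pscale.
Proof. by move=> x; have [u ->] := pr_surj x; rewrite prZdef scale1r. Qed.
Fact pscaleDr : right_distributive pscale +%R.
Proof.
move=> c x y; have [[u ->] [v ->]] := (pr_surj x, pr_surj y).
by rewrite -prD !prZdef scalerDr prD.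
Qed.
Fact pscaleDl x : {morph pscale^~ x : a b / a + b}.
Proof. by move=> a b; have [u ->] := pr_surj x; rewrite !prZdef scalerDl prD. Qed.

HB.instance Definition _ := GRing.Zmodule_isLmodule.Build F presAlg
  pscaleA pscale1 pscaleDr pscaleDl.

Lemma prM u v : pr (u * v) = pr u * pr v.
Proof. by rewrite -prMdef. Qed.
Lemma pr1 : pr 1 = 1.
Proof. by []. Qed.
Lemma prZ c u : pr (c *: u) = c *: pr u.
Proof. by rewrite -prZdef. Qed.

Lemma presAlg_scalerAl (c : F) (x y : presAlg) : c *: (x * y) = (c *: x) * y.
Proof.
have [[u ->] [v ->]] := (pr_surj x, pr_surj y).
by rewrite -prM -!prZ -prM scalerAl.
Qed.

Hypothesis scalerArA : forall (c : F) (u v : A), c *: (u * v) = u * (c *: v).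

Lemma presAlg_scalerAr (c : F) (x y : presAlg) : c *: (x * y) = x * (c *: y).
Proof.
have [[u ->] [v ->]] := (pr_surj x, pr_surj y).
by rewrite -prM -!prZ -prM scalerArA.
Qed.

End PresAlgTheory.

Lemma freeAlg_scalerAr (F : fieldType) (X : choiceType) (c : F)
  (u v : freeAlg F X) : c *: (u * v) = u * (c *: v).
Proof.
rewrite -!mul_malgC !mulrA; congr (_ * v).
by rewrite [u]monalgE mulr_sumr mulr_suml; apply: eq_bigr => w _;
   rewrite !malgM_def !fgmulUU mulrC mul1m mulm1.
Qed.

Section Star.
Variables (F : fieldType) (X : choiceType).
Local Notation A := (freeAlg F X).
Variable rel : A -> A -> Prop.

Definition pstar (x : presAlg rel) : presAlg rel := pr rel (revA (repr x)).

Hypothesis rel_rev : forall u v, rel u v -> in_ideal rel (revA u - revA v).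

Lemma in_ideal_rev u : in_ideal rel u -> in_ideal rel (revA u).
Proof.
elim=> {u} [u v /rel_rev|| u v _ hu _ hv|a u _ hu|a u _ hu].
- by rewrite raddfB.
- by rewrite raddf0; apply: Ideal0.
- by rewrite raddfD; apply: IdealD.
- by rewrite revAM; apply: IdealMr.
- by rewrite revAM; apply: IdealMl.
Qed.

Lemma pstar_pr u : pstar (pr rel u) = pr rel (revA u).
Proof. by apply/prP; rewrite -raddfB; apply/in_ideal_rev/repr_pr. Qed.

Lemma pstar_linear : linear pstar.
Proof.
move=> c x y; have [[u ->] [v ->]] := (pr_surj x, pr_surj y).
by rewrite -prZ -prD !pstar_pr linearP prD prZ.
Qed.

Lemma pstar_anti x y : pstar (x * y) = pstar y * pstar x.
Proof.
have [[u ->] [v ->]] := (pr_surj x, pr_surj y).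
by rewrite -prM !pstar_pr revAM prM.
Qed.

Lemma pstar1 : pstar 1 = 1.
Proof. by rewrite -pr1 pstar_pr revA1. Qed.

Lemma pstarK : involutive pstar.
Proof. by move=> x; have [u ->] := pr_surj x; rewrite !pstar_pr revAK. Qed.

Lemma pstar_letter x : pstar (pr rel (letter F x)) = pr rel (letter F x).
Proof. by rewrite pstar_pr revA_letter. Qed.

End Star.

(* Indices are shifted down by one: positions and the [y_r] are indexed by
   ['I_n], the [s_r] and [psi_r] by ['I_n.-1], and [s_r] exchanges the
   positions [lo r] and [hi r], of values [r] and [r.+1]. *)
Definition lo n (r : 'I_n.-1) : 'I_n := widen_ord (leq_pred n) r.

Fact hi_proof n (r : 'I_n.-1) : (r.+1 < n)%N.
Proof. by rewrite -ltn_predRL. Qed.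

Definition hi n (r : 'I_n.-1) : 'I_n := Ordinal (hi_proof r).

Definition simple_refl n (r : 'I_n.-1) : 'S_n := tperm (lo r) (hi r).

(* ['Z_e] is the ring of integers mod [e] only when [1 < e], which is always
   assumed. *)
Notation resseq e n := {ffun 'I_n -> 'Z_e}.

Definition act_s e n (r : 'I_n.-1) (i : resseq e n) : resseq e n :=
  [ffun k => i (simple_refl r k)].

Section BlobAlgebra.
Variables (F : fieldType) (e l n : nat) (kappa : 'I_l -> 'Z_e).
Implicit Types (i j : resseq e n) (r s : 'I_n.-1) (k : 'I_n).

Definition blob_gen : Type := ('I_n.-1 + 'I_n + resseq e n)%type.
HB.instance Definition _ := Choice.on blob_gen.

Local Notation A := (freeAlg F blob_gen).
Local Notation Psi r := (letter F (inl (inl r) : blob_gen)).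
Local Notation Y r := (letter F (inl (inr r) : blob_gen)).
Local Notation E i := (letter F (inr i : blob_gen)).

(* The coefficient alpha of the braid relation, for [s] the successor of [r]. *)
Definition braid_coef (i : resseq e n) (r s : 'I_n.-1) : A :=
  if (i (hi s) == i (lo r)) && (i (lo r) == i (hi r) - 1) then -1
  else if (i (hi s) == i (lo r)) && (i (lo r) == i (hi r) + 1) then 1
  else 0.

Inductive blob_rel : A -> A -> Prop :=
| RelEE i j : blob_rel (E i * E j) (if i == j then E i else 0)
| RelE1 : blob_rel (\sum_i E i) 1
| RelE0 i k of k = 0%N :> nat & (forall m, i k <> kappa m) :
    blob_rel (E i) 0
| RelE01 i k k' m of k = 0%N :> nat & k' = 1%N :> nat
    & i k = kappa m & i k' = i k + 1 : blob_rel (E i) 0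
| RelYE0 i (k : 'I_n) m of k = 0%N :> nat & i k = kappa m :
    blob_rel (Y k * E i) 0
| RelYE k i : blob_rel (Y k * E i) (E i * Y k)
| RelPsiE r i : blob_rel (Psi r * E i) (E (act_s r i) * Psi r)
| RelYY k k' : blob_rel (Y k * Y k') (Y k' * Y k)
| RelPsiY r k of k <> lo r & k <> hi r : blob_rel (Psi r * Y k) (Y k * Psi r)
| RelPsiPsi r s of ((r.+1 < s) || (s.+1 < r))%N :
    blob_rel (Psi r * Psi s) (Psi s * Psi r)
| RelPsiYhi r i :
    blob_rel (Psi r * Y (hi r) * E i)
             ((Y (lo r) * Psi r - (i (lo r) == i (hi r))%:R) * E i)
| RelYhiPsi r i :
    blob_rel (Y (hi r) * Psi r * E i)
             ((Psi r * Y (lo r) - (i (lo r) == i (hi r))%:R) * E i)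
| RelSqEq r i of i (lo r) = i (hi r) : blob_rel (Psi r ^+ 2 * E i) 0
| RelSqFar r i of i (lo r) <> i (hi r) & i (lo r) <> i (hi r) + 1
    & i (lo r) <> i (hi r) - 1 : blob_rel (Psi r ^+ 2 * E i) (E i)
| RelSqUp r i of i (hi r) = i (lo r) + 1 :
    blob_rel (Psi r ^+ 2 * E i) ((Y (hi r) - Y (lo r)) * E i)
| RelSqDown r i of i (hi r) = i (lo r) - 1 :
    blob_rel (Psi r ^+ 2 * E i) ((Y (lo r) - Y (hi r)) * E i)
| RelBraid (r s : 'I_n.-1) i of s = r.+1 :> nat :
    blob_rel (Psi r * Psi s * Psi r * E i)
             ((Psi s * Psi r * Psi s + braid_coef i r s) * E i).

Definition blobAlg := presAlg blob_rel.

HB.instance Definition _ := GRing.PzRing.on blobAlg.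
HB.instance Definition _ := GRing.Lmodule.on blobAlg.

Definition psi (r : 'I_n.-1) : blobAlg := pr blob_rel (Psi r).
Definition y (r : 'I_n) : blobAlg := pr blob_rel (Y r).
Definition idem (i : resseq e n) : blobAlg := pr blob_rel (E i).

(* The anti-involution fixing all generators: see [star_anti], [starK],
   [star_psi], [star_y] and [star_idem]. *)
Definition star (x : blobAlg) : blobAlg := pstar x.

Lemma act_sK r : involutive (@act_s e n r).
Proof. by move=> i; apply/ffunP=> k; rewrite !ffunE tpermK. Qed.

Lemma act_s_lo r (i : resseq e n) : act_s r i (lo r) = i (hi r).
Proof. by rewrite ffunE tpermL. Qed.

Lemma act_s_hi r (i : resseq e n) : act_s r i (hi r) = i (lo r).
Proof. by rewrite ffunE tpermR. Qed.

Lemma delta_act r (i : resseq e n) (B : pzRingType) (x : resseq e n -> B) :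
  (i (lo r) == i (hi r))%:R * x (act_s r i) = x i * (i (lo r) == i (hi r))%:R.
Proof.
case: eqVneq => [h|_]; last by rewrite mul0r mulr0.
rewrite mul1r mulr1; congr x; apply/ffunP=> k; rewrite ffunE.
by case: tpermP => [->|->|].
Qed.

Local Notation p := (pr blob_rel).

Lemma E_psi r i : p (E i) * p (Psi r) = p (Psi r) * p (E (act_s r i)).
Proof.
have := pr_rel (RelPsiE r (act_s r i)); rewrite act_sK !prM; exact: esym.
Qed.

Lemma E_y k i : p (E i) * p (Y k) = p (Y k) * p (E i).
Proof. by have := pr_rel (RelYE k i); rewrite !prM; exact: esym. Qed.

Lemma pr_nat m : p m%:R = m%:R.
Proof. by elim: m => [|m IH]; rewrite ?pr0 // -!natr1 prD IH. Qed.

Lemma revA_nat m : revA (m%:R : A) = m%:R.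
Proof. by elim: m => [|m IH]; rewrite ?raddf0 // -!natr1 raddfD /= IH revA1. Qed.

Lemma act_braid r s i : s = r.+1 :> nat ->
  [/\ act_s r (act_s s (act_s r i)) = act_s s (act_s r (act_s s i)),
     act_s r (act_s s (act_s r i)) (lo r) = i (hi s),
     act_s r (act_s s (act_s r i)) (hi s) = i (lo r),
     act_s r (act_s s (act_s r i)) (hi r) = i (hi r) &
     i (hi s) = i (lo r) -> act_s r (act_s s (act_s r i)) = i].
Proof.
move=> sr; have hl : hi r = lo s by apply: val_inj.
have ne1 : lo r != lo s by rewrite -val_eqE /= sr neq_ltn ltnSn.
have ne2 : lo r != hi s by rewrite -val_eqE /= sr neq_ltn ltnS leqnSn.
have ne3 : lo s != hi s by rewrite -val_eqE /= neq_ltn ltnSn.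
have H j : act_s r j = [ffun k => j (tperm (lo r) (lo s) k)].
  by apply/ffunP=> k; rewrite !ffunE /simple_refl hl.
have H' j : act_s s j = [ffun k => j (tperm (lo s) (hi s) k)].
  by apply/ffunP=> k; rewrite !ffunE.
have T (a b c : 'I_n) k : a != b -> a != c -> b != c ->
    tperm a b (tperm b c (tperm a b k)) = tperm a c k.
  move=> ab ac bc; rewrite -!permM -{1}[tperm a b]tpermV -conjgE tpermJ.
  by rewrite tpermR (tpermD ac bc).
have R : act_s r (act_s s (act_s r i)) = [ffun k => i (tperm (lo r) (hi s) k)].
  by rewrite !H H'; apply/ffunP=> k; rewrite !ffunE T.
rewrite R; split; rewrite ?ffunE ?tpermL ?tpermR //; last first.
- by move=> h; apply/ffunP=> k; rewrite ffunE; case: tpermP => [->|->|].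
- by rewrite hl tpermD // eq_sym.
rewrite !H !H'; apply/ffunP=> k; rewrite !ffunE.
by rewrite [tperm (lo s) (hi s)]tpermC [tperm (lo r) (lo s)]tpermC T 1?tpermC // eq_sym.
Qed.

Lemma blob_rel_rev u v : blob_rel u v -> in_ideal blob_rel (revA u - revA v).
Proof.
have EQ r i w : p (E i) * (p (Psi r) * w) = p (Psi r) * (p (E (act_s r i)) * w).
  by rewrite !mulrA E_psi.
have EY k i w : p (E i) * (p (Y k) * w) = p (Y k) * (p (E i) * w).
  by rewrite !mulrA E_y.
have pE2 := (prM, prB, prD).
move=> h; apply/prP; case: h => {u v}.
- move=> i j; rewrite revAM !revA_letter (pr_rel (RelEE j i)) eq_sym.
  by case: eqVneq => [->|_]; rewrite ?revA_letter ?raddf0.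
- rewrite revA_sum revA1 -(pr_rel RelE1); congr p; apply: eq_bigr => i _.
  by rewrite revA_letter.
- by move=> i k k0 ik; rewrite revA_letter raddf0 (pr_rel (RelE0 k0 ik)).
- move=> i k k' m k0 k1 ik ik'.
  by rewrite revA_letter raddf0 (pr_rel (RelE01 k0 k1 ik ik')).
- move=> i k m k0 ik; rewrite revAM !revA_letter raddf0.
  by rewrite prM E_y -prM (pr_rel (RelYE0 k0 ik)).
- by move=> k i; rewrite !revAM !revA_letter !prM E_y.
- by move=> r i; rewrite !revAM !revA_letter !prM E_psi.
- by move=> k k'; rewrite !revAM !revA_letter (pr_rel (RelYY k k')).
- move=> r k h1 h2; rewrite !revAM !revA_letter.
  by rewrite (pr_rel (RelPsiY h1 h2)).
- by move=> r s h; rewrite !revAM !revA_letter (pr_rel (RelPsiPsi h)).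
- move=> r i; have := pr_rel (RelYhiPsi r (act_s r i)).
  rewrite act_s_lo act_s_hi eq_sym !revAM raddfB /= revA_nat !revAM !revA_letter.
  rewrite !pE2 pr_nat -mulrA EY E_psi !mulrA => ->.
  by rewrite mulrBr mulrBl (delta_act r i (fun j => p (E j))) !mulrA E_psi -!mulrA E_y.
- move=> r i; have := pr_rel (RelPsiYhi r (act_s r i)).
  rewrite act_s_lo act_s_hi eq_sym !revAM raddfB /= revA_nat !revAM !revA_letter.
  rewrite !pE2 pr_nat EQ E_y !mulrA => ->.
  by rewrite mulrBr mulrBl (delta_act r i (fun j => p (E j))) !mulrA E_y -!mulrA E_psi.
- move=> r i ir; have := pr_rel (RelSqEq (i := i) ir).
  rewrite expr2 !revAM !revA_letter raddf0 !pE2 EQ E_psi act_sK !mulrA => ->.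
  by [].
- move=> r i h1 h2 h3; have := pr_rel (RelSqFar h1 h2 h3).
  by rewrite expr2 !revAM !revA_letter !pE2 EQ E_psi act_sK !mulrA => ->.
- move=> r i h; have := pr_rel (RelSqUp h).
  rewrite expr2 !revAM raddfB /= !revA_letter !pE2 EQ E_psi act_sK !mulrA => ->.
  by rewrite mulrBr mulrBl !E_y.
- move=> r i h; have := pr_rel (RelSqDown h).
  rewrite expr2 !revAM raddfB /= !revA_letter !pE2 EQ E_psi act_sK !mulrA => ->.
  by rewrite mulrBr mulrBl !E_y.
- move=> r s i sr; have [h1 h2 h3 h4 h5] := act_braid i sr.
  have := pr_rel (RelBraid (act_s r (act_s s (act_s r i))) sr).
  have -> : braid_coef (act_s r (act_s s (act_s r i))) r s = braid_coef i r s.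
    by rewrite /braid_coef h2 h3 h4 eq_sym; case: eqVneq => //= ->.
  have revc : revA (braid_coef i r s) = braid_coef i r s.
    rewrite /braid_coef; case: ifP => _; last case: ifP => _.
    - by rewrite raddfN /= revA1.
    - by rewrite revA1.
    - by rewrite raddf0.
  have comc : p (braid_coef i r s) * p (E (act_s r (act_s s (act_s r i)))) =
              p (E i) * p (braid_coef i r s).
    rewrite /braid_coef; case: (eqVneq (i (hi s))) => [/h5 ->|_] /=.
      case: ifP => _; last case: ifP => _; rewrite ?prN ?pr1 ?pr0.
      - by rewrite mulN1r mulrN1.
      - by rewrite mul1r mulr1.
      - by rewrite mul0r mulr0.
    by rewrite pr0 mul0r mulr0.
  rewrite !revAM raddfD /= revc !revAM !revA_letter !pE2.
  move: (p (braid_coef i r s)) comc => c comc.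
  rewrite !EQ E_psi !mulrA => ->.
  by rewrite mulrDl mulrDr comc -!mulrA !EQ E_psi h1.
Qed.

Lemma star_linear : linear star.
Proof. exact: pstar_linear blob_rel_rev. Qed.
Lemma star_anti x1 x2 : star (x1 * x2) = star x2 * star x1.
Proof. exact: pstar_anti blob_rel_rev _ _. Qed.
Lemma star1 : star 1 = 1.
Proof. exact: pstar1 blob_rel_rev. Qed.
Lemma starK : involutive star.
Proof. exact: pstarK blob_rel_rev. Qed.
Lemma star_psi r : star (psi r) = psi r.
Proof. exact: pstar_letter blob_rel_rev _. Qed.
Lemma star_y k : star (y k) = y k.
Proof. exact: pstar_letter blob_rel_rev _. Qed.
Lemma star_idem i : star (idem i) = idem i.
Proof. exact: pstar_letter blob_rel_rev _. Qed.

End BlobAlgebra.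

Section Tableaux.
Variables (l n : nat).

(* [a m] is the length of the [m]-th column; lengths of a multipartition of [n]
   are at most [n]. *)
Definition par1 : Type :=
  {a : {ffun 'I_l -> 'I_n.+1} | (\sum_m (a m : nat) == n)%N}.
HB.instance Definition _ := Finite.on par1.

(* [(r, m)] is the node in row [r.+1] and column [1] of component [m.+1]. *)
Definition node : Type := ('I_n * 'I_l)%type.
HB.instance Definition _ := Finite.on node.

Definition node_lt (x x' : node) : bool :=
  ((x'.1 < x.1) || ((x.1 == x'.1) && (x'.2 < x.2)))%N.

Definition diagram (lam : par1) : {set node} :=
  [set x : node | (x.1 < val lam x.2)%N].

Definition is_tab (lam : par1) (t : {ffun 'I_n -> node}) : bool :=
  injectiveb t && (t @: [set: 'I_n] == diagram lam).

Definition tab (lam : par1) : Type := {t : {ffun 'I_n -> node} | is_tab lam t}.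
HB.instance Definition _ lam := Finite.on (tab lam).

Definition is_std (lam : par1) (t : tab lam) : bool :=
  [forall k, forall k', ((val t k).2 == (val t k').2) &&
     ((val t k).1 < (val t k').1)%N ==> (k < k')%N].

Definition std (lam : par1) : Type := {t : tab lam | is_std t}.
HB.instance Definition _ lam := Finite.on (std lam).

Definition diagram_seq (lam : par1) : seq node :=
  sort (fun x x' => (x == x') || node_lt x' x) (enum (diagram lam)).

Lemma card_diagram lam : #|diagram lam| = n.
Proof.
rewrite -[RHS](eqP (valP lam)) -sum1_card.
rewrite (eq_bigl (fun x : node => true && (x.1 < val lam x.2)%N)); last first.
  by move=> x; rewrite inE.
rewrite -(pair_big_dep xpredT (fun (r : 'I_n) m => (r < val lam m)%N)
  (fun _ _ => 1%N)) /=.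
rewrite (exchange_big_dep xpredT) //=; apply: eq_bigr => m _.
by rewrite -(big_ord_widen n (fun=> 1%N)) ?sum1_card ?card_ord // -ltnS.
Qed.

Fact size_diagram_seq lam : size (diagram_seq lam) == n.
Proof. by rewrite size_sort -cardE card_diagram. Qed.

Definition init_fun (lam : par1) : {ffun 'I_n -> node} :=
  [ffun k => tnth (Tuple (size_diagram_seq lam)) k].

Fact init_fun_is_tab lam : is_tab lam (init_fun lam).
Proof.
have U : uniq (Tuple (size_diagram_seq lam)) by rewrite sort_uniq enum_uniq.
have I : injective (init_fun lam).
  by move=> k k'; rewrite !ffunE => /eqP; rewrite (inj_eq (tuple_uniqP _ U)) => /eqP.
rewrite /is_tab; apply/andP; split; first exact/injectiveP.
rewrite eqEcard card_imset // card_diagram cardsT card_ord leqnn andbT.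
apply/subsetP=> x /imsetP[k _ ->]; rewrite ffunE.
by have := mem_tnth k (Tuple (size_diagram_seq lam)); rewrite /= mem_sort mem_enum.
Qed.

(* The tableau t^lambda, see [init_tab_decr]. *)
Definition init_tab (lam : par1) : tab lam :=
  exist _ (init_fun lam) (init_fun_is_tab lam).

Lemma tab_inj lam (t : tab lam) : injective (val t).
Proof. by apply/injectiveP; case/andP: (valP t). Qed.

Lemma init_tab_decr lam (k k' : 'I_n) :
  (k < k')%N -> node_lt (val (init_tab lam) k') (val (init_tab lam) k).
Proof.
move=> kk'; set e := fun x x' : node => (x == x') || node_lt x' x.
have tot : total e.
  move=> [r m] [r' m']; rewrite /e /node_lt /= !xpair_eqE -!val_eqE /=; lia.
have tr : transitive e.
  move=> [r m] [r' m'] [r2 m2].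
  by rewrite /e /node_lt /= !xpair_eqE -!val_eqE /=; lia.
have S : sorted e (diagram_seq lam) by apply: sort_sorted.
have /eqP sz := size_diagram_seq lam; have x0 := val (init_tab lam) k.
have := sorted_ltn_nth tr x0 S; move/(_ k k').
rewrite !inE sz !ltn_ord => /(_ isT isT kk').
rewrite -!(tnth_nth x0 (Tuple (size_diagram_seq lam))) /e => /orP[/eqP H|].
  have : val (init_tab lam) k = val (init_tab lam) k' by rewrite /= !ffunE.
  by move/tab_inj=> E; rewrite E ltnn in kk'.
by rewrite /= !ffunE.
Qed.

Fact d_subproof lam (t : tab lam) k :
  {k' | val (init_tab lam) k' == val t k}.
Proof.
apply/sigW; have : val t k \in val (init_tab lam) @: [set: 'I_n].
  have [/andP[_ /eqP ->] /andP[_ /eqP <-]] := (valP (init_tab lam), valP t).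
  exact: imset_f.
by case/imsetP=> k' _ ->; exists k'.
Qed.

Definition d_fun lam (t : tab lam) (k : 'I_n) : 'I_n := sval (d_subproof t k).

Lemma d_funE lam (t : tab lam) k : val (init_tab lam) (d_fun t k) = val t k.
Proof. exact/eqP/(svalP (d_subproof t k)). Qed.

Fact d_fun_inj lam (t : tab lam) : injective (d_fun t).
Proof.
move=> k k' /(congr1 (val (init_tab lam))).
by rewrite !d_funE => /tab_inj.
Qed.

(* The permutation [d] with [init_tab lam \o d =1 t]. *)
Definition d_perm lam (t : tab lam) : 'S_n := perm (@d_fun_inj lam t).

Lemma d_permE lam (t : tab lam) k :
  val (init_tab lam) (d_perm t k) = val t k.
Proof. by rewrite permE d_funE. Qed.

End Tableaux.

(* The product of [S_n] is composition of functions, [(v w) x = v (w x)], which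
   is the opposite of the product [v * w] of ['S_n]: [word_perm [:: r1; r2]] is
   [s_r1 \o s_r2]. *)
Definition word_perm n (u : seq 'I_n.-1) : 'S_n :=
  foldr (fun r w => (w * simple_refl r)%g) 1%g u.

Definition reduced_expr n (w : 'S_n) (u : seq 'I_n.-1) : Prop :=
  word_perm u = w /\ forall v, word_perm v = w -> (size u <= size v)%N.

Section Mst.
Variables (F : fieldType) (e l n : nat) (kappa : 'I_l -> 'Z_e).

(* The node [(r, m)] is in row [r.+1]. *)
Definition res (x : node l n) : 'Z_e := kappa x.2 + 1 - (x.1.+1)%:R.

Definition res_par (lam : par1 l n) : resseq e n :=
  [ffun k => res (val (init_tab lam) k)].

Variable red : 'S_n -> seq 'I_n.-1.

Definition psi_perm (w : 'S_n) : blobAlg F n kappa :=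
  \prod_(r <- red w) psi F kappa r.

Definition m_elt lam (s t : tab lam) : blobAlg F n kappa :=
  star (psi_perm (d_perm s)) * idem F kappa (res_par lam) *
  psi_perm (d_perm t).

Definition C_index : Type := {lam : par1 l n & (std lam * std lam)%type}.
HB.instance Definition _ := Finite.on C_index.

Definition C_family (x : C_index) : blobAlg F n kappa :=
  m_elt (val (tagged x).1) (val (tagged x).2).

End Mst.

Section Charge.
Variables (e l n : nat) (khat : 'I_l -> int).

Definition charge (m : 'I_l) : 'Z_e := (khat m)%:~R.

Definition strongly_adjacency_free : Prop :=
  [/\ forall m m' : 'I_l, m' = m.+1 :> nat -> khat m' - khat m >= n%:Z,
      forall m m' : 'I_l, m != m' ->
        [/\ charge m - charge m' <> 0, charge m - charge m' <> 1
          & charge m - charge m' <> -1],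
      forall m m' : 'I_l, m = 0%N :> nat -> m'.+1 = l -> charge m <> charge m' + 2%:R
    & forall m m' : 'I_l, (m < m')%N -> (charge m < charge m')%N].

End Charge.

(* Main.v *)
From HB Require Import structures.
Require Import Defs.
From mathcomp Require Import all_boot all_order all_algebra all_fingroup.
From mathcomp Require Import finmap fraction zify ring.
From mathcomp.multinomials Require Import monalg.

(** The elements [m_st] span by straightening, and they are independent because they stay
    independent in a deformation that acts faithfully enough on a finite set of words.

    The deformation. Over [F[X]], replace the relation [y_1 e(i) = 0] for [i_1 = kappa_m]
    by [y_1 e(i) = x_m e(i)], with distinct [x_m] divisible by [X]. The relations, for
    arbitrary scalars [x_m], are collected in [deformed_blob]; the blob algebra satisfies
    them with [x = 0], and an algebra of matrices over the field of fractions satisfies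
    them with these [x_m].

    Spanning, in every algebra with the deformed relations. Think of [e(i)] as a row of
    strands coloured by residues. Strands whose residues are neither equal nor adjacent
    pass through each other. Read [i] from the left, and suppose that an initial part
    consists of the residues of a shape in row-reading order. The next strand moves to the
    left until it is stopped. Either it is then the strand of a box that can be added to
    the shape, or the relations for equal and adjacent residues put [e(i)] into the ideal
    of heavier shapes; here the weight of a box is so large that it exceeds that of [n]
    boxes in lower rows. Thus the idempotents of the shapes generate everything
    ([absorb_strand], [cell_idem]), and modulo heavier shapes each [y_r] acts on
    [e(i^lam)] as a scalar ([y_eigen_and_skip]). Hence a word in the [psi_r] applied to
    [e(i^lam)] depends only on its permutation, up to shorter words and heavier shapes
    ([matsumoto], [word_equiv_reduced]). If the tableau of that permutation is not
    standard, the word can be chosen so as to reverse first two vertically adjacent boxes;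
    the strands of all boxes between them, in row-reading order, are far from both, so the
    result lies in the ideal of heavier shapes ([window_kill], [window_word]). Together
    with the mirror image of this argument, it follows that the [m_st] span the ideals of
    the shapes, in particular the one that contains 1 ([left_span_word],
    [cell_ideal_span]).

    Independence over the field of fractions. Words of length [n] in the components are
    paths in the lattice of shapes, and a word has a residue sequence. The functions on
    words carry a representation of the deformed relations, in which [y_r] multiplies by
    [x_m] for [m] the [r]-th letter, and [psi_r] exchanges neighbouring letters, up to a
    multiple of the identity if their residues agree ([matrix_deformed]). A word with
    residue sequence [i^lam] has a shape heavier than [lam], unless it is the word of the
    initial tableau ([word_weight_ge], [word_weight_eq]); and from the word of the initial
    tableau [psi_w] leads to words with at most as many inversions as the length of [w],
    with equality for one word only ([transition_top]). So the matrix entries of the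
    [m_st] at the words of [s] and [t] are triangular ([matrix_indep]).

    Specialisation. The matrices satisfy every relation of the blob algebra up to a
    multiple of [X], which by spanning is [X] times a combination of the [m_st] over
    [F[X]] ([ideal_divisible]). A linear relation in the blob algebra with coefficients
    [c] in [F] gives, for the matrices, a relation with coefficients [c - X b], so every
    entry of [c] is divisible by [X] and therefore 0 ([C_family_indep]). *)

Set Implicit Arguments.
Unset Strict Implicit.
Unset Printing Implicit Defensive.

Import GRing.Theory.
Local Open Scope ring_scope.

(** * Inversions and reduced words in the symmetric group *)

(** Splits the innermost conditionals first, so that the conditions are free of them. *)
Ltac split_ifs := repeat match goal with
  | |- context [if ?b then _ else _] =>
    lazymatch b with context [if _ then _ else _] => fail | _ => case: (boolP b) => ? end
  end.

Section Inversions.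
Variable n : nat.
Implicit Types (r s : 'I_n.-1) (p : 'I_n) (w : 'S_n) (u v : seq 'I_n.-1).

Lemma lo_lt_hi r : (lo r < hi r)%N.
Proof. by []. Qed.

Lemma lo_neq_hi r : lo r != hi r.
Proof. by rewrite neq_ltn lo_lt_hi. Qed.

Lemma srK r : involutive (simple_refl r).
Proof. exact: tpermK. Qed.

Lemma sr_lo r : simple_refl r (lo r) = hi r.
Proof. exact: tpermL. Qed.

Lemma sr_hi r : simple_refl r (hi r) = lo r.
Proof. exact: tpermR. Qed.

Lemma sr_out r p : p != lo r -> p != hi r -> simple_refl r p = p.
Proof. by move=> h1 h2; rewrite /simple_refl tpermD // eq_sym. Qed.

Lemma val_sr r p : nat_of_ord (simple_refl r p) =
  if p == r :> nat then r.+1 else if p == r.+1 :> nat then r : nat else p.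
Proof.
rewrite -[(p == r :> nat)]/(p == lo r) -[(p == r.+1 :> nat)]/(p == hi r).
case: eqVneq => [->|h1]; first by rewrite sr_lo.
by case: eqVneq => [->|h2]; rewrite ?sr_hi // sr_out.
Qed.

(** A simple reflection reverses the order of no pair of positions but its own, so it
    changes the number of inversions of a sequence by the status of that one pair. *)
Lemma sr_lt r p p' : (p < p')%N -> (p, p') != (lo r, hi r) ->
  (simple_refl r p < simple_refl r p')%N.
Proof.
move=> lt; rewrite xpair_eqE -!val_eqE /= !val_sr => ne.
by move: ne lt; split_ifs; lia.
Qed.

Lemma sr_comm r s p : ((r.+1 < s) || (s.+1 < r))%N ->
  simple_refl r (simple_refl s p) = simple_refl s (simple_refl r p).
Proof. by move=> far; apply/val_inj; rewrite /= !val_sr; split_ifs; lia. Qed.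

Lemma sr_braid r s p : s = r.+1 :> nat ->
  simple_refl r (simple_refl s (simple_refl r p)) =
  simple_refl s (simple_refl r (simple_refl s p)).
Proof. by move=> adj; apply/val_inj; rewrite /= !val_sr; split_ifs; lia. Qed.

Section Stat.
Variables (T : Type) (gt : T -> T -> bool).

(** Permutations and words in the components are both compared by their inversions, for two
    different orders on the values; hence the abstract comparison [gt]. *)
Definition count_inversions (f : 'I_n -> T) : nat :=
  #|[set x : 'I_n * 'I_n | (x.1 < x.2)%N && gt (f x.1) (f x.2)]|.

Lemma eq_count_inversions f g : f =1 g -> count_inversions f = count_inversions g.
Proof. by move=> fg; congr #|pred_of_set _|; apply/setP=> x; rewrite !inE !fg. Qed.

Lemma count_inversions_swap (f : 'I_n -> T) r :
  gt (f (lo r)) (f (hi r)) = false -> gt (f (hi r)) (f (lo r)) ->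
  count_inversions (f \o simple_refl r) = (count_inversions f).+1.
Proof.
move=> h1 h2; rewrite /count_inversions (cardsD1 (lo r, hi r)) !inE /= sr_lo sr_hi h2.
rewrite leqnn /= add1n; congr _.+1.
pose h (x : 'I_n * 'I_n) := (simple_refl r x.1, simple_refl r x.2).
have hK : involutive h by move=> [a b]; rewrite /h /= !srK.
rewrite -(card_imset _ (inv_inj hK)); congr #|pred_of_set _|.
apply/setP=> -[a b]; rewrite -[(a, b)]hK (mem_imset _ _ (inv_inj hK)) /h /=.
rewrite !inE /= !srK; case: (eqVneq (a, b) (lo r, hi r)) => [[-> ->]|ne].
  by rewrite sr_lo sr_hi h1 !andbF.
rewrite andbA; congr (_ && _); case: (ltngtP a b) => [ab|ba|/val_inj ->] /=.
- rewrite (sr_lt ab ne) andbT; apply/eqP=> -[E1 E2].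
  by move: ab; rewrite -[a](srK r) -[b](srK r) E1 E2 sr_lo sr_hi /=; lia.
- case: (eqVneq (b, a) (lo r, hi r)) => [[-> ->]|ne'].
    by rewrite sr_lo sr_hi eqxx.
  by rewrite ltnNge (ltnW (sr_lt ba ne')) andbF.
- by rewrite ltnn andbF.
Qed.
End Stat.

Definition inversions w : nat := count_inversions (fun a b : 'I_n => (b < a)%N) w.

Lemma inversions_up w r : (w (lo r) < w (hi r))%N -> inversions (simple_refl r * w)%g = (inversions w).+1.
Proof.
move=> lt; rewrite /inversions -(@count_inversions_swap _ _ _ r) //; last by apply/negbTE; lia.
by apply: eq_count_inversions => p /=; rewrite permM.
Qed.

Lemma inversions_down w r : (w (hi r) < w (lo r))%N -> inversions w = (inversions (simple_refl r * w)%g).+1.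
Proof.
move=> lt; rewrite -(@inversions_up _ r); first by rewrite mulgA /simple_refl tperm2 mul1g.
by rewrite !permM sr_lo sr_hi.
Qed.

(** Exchanging positions and values matches the inversions of [w] and of its inverse. *)
Lemma inversionsV w : inversions w^-1%g = inversions w.
Proof.
rewrite /inversions /count_inversions; pose h (x : 'I_n * 'I_n) := (w x.2, w x.1).
have hI : injective h by move=> [a b] [c d] [/perm_inj -> /perm_inj ->].
rewrite -[RHS](card_imset _ hI); congr #|pred_of_set _|; apply/setP=> -[a b].
have -> : (a, b) = h (w^-1%g b, w^-1%g a) by rewrite /h /= !permKV.
by rewrite mem_imset // !inE /= !permK !permKV andbC.
Qed.

Lemma inversions_upl w r : (w^-1%g (lo r) < w^-1%g (hi r))%N ->
  inversions (w * simple_refl r)%g = (inversions w).+1.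
Proof.
by move=> lt; rewrite -inversionsV invMg /simple_refl tpermV inversions_up // inversionsV.
Qed.

Lemma inversions_downl w r : (w^-1%g (hi r) < w^-1%g (lo r))%N ->
  inversions w = (inversions (w * simple_refl r)%g).+1.
Proof.
by move=> lt; rewrite -inversionsV (inversions_down lt) -[in RHS]inversionsV invMg /simple_refl tpermV.
Qed.

Lemma inversions_step w r : (inversions (w * simple_refl r)%g <= (inversions w).+1)%N.
Proof.
case: (ltngtP (w^-1%g (lo r)) (w^-1%g (hi r))) => [/inversions_upl ->|/inversions_downl ->|] //.
  by rewrite leqW // leqW.
by move/val_inj/perm_inj => E; have := lo_neq_hi r; rewrite E eqxx.
Qed.

(** Along the positions from [a] to [b] the values cannot increase all the time. *)
Lemma descent_between w (a b : 'I_n) : (a < b)%N -> (w b < w a)%N ->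
  exists2 r : 'I_n.-1, (a <= r < b)%N & (w (hi r) < w (lo r))%N.
Proof.
move: {2}(b - a)%N (leqnn (b - a)) => m; elim: m a b => [|m IH] a b le ab lt; first lia.
have r_lt : (a < n.-1)%N by have := ltn_ord b; lia.
pose r := Ordinal r_lt; have Ea : lo r = a by apply: val_inj.
case: (ltngtP (w (hi r)) (w a)) => [h|h|/val_inj/perm_inj h].
- by exists r; rewrite ?Ea //= leqnn.
- have [||r' /andP[h1 h2] h3] := IH (hi r) b _ _ (ltn_trans lt h).
  + by rewrite /=; lia.
  + rewrite ltn_neqAle -[(_ <= b)%N]/(a < b)%N ab andbT.
    by apply/eqP=> /val_inj E; move: h; rewrite E; lia.
  by exists r' => //; rewrite h2 andbT; move: h1 => /=; lia.
by have := lo_neq_hi r; rewrite Ea h eqxx.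
Qed.

Lemma inversions0_id w : inversions w = 0%N -> w = 1%g.
Proof.
have mono (v : 'S_n) : inversions v = 0%N -> forall p, (p <= v p)%N.
  move/eqP; rewrite cards_eq0 => /eqP h0.
  have inc (a b : 'I_n) : (a < b)%N -> (v a < v b)%N.
    move=> ab; move: (h0) => /setP/(_ (a, b)); rewrite !inE ab /= => /negbT.
    rewrite -leqNgt leq_eqVlt => /orP[/eqP/val_inj/perm_inj E|//].
    by rewrite E ltnn in ab.
  move=> p; have [m] := ubnP (p : nat); elim: m p => // m IH p pm.
  case: (posnP p) => [->//|p0].
  have q_lt : (p.-1 < n)%N by have := ltn_ord p; lia.
  have /= := IH (Ordinal q_lt); have /= := inc (Ordinal q_lt) p; lia.
move=> h; apply/permP=> p; rewrite perm1; apply/val_inj/eqP.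
rewrite eqn_leq mono // andbT; have := mono w^-1%g; rewrite inversionsV => /(_ h (w p)).
by rewrite permK.
Qed.

Lemma inversions1 : inversions 1 = 0%N.
Proof.
apply/eqP; rewrite cards_eq0; apply/eqP/setP=> x; rewrite !inE !perm1; lia.
Qed.

Lemma word_perm_cat u v : word_perm (u ++ v) = (word_perm v * word_perm u)%g.
Proof. by elim: u => [|r u IH] /=; rewrite ?mulg1 // IH mulgA. Qed.

Lemma word_perm_rev u : word_perm (rev u) = (word_perm u)^-1%g.
Proof.
elim: u => [|r u IH] /=; rewrite ?invg1 // rev_cons -cats1 word_perm_cat IH /=.
by rewrite mul1g invMg /simple_refl tpermV.
Qed.

Lemma inversions_word u : (inversions (word_perm u) <= size u)%N.
Proof. by elim: u => [|r u IH] /=; rewrite ?inversions1 // (leq_trans (inversions_step _ _)). Qed.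

(** Sorting by adjacent descents, each of which removes one inversion. With
    [inversions_word] this makes the length of a reduced expression the number of
    inversions. *)
Lemma reduced_word w : exists2 u, word_perm u = w & size u = inversions w.
Proof.
move: {2}(inversions w) (erefl (inversions w)) => m; elim: m w => [|m IH] w h.
  by exists [::]; rewrite ?h // (inversions0_id h).
have : (inversions w != 0)%N by rewrite h.
rewrite cards_eq0 => /set0Pn[[a b]]; rewrite inE /= => /andP[ab lt].
have [r _ /inversions_down E] := descent_between ab lt.
have [|u Eu su] := IH (simple_refl r * w)%g; first by move: E; rewrite h => -[].
exists (rcons u r); last by rewrite size_rcons su -E.
by rewrite -cats1 word_perm_cat /= mul1g Eu mulgA /simple_refl tperm2 mul1g.
Qed.

Lemma size_reduced w u : reduced_expr w u -> size u = inversions w.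
Proof.
move=> [E min]; apply/eqP; rewrite eqn_leq -{2}E inversions_word andbT.
by have [v /min le <-] := reduced_word w.
Qed.

End Inversions.

Section Matsumoto.
Variable n : nat.
Implicit Types (r s : 'I_n.-1) (u v : seq 'I_n.-1).
Variable R : seq 'I_n.-1 -> seq 'I_n.-1 -> Prop.
Hypothesis Rrefl : forall u, R u u.
Hypothesis Rsym : forall u v, R u v -> R v u.
Hypothesis Rtrans : forall u v w, R u v -> R v w -> R u w.
Hypothesis Rcons : forall r u v, R u v -> R (r :: u) (r :: v).
Hypothesis Rcomm : forall r s u, ((r.+1 < s) || (s.+1 < r))%N ->
  R [:: r, s & u] [:: s, r & u].
Hypothesis Rbraid : forall r s u, s = r.+1 :> nat ->
  R [:: r, s, r & u] [:: s, r, s & u].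

(** A first letter of a reduced word is a descent of the inverse permutation, and the rest
    of the word is reduced. *)
Lemma reduced_tail (t : 'I_n.-1) (x : seq 'I_n.-1) : size (t :: x) = inversions (word_perm (t :: x)) ->
  [/\ ((word_perm (t :: x))^-1%g (hi t) < (word_perm (t :: x))^-1%g (lo t))%N,
      size x = inversions (word_perm x) &
      word_perm x = (word_perm (t :: x) * simple_refl t)%g].
Proof.
move=> h; have hx := inversions_word x; move: (h) => /=.
have -> : (word_perm x * simple_refl t * simple_refl t = word_perm x)%g.
  by rewrite -mulgA /simple_refl tperm2 mulg1.
case: (ltngtP ((word_perm x)^-1%g (lo t)) ((word_perm x)^-1%g (hi t))) => [lt|lt|].
- rewrite (inversions_upl lt) => -[->]; split=> //.
  by rewrite /= invMg /simple_refl tpermV !permM sr_lo sr_hi.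
- by have := inversions_downl lt => e1 e2; move: hx; rewrite e1 -e2 /=; lia.
- by move/val_inj/perm_inj => e; have := lo_neq_hi t; rewrite e eqxx.
Qed.

(** The theorem of Matsumoto and Tits for the symmetric group, for an arbitrary equivalence
    [R] compatible with new first letters, so that it can be applied to equality up to
    shorter words. If the first letters [r] and [s] of the two words differ, both are
    descents; the longest element of the subgroup they generate then splits off, and the two
    words are joined, by induction on their tails, to words that begin with its two reduced
    expressions. *)
Lemma matsumoto u v : word_perm u = word_perm v ->
  size u = inversions (word_perm u) -> size v = inversions (word_perm v) -> R u v.
Proof.
have [m] := ubnP (size u); elim: m u v => // m IH u v.
case: u v => [|r u] [|s v] um E su sv //.
- by rewrite -E /= inversions1 in sv.
- by rewrite E /= inversions1 in su.
have suv : size u = size v by move: su; rewrite E -sv => -[].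
wlog rs : r s u v um E su sv suv / (r <= s)%N.
  move=> H; case/orP: (leq_total r s) => le; first exact: H.
  by apply/Rsym/H => //; move: um; rewrite /= suv.
have [dr su' Eu] := reduced_tail su; have [ds sv' Ev] := reduced_tail sv.
rewrite -E in ds Ev; move: dr ds Eu Ev; set w := word_perm (r :: u).
move=> dr ds Eu Ev; rewrite -[inversions _]/(inversions w) in su; clearbody w.
have K (t : 'I_n.-1) : (simple_refl t * simple_refl t = 1 :> 'S_n)%g by rewrite /simple_refl tperm2.
(* Both words pass through words with a common second half; induction applies to the tails. *)
have key x y : word_perm x = word_perm u -> word_perm y = word_perm v ->
    size x = size u -> size y = size u -> R (r :: x) (s :: y) -> R (r :: u) (s :: v).
  have um' : (size u < m)%N by move: um => /=; lia.
  move=> e1 e2 z1 z2 h; apply: (Rtrans (v := r :: x)).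
    by apply: Rcons; apply: IH => //; rewrite e1 ?z1.
  apply: (Rtrans h); apply: Rcons; apply: IH; rewrite ?e2 ?z2 //.
  by rewrite suv.
have dinv (x : 'S_n) (t : 'I_n.-1) : (x^-1%g (hi t) < x^-1%g (lo t))%N ->
    inversions x = (inversions (x * simple_refl t)%g).+1 by exact: inversions_downl.
have WV (x : 'S_n) t p : (x * simple_refl t)^-1%g p = x^-1%g (simple_refl t p).
  by rewrite invMg /simple_refl tpermV permM.
move: rs; rewrite leq_eqVlt => /orP[/eqP/val_inj rs|rs].
  by rewrite -rs in Ev *; apply: Rcons; apply: IH; rewrite // Eu Ev.
(* Far letters: the longest element is [s_r s_s]. Adjacent letters, below: [s_r s_s s_r]. *)
have [adj|nadj] := eqVneq (s : nat) r.+1; last first.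
  have far : (r.+1 < s)%N by lia.
  have C : (simple_refl r * simple_refl s = simple_refl s * simple_refl r)%g.
    by apply/permP=> p; rewrite !permM sr_comm // far orbT.
  have [u0 E0 s0] := reduced_word (w * simple_refl r * simple_refl s)%g.
  have d2 : ((w * simple_refl r)^-1%g (hi s) < (w * simple_refl r)^-1%g (lo s))%N.
    have h1 : simple_refl r (hi s) = hi s by apply: sr_out; rewrite -val_eqE /=; lia.
    have h2 : simple_refl r (lo s) = lo s by apply: sr_out; rewrite -val_eqE /=; lia.
    by rewrite !WV h1 h2.
  have := dinv _ _ dr; have := dinv _ _ d2; rewrite -su -s0 => -> [] /= z.
  apply: (key (s :: u0) (r :: u0)) => //=.
  - by rewrite E0 Eu -!mulgA K mulg1.
  - by rewrite E0 Ev -!mulgA -C !(mulgA (simple_refl r)) K mul1g.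
  - by apply: Rcomm; rewrite far.
have hl : hi r = lo s by apply: val_inj.
have rout : simple_refl r (hi s) = hi s by apply: sr_out; rewrite -val_eqE /=; lia.
have sout : simple_refl s (lo r) = lo r by apply: sr_out; rewrite -val_eqE /=; lia.
have C : (simple_refl r * simple_refl s * simple_refl r =
    simple_refl s * simple_refl r * simple_refl s)%g.
  by apply/permP=> p; rewrite !permM sr_braid.
have [u0 E0 s0] := reduced_word (w * simple_refl r * simple_refl s * simple_refl r)%g.
have d2 : ((w * simple_refl r)^-1%g (hi s) < (w * simple_refl r)^-1%g (lo s))%N.
  by rewrite !WV rout -hl sr_hi (ltn_trans ds) // -hl.
have d3 : ((w * simple_refl r * simple_refl s)^-1%g (hi r) <
           (w * simple_refl r * simple_refl s)^-1%g (lo r))%N.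
  by rewrite !WV hl sr_lo rout sout sr_lo hl.
have := dinv _ _ dr; have := dinv _ _ d2; have := dinv _ _ d3.
rewrite -su -s0 => -> -> [] /= z.
apply: (key (s :: r :: u0) (r :: s :: u0)) => //=.
- rewrite E0 Eu -!mulgA !(mulgA (simple_refl r) (simple_refl r)) K mul1g.
  by rewrite K mulg1.
- rewrite E0 Ev -!mulgA; congr (_ * _)%g; rewrite !mulgA C.
  by rewrite -!mulgA (mulgA (simple_refl s) (simple_refl s)) K mul1g K mulg1.
- exact: Rbraid.
Qed.

End Matsumoto.

(** * The deformed relations and their symmetry *)

(** The correction term of the braid relation, as an element of the algebra [A]. *)
Definition braid_sign (e n : nat) (A : pzRingType) (i : resseq e n) (r s : 'I_n.-1) : A :=
  if (i (hi s) == i (lo r)) && (i (lo r) == i (hi r) - 1) then -1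
  else if (i (hi s) == i (lo r)) && (i (lo r) == i (hi r) + 1) then 1
  else 0.

(** The relations of the blob algebra over a commutative ring [R] of scalars, except that
    [y_1] acts on the strands starting at component [m] by the scalar [x m] instead of by 0.
    The elements satisfy the relations but are not assumed to generate [A], so that the
    record applies both to the blob algebra, with [x = 0], and to a whole matrix algebra,
    with distinct [x m]. *)
Record deformed_blob (e l n : nat) (kappa : 'I_l -> 'Z_e) (R : comNzRingType)
  (A : pzRingType) (sc : R -> A) (x : 'I_l -> R)
  (ps : 'I_n.-1 -> A) (yy : 'I_n -> A) (ee : resseq e n -> A) : Prop := DeformedBlob {
  sc1 : sc 1 = 1;
  scD : forall a b, sc (a + b) = sc a + sc b;
  scM : forall a b, sc (a * b) = sc a * sc b;
  scC : forall c a, sc c * a = a * sc c;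
  idM : forall i j, ee i * ee j = if i == j then ee i else 0;
  id1 : \sum_i ee i = 1;
  id0 : forall (i : resseq e n) (k : 'I_n), k = 0%N :> nat -> (forall m, i k <> kappa m) -> ee i = 0;
  id01 : forall (i : resseq e n) (k k' : 'I_n) m, k = 0%N :> nat -> k' = 1%N :> nat ->
    i k = kappa m -> i k' = i k + 1 -> ee i = 0;
  y_id0 : forall (i : resseq e n) (k : 'I_n) m, k = 0%N :> nat -> i k = kappa m ->
    yy k * ee i = sc (x m) * ee i;
  y_id : forall k i, yy k * ee i = ee i * yy k;
  psi_id : forall (r : 'I_n.-1) (i : resseq e n), ps r * ee i = ee (act_s r i) * ps r;
  psi_y : forall r k, k <> lo r -> k <> hi r -> ps r * yy k = yy k * ps r;
  psi_psi : forall r s : 'I_n.-1, ((r.+1 < s) || (s.+1 < r))%N -> ps r * ps s = ps s * ps r;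
  psi_y_hi : forall (r : 'I_n.-1) (i : resseq e n), ps r * yy (hi r) * ee i =
    (yy (lo r) * ps r - (i (lo r) == i (hi r))%:R) * ee i;
  y_hi_psi : forall (r : 'I_n.-1) (i : resseq e n), yy (hi r) * ps r * ee i =
    (ps r * yy (lo r) - (i (lo r) == i (hi r))%:R) * ee i;
  sq_eq : forall (r : 'I_n.-1) (i : resseq e n), i (lo r) = i (hi r) -> ps r * ps r * ee i = 0;
  sq_far : forall (r : 'I_n.-1) (i : resseq e n), i (lo r) <> i (hi r) -> i (lo r) <> i (hi r) + 1 ->
    i (lo r) <> i (hi r) - 1 -> ps r * ps r * ee i = ee i;
  sq_up : forall (r : 'I_n.-1) (i : resseq e n), i (hi r) = i (lo r) + 1 ->
    ps r * ps r * ee i = (yy (hi r) - yy (lo r)) * ee i;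
  sq_down : forall (r : 'I_n.-1) (i : resseq e n), i (hi r) = i (lo r) - 1 ->
    ps r * ps r * ee i = (yy (lo r) - yy (hi r)) * ee i;
  braid : forall (r s : 'I_n.-1) (i : resseq e n), s = r.+1 :> nat ->
    ps r * ps s * ps r * ee i = (ps s * ps r * ps s + braid_sign A i r s) * ee i
}.

Section Opposite.
Variables (e l n : nat) (kappa : 'I_l -> 'Z_e) (R : comNzRingType) (A : pzRingType)
  (sc : R -> A) (x : 'I_l -> R) (ps : 'I_n.-1 -> A) (yy : 'I_n -> A) (ee : resseq e n -> A).
Hypothesis D : deformed_blob kappa sc x ps yy ee.

Lemma id_psi r i : ee i * ps r = ps r * ee (act_s r i).
Proof. by rewrite (psi_id D) act_sK. Qed.

Lemma braid_sign_comm (r s : 'I_n.-1) i : s = r.+1 :> nat ->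
  ee i * braid_sign A i r s = braid_sign A i r s * ee (act_s r (act_s s (act_s r i))).
Proof.
move=> sr; have [_ _ _ _ h5] := act_braid i sr; rewrite /braid_sign.
case: (eqVneq (i (hi s))) => [/h5 ->|_] /=; last by rewrite mul0r mulr0.
case: ifP => _; last case: ifP => _; rewrite ?mulN1r ?mulrN1 ?mul1r ?mulr1 //.
by rewrite mul0r mulr0.
Qed.

(** The relations are stable under the anti-involution that fixes the generators. Read in
    the opposite ring, what is proved for left multiplication thus holds for right
    multiplication. *)
Lemma deformed_blob_op : @deformed_blob e l n kappa R A^c sc x ps yy ee.
Proof.
have comm_del (r : 'I_n.-1) (i : resseq e n) (c : A) : c = (i (lo r) == i (hi r))%:R -> ee i * c = c * ee (act_s r i).
  by move=> ->; rewrite (delta_act r i ee).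
have C2 r i : ee i * (ps r * ps r) = ps r * ps r * ee i.
  by rewrite mulrA id_psi -mulrA id_psi act_sK mulrA.
have C3 r s t i : ee i * (ps r * (ps s * ps t)) =
    ps r * ps s * ps t * ee (act_s t (act_s s (act_s r i))).
  by rewrite mulrA id_psi -mulrA (mulrA (ee _)) id_psi -mulrA id_psi !mulrA.
split.
- exact: (sc1 D).
- exact: (scD D).
- move=> a b; rewrite mulrC; exact: (scM D).
- by move=> c a; apply: esym; exact: (scC D).
- move=> i j; rewrite [LHS](idM D) eq_sym; by case: eqP => // ->.
- exact: (id1 D).
- exact: (id0 D).
- exact: (id01 D).
- move=> i k m k0 ik; have /= := y_id0 D k0 ik; rewrite (y_id D) (scC D); exact.
- by move=> k i; apply: esym; exact: (y_id D).
- by move=> r i; exact: id_psi.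
- by move=> r k h1 h2; apply: esym; exact: (psi_y D).
- by move=> r s h; apply: esym; exact: (psi_psi D).
- move=> r i; suff: ee i * (yy (hi r) * ps r) =
      ee i * (ps r * yy (lo r) - (i (lo r) == i (hi r))%:R :> A) by [].
  have := y_hi_psi D r (act_s r i); rewrite act_s_lo act_s_hi eq_sym.
  rewrite mulrBl mulrBr (comm_del r i _ (erefl _)) => E.
  rewrite mulrA -(y_id D) -mulrA id_psi mulrA E mulrA id_psi.
  by rewrite -[in RHS]mulrA -(y_id D) !mulrA.
- move=> r i; suff: ee i * (ps r * yy (hi r)) =
      ee i * (yy (lo r) * ps r - (i (lo r) == i (hi r))%:R :> A) by [].
  have := psi_y_hi D r (act_s r i); rewrite act_s_lo act_s_hi eq_sym.
  rewrite mulrBl mulrBr (comm_del r i _ (erefl _)) => E.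
  rewrite mulrA id_psi -mulrA -(y_id D) mulrA E mulrA -(y_id D).
  by rewrite -[in RHS]mulrA id_psi !mulrA.
- by move=> r i h; have := sq_eq D h; rewrite -C2; exact.
- by move=> r i h1 h2 h3; have := sq_far D h1 h2 h3; rewrite -C2; exact.
- move=> r i h; have := sq_up D h; rewrite -C2 mulrBl !(y_id D) -mulrBr; exact.
- move=> r i h; have := sq_down D h; rewrite -C2 mulrBl !(y_id D) -mulrBr; exact.
move=> r s i sr; have [h1 h2 h3 h4 _] := act_braid i sr.
suff: ee i * (ps r * (ps s * ps r)) = ee i * (ps s * (ps r * ps s) + braid_sign A i r s) by [].
have := braid D (act_s r (act_s s (act_s r i))) sr.
have -> : braid_sign A (act_s r (act_s s (act_s r i))) r s = braid_sign A i r s.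
  by rewrite /braid_sign h2 h3 h4 eq_sym; case: eqVneq => //= ->.
rewrite mulrDl mulrDr braid_sign_comm // => E.
by rewrite !C3 E h1.
Qed.

End Opposite.

(** * Strand calculus on residue sequences *)

Section Ideals.
Variables (e n : nat) (R : comNzRingType) (A : pzRingType) (sc : R -> A)
  (ps : 'I_n.-1 -> A) (yy : 'I_n -> A) (ee : resseq e n -> A).

Inductive is_gen : A -> Prop :=
| GenPsi r : is_gen (ps r)
| GenY p : is_gen (yy p)
| GenE i : is_gen (ee i)
| GenSc c : is_gen (sc c).

(** Stability under the generators only: [A] may be larger than the subalgebra that they
    generate, and the ideals in use are ideals of that subalgebra. *)
Definition is_ideal (I : A -> Prop) : Prop :=
  [/\ I 0, forall a b, I a -> I b -> I (a + b),
      forall g a, is_gen g -> I a -> I (g * a)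
    & forall g a, is_gen g -> I a -> I (a * g)].

End Ideals.

(** On strands with such residues [psi_r^2 = 1], so they can be moved past one another. *)
Definition far (e : nat) (a b : 'Z_e) : bool := [&& a != b, a != b + 1 & a != b - 1].

Lemma far_sym e (a b : 'Z_e) : far a b = far b a.
Proof.
rewrite /far eq_sym; congr (_ && _); rewrite andbC; congr (_ && _).
  by rewrite eq_sym subr_eq.
by rewrite [in RHS]eq_sym subr_eq.
Qed.

Lemma farxx e (a : 'Z_e) : far a a = false.
Proof. by rewrite /far eqxx. Qed.

Lemma notfar e (a b : 'Z_e) : ~~ far a b -> [\/ a = b, a = b + 1 | a = b - 1].
Proof.
by rewrite /far !negb_and !negbK => /or3P[/eqP ->|/eqP ->|/eqP ->];
  [constructor 1 | constructor 2 | constructor 3].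
Qed.

Section Lists.
Variables (e l n : nat) (kappa : 'I_l -> 'Z_e) (R : comNzRingType) (A : pzRingType)
  (sc : R -> A) (x : 'I_l -> R) (ps : 'I_n.-1 -> A) (yy : 'I_n -> A) (ee : resseq e n -> A).
Hypothesis D : deformed_blob kappa sc x ps yy ee.
Implicit Types (s : seq 'Z_e) (a b c : 'Z_e) (z : R).

(** Residue sequences are handled as lists, which can be cut and concatenated; positions are
    then natural numbers, and [psi_at], [y_at] are the generators at a position, with the
    value 0 outside the range. *)
Definition res_of_seq s : resseq e n := [ffun k : 'I_n => nth 0 s k].
Definition idem_seq s : A := ee (res_of_seq s).
Definition psi_at (k : nat) : A := oapp ps 0 (insub k).
Definition y_at (k : nat) : A := oapp yy 0 (insub k).

Lemma y_atE (k : 'I_n) : y_at k = yy k.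
Proof. by rewrite /y_at valK. Qed.

(** Translates the relations at the position of two consecutive entries of a list into those
    of the generators. *)
Lemma list_pos s1 a b s2 : size (s1 ++ a :: b :: s2) = n -> exists r : 'I_n.-1,
  [/\ r = size s1 :> nat, psi_at (size s1) = ps r, y_at (size s1) = yy (lo r) & y_at (size s1).+1 = yy (hi r)] /\
  [/\ res_of_seq (s1 ++ a :: b :: s2) (lo r) = a, res_of_seq (s1 ++ a :: b :: s2) (hi r) = b
    & act_s r (res_of_seq (s1 ++ a :: b :: s2)) = res_of_seq (s1 ++ b :: a :: s2)].
Proof.
rewrite size_cat /= => h; have lt : (size s1 < n.-1)%N by lia.
exists (Ordinal lt); split.
  split=> //; rewrite /psi_at /y_at.
  - by rewrite insubT.
  - by rewrite -[X in insub X]/(lo (Ordinal lt) : nat) valK.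
  - by rewrite -[X in insub X]/(hi (Ordinal lt) : nat) valK.
split; rewrite ?ffunE /=.
- by rewrite nth_cat ltnn subnn.
- by rewrite nth_cat ltnNge leqW //= subSnn.
apply/ffunP=> k; rewrite !ffunE val_sr /= !nth_cat.
case: (ltngtP k (size s1)) => [lt'|gt|->].
- have -> : (k == (size s1).+1 :> nat) = false by lia.
  by rewrite lt'.
- case: eqP => [->|ne]; first by rewrite ltnn subnn subSnn.
  have -> : (k < size s1)%N = false by lia.
  by case E: (k - size s1)%N => [|[|m]] //; lia.
- by rewrite ltnNge leqnSn /= subSnn subnn.
Qed.

Lemma y_at_comm k s : y_at k * idem_seq s = idem_seq s * y_at k.
Proof.
rewrite /y_at; case: insub => [p|] /=; first exact: (y_id D).
by rewrite mul0r mulr0.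
Qed.

Section Two.
Variables (s1 s2 : seq 'Z_e) (a b : 'Z_e).
Hypothesis sz : size (s1 ++ a :: b :: s2) = n.
Local Notation k := (size s1).
Local Notation E := (idem_seq (s1 ++ a :: b :: s2)).

Lemma psi_at_idem : psi_at k * E = idem_seq (s1 ++ b :: a :: s2) * psi_at k.
Proof.
by have [r [[_ -> _ _] [_ _ h]]] := list_pos sz; rewrite /idem_seq -h; exact: (psi_id D).
Qed.

Lemma psi_at_far : far a b -> psi_at k * (psi_at k * E) = E.
Proof.
have [r [[_ -> _ _] [h1 h2 _]]] := list_pos sz; case/and3P=> /eqP f1 /eqP f2 /eqP f3.
by rewrite mulrA; apply: (sq_far D); rewrite h1 h2.
Qed.

Lemma y_at_far : far a b -> y_at k.+1 * (psi_at k * E) = psi_at k * (y_at k * E).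
Proof.
have [r [[_ -> -> ->] [h1 h2 _]]] := list_pos sz; case/and3P=> f1 _ _.
by rewrite mulrA (y_hi_psi D) h1 h2 (negbTE f1) subr0 mulrA.
Qed.

Lemma psi_at_eq : a = b -> psi_at k * (psi_at k * E) = 0.
Proof.
have [r [[_ -> _ _] [h1 h2 _]]] := list_pos sz => ab.
by rewrite mulrA (sq_eq D) // h1 h2.
Qed.

(** On two strands of the same residue, [psi] and [y] satisfy the nil-Hecke relation, which
    expresses the idempotent by products that contain [psi]. *)
Lemma nilhecke_at : a = b -> E = y_at k * (psi_at k * E) - psi_at k * (y_at k.+1 * E).
Proof.
have [r [[_ -> -> ->] [h1 h2 _]]] := list_pos sz => ab.
by rewrite (mulrA (ps r)) (psi_y_hi D) h1 h2 ab eqxx mulrBl mul1r mulrA opprB addrCA subrr addr0.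
Qed.

(** The quadratic relation for adjacent residues, solved for the right-hand [y]. *)
Lemma psi_at_adj : b = a + 1 \/ b = a - 1 -> exists2 sg : A, (sg = 1 \/ sg = -1) &
  y_at k.+1 * E = y_at k * E + sg * (psi_at k * (psi_at k * E)).
Proof.
have [r [[_ -> -> ->] [h1 h2 _]]] := list_pos sz; rewrite mulrA.
case=> ab.
  exists 1; first by left.
  by rewrite (sq_up D) ?h1 ?h2 // mul1r -mulrDl addrC subrK.
exists (-1); first by right.
by rewrite (sq_down D) ?h1 ?h2 // mulN1r -mulNr -mulrDl opprB addrC subrK.
Qed.
End Two.

(** For residues [a, a - 1, a] the correction term of the braid relation is invertible, so
    the idempotent is a combination of the two products of three crossings. *)
Lemma braid_at s1 a s2 (k := size s1) (E := idem_seq (s1 ++ a :: (a - 1) :: a :: s2)) :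
  size (s1 ++ a :: (a - 1) :: a :: s2) = n -> exists2 sg : A, (sg = 1 \/ sg = -1) &
  E = sg * (psi_at k * (psi_at k.+1 * (psi_at k * E)) - psi_at k.+1 * (psi_at k * (psi_at k.+1 * E))).
Proof.
move=> sz; have [r [[rk Er _ _] [h1 h2 _]]] := list_pos sz.
have sz' : size (rcons s1 a ++ (a - 1) :: a :: s2) = n by rewrite cat_rcons.
have [s [[sk Es _ _] [_ h3 _]]] := list_pos sz'.
rewrite size_rcons in sk Es; rewrite cat_rcons in h3.
have sr : s = r.+1 :> nat by rewrite sk rk.
have := braid D (res_of_seq (s1 ++ a :: (a - 1) :: a :: s2)) sr.
rewrite -/E -/(idem_seq _) -/E /k Er Es !mulrA mulrDl => ->; rewrite addrAC subrr add0r.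
rewrite /braid_sign h1 h2 h3 eqxx subrK eqxx /=.
case: ifP => _; [exists (-1); first by right | exists 1; first by left].
  by rewrite !mulN1r opprK.
by rewrite !mul1r.
Qed.

Lemma idem_head0 c s : size (c :: s) = n -> (forall m, c <> kappa m) -> idem_seq (c :: s) = 0.
Proof.
move=> sz h; have n0 : (0 < n)%N by rewrite -sz.
by apply: (id0 D (k := Ordinal n0)) => // m; rewrite ffunE.
Qed.

Lemma idem_head01 m s : size [:: kappa m, kappa m + 1 & s] = n ->
  idem_seq [:: kappa m, kappa m + 1 & s] = 0.
Proof.
move=> sz; have n1 : (1 < n)%N by rewrite -sz.
by apply: (id01 D (k := Ordinal (ltnW n1)) (k' := Ordinal n1) (m := m)); rewrite // !ffunE.
Qed.

Lemma y_at_head m s : size (kappa m :: s) = n ->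
  y_at 0 * idem_seq (kappa m :: s) = sc (x m) * idem_seq (kappa m :: s).
Proof.
move=> sz; have n0 : (0 < n)%N by rewrite -sz.
rewrite -[0%N]/(Ordinal n0 : nat) y_atE.
by apply: (y_id0 D); rewrite // ffunE.
Qed.

Section InIdeal.
Variable I : A -> Prop.
Hypothesis idI : is_ideal sc ps yy ee I.

Lemma ideal_mem0 : I 0. Proof. by case: idI. Qed.
Lemma ideal_memD u v : I u -> I v -> I (u + v). Proof. by case: idI => _ h _ _; apply: h. Qed.
Lemma sc0 : sc 0 = 0.
Proof. by apply: (addrI (sc 0)); rewrite -(scD D) !addr0. Qed.
Lemma scN z : sc (- z) = - sc z.
Proof. by apply/eqP; rewrite -addr_eq0 -(scD D) addNr sc0. Qed.
Lemma ideal_memZ z u : I u -> I (sc z * u).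
Proof. by case: idI => _ _ h _; apply: h; constructor. Qed.
Lemma ideal_memN u : I u -> I (- u).
Proof. by rewrite -mulN1r -(sc1 D) -scN; apply: ideal_memZ. Qed.
Lemma ideal_memB u v : I u -> I v -> I (u - v).
Proof. by move=> h1 h2; apply: ideal_memD h1 _; apply: ideal_memN. Qed.
Lemma ideal_mem_sign (sg : A) u : sg = 1 \/ sg = -1 -> I u -> I (sg * u).
Proof. by case=> ->; rewrite ?mul1r // mulN1r; apply: ideal_memN. Qed.
Lemma ideal_psil k u : I u -> I (psi_at k * u).
Proof.
rewrite /psi_at; case: insub => [r|] /=; last by rewrite mul0r => _; apply: ideal_mem0.
by case: idI => _ _ h _; apply: h; constructor.
Qed.
Lemma ideal_psir k u : I u -> I (u * psi_at k).
Proof.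
rewrite /psi_at; case: insub => [r|] /=; last by rewrite mulr0 => _; apply: ideal_mem0.
by case: idI => _ _ _ h; apply: h; constructor.
Qed.
Lemma ideal_yl k u : I u -> I (y_at k * u).
Proof.
rewrite /y_at; case: insub => [r|] /=; last by rewrite mul0r => _; apply: ideal_mem0.
by case: idI => _ _ h _; apply: h; constructor.
Qed.
Lemma ideal_yr k u : I u -> I (u * y_at k).
Proof.
rewrite /y_at; case: insub => [r|] /=; last by rewrite mulr0 => _; apply: ideal_mem0.
by case: idI => _ _ _ h; apply: h; constructor.
Qed.

(** Crossing two far strands twice does nothing, and the idempotent in the middle of the
    double crossing is the one of the exchanged sequence. *)
Lemma far_swap s1 a b s2 : far a b -> size (s1 ++ a :: b :: s2) = n ->
  I (idem_seq (s1 ++ b :: a :: s2)) -> I (idem_seq (s1 ++ a :: b :: s2)).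
Proof.
by move=> f sz h; rewrite -psi_at_far //; apply: ideal_psil; rewrite psi_at_idem //; apply: ideal_psir.
Qed.

(** Its membership in [I] says that the [y] at position [k] acts on the idempotent of [s] as
    the scalar [z] modulo [I]. *)
Definition y_defect z k s := y_at k * idem_seq s - sc z * idem_seq s.

(** A dot slides through a crossing of far strands, so the eigenvalue of a strand is kept
    when it moves. *)
Lemma far_swap_y z s1 a b s2 : far a b -> size (s1 ++ a :: b :: s2) = n ->
  I (y_defect z (size s1) (s1 ++ b :: a :: s2)) -> I (y_defect z (size s1).+1 (s1 ++ a :: b :: s2)).
Proof.
move=> f sz h; have sz' : size (s1 ++ b :: a :: s2) = n by rewrite -sz !size_cat.
have -> : y_defect z (size s1).+1 (s1 ++ a :: b :: s2) =
    psi_at (size s1) * y_defect z (size s1) (s1 ++ b :: a :: s2) * psi_at (size s1).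
  rewrite /y_defect mulrBr mulrBl -(y_at_far sz') 1?far_sym //.
    have C := psi_at_idem sz; have Q := psi_at_far sz f.
    by rewrite (mulrA _ (sc z)) -(scC D) -!mulrA -C Q.
  by apply: ideal_psir; apply: ideal_psil.
Qed.

Lemma far_move s1 w b s2 : all (far b) w -> size (s1 ++ w ++ b :: s2) = n ->
  I (idem_seq (s1 ++ b :: w ++ s2)) -> I (idem_seq (s1 ++ w ++ b :: s2)).
Proof.
elim: w s1 => [s1 _ _ //|a w IH s1 /= /andP[f fw] sz h].
rewrite -cat_rcons; apply: IH; rewrite ?cat_rcons //.
apply: far_swap h; first by rewrite far_sym.
by move: sz; rewrite !size_cat /= !size_cat /=; lia.
Qed.

Lemma far_move_y z s1 w b s2 : all (far b) w -> size (s1 ++ w ++ b :: s2) = n ->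
  I (y_defect z (size s1) (s1 ++ b :: w ++ s2)) -> I (y_defect z (size s1 + size w) (s1 ++ w ++ b :: s2)).
Proof.
elim: w s1 => [s1 _ _|a w IH s1 /= /andP[f fw] sz h]; first by rewrite addn0.
rewrite -cat_rcons addnS -addSn -(size_rcons s1 a); apply: IH; rewrite ?cat_rcons //.
rewrite size_rcons; apply: far_swap_y h; first by rewrite far_sym.
by move: sz; rewrite !size_cat /= !size_cat /=; lia.
Qed.

(** If [y] acts on the left one of two equal strands as the scalar [z], then [psi E = psi (y
    - z) E psi] by the nil-Hecke relation and [psi^2 E = 0], so [psi E] is in [I]; and [E]
    itself is a combination of products that contain [psi E]. *)
Lemma equal_residues_mem z s1 a s2 : size (s1 ++ a :: a :: s2) = n ->
  I (y_defect z (size s1) (s1 ++ a :: a :: s2)) -> I (idem_seq (s1 ++ a :: a :: s2)).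
Proof.
set E := idem_seq _; set k := size s1 => sz h.
have C : psi_at k * E = E * psi_at k := psi_at_idem sz.
have P2 : psi_at k * (psi_at k * E) = 0 := psi_at_eq sz erefl.
have Q : E = y_at k * (psi_at k * E) - psi_at k * (y_at k.+1 * E) := nilhecke_at sz erefl.
have IP : I (psi_at k * E).
  have -> : psi_at k * E = psi_at k * y_defect z k (s1 ++ a :: a :: s2) * psi_at k.
    rewrite /y_defect -/E mulrBr mulrBl -!mulrA -C.
    rewrite (mulrA (psi_at k) (sc z)) -(scC D) -mulrA P2 mulr0 subr0.
    rewrite {1}Q mulrBr [X in _ - X](_ : _ = 0) ?subr0 //.
    by rewrite y_at_comm !mulrA -(mulrA _ _ E) P2 mul0r.
  by apply: ideal_psir; apply: ideal_psil.
rewrite Q; apply: ideal_memB; first exact: ideal_yl.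
by rewrite y_at_comm mulrA; apply: ideal_yr.
Qed.

(** The difference of two neighbouring [y] on adjacent residues is a double crossing, which
    factors through the exchanged sequence. *)
Lemma adjacent_y_mem z s1 a b s2 : size (s1 ++ a :: b :: s2) = n -> b = a + 1 \/ b = a - 1 ->
  I (y_defect z (size s1) (s1 ++ a :: b :: s2)) -> I (idem_seq (s1 ++ b :: a :: s2)) ->
  I (y_defect z (size s1).+1 (s1 ++ a :: b :: s2)).
Proof.
move=> sz ab h1 h2; have [sg hsg E] := psi_at_adj sz ab.
rewrite /y_defect E addrAC; apply: ideal_memD h1 _; apply: ideal_mem_sign hsg _; apply: ideal_psil.
by rewrite psi_at_idem //; apply: ideal_psir.
Qed.

(** In [braid_at] each of the two products factors through one of the two sequences in which
    the equal residues are neighbours. *)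
Lemma braid_mem s1 a s2 : size (s1 ++ a :: (a - 1) :: a :: s2) = n ->
  I (idem_seq (s1 ++ a :: a :: (a - 1) :: s2)) -> I (idem_seq (s1 ++ (a - 1) :: a :: a :: s2)) ->
  I (idem_seq (s1 ++ a :: (a - 1) :: a :: s2)).
Proof.
move=> sz h1 h2; have [sg hsg ->] := braid_at sz; apply: ideal_mem_sign hsg _; apply: ideal_memB.
  apply: ideal_psil; rewrite psi_at_idem // -cat_rcons mulrA -(size_rcons s1 (a - 1)) psi_at_idem.
    by rewrite cat_rcons; apply: ideal_psir; apply: ideal_psir.
  by rewrite cat_rcons -sz !size_cat.
apply: ideal_psil; rewrite -(cat_rcons a s1) -(size_rcons s1 a) psi_at_idem ?cat_rcons //.
rewrite mulrA psi_at_idem; last by rewrite -sz !size_cat.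
by apply: ideal_psir; apply: ideal_psir.
Qed.

End InIdeal.
End Lists.

(** * Boxes in row-reading order *)

Lemma eq_of_subr (V : zmodType) (u v p q : V) : u = v -> p - q = u - v -> p = q.
Proof. by move=> -> /eqP; rewrite subrr subr_eq0 => /eqP. Qed.

Section Rowlists.
Variables (e l n : nat) (kappa : 'I_l -> 'Z_e).
Hypothesis K1 : forall m m', m != m' -> far (kappa m) (kappa m').
Hypothesis K2 : forall m m' : 'I_l, (m < m')%N -> kappa m <> kappa m' + 2%:R.

(** The row, counted from 0, and the component. *)
Notation box := (nat * 'I_l)%type.
Implicit Types (b d : box) (bs : seq box) (r : nat) (m : 'I_l).

Definition box_lt b b' : bool := (b.1 < b'.1)%N || ((b.1 == b'.1) && (b.2 < b'.2)%N).
Definition box_res b : 'Z_e := kappa b.2 - b.1%:R.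
(** The base [n.+1] makes one box outweigh any [n] boxes of lower rows, so shapes can be
    compared by a number, and one can induct on it. *)
Definition row_weight r : nat := (n.+1 ^ (n - r))%N.
Definition boxes_weight bs : nat := (\sum_(b <- bs) row_weight b.1)%N.
(** The boxes of a shape in row-reading order; the second condition says that each column is
    filled from the top. *)
Definition reading_list bs : Prop :=
  sorted box_lt bs /\ forall r m, (r.+1, m) \in bs -> (r, m) \in bs.

Lemma box_lt_trans : transitive box_lt.
Proof. move=> [a b] [c d] [f g]; rewrite /box_lt /=; lia. Qed.

Lemma box_lt_irr : irreflexive box_lt.
Proof. move=> [a b]; rewrite /box_lt /=; lia. Qed.

Lemma sorted_cat_lt s1 s2 : sorted box_lt (s1 ++ s2) ->
  forall b b', b \in s1 -> b' \in s2 -> box_lt b b'.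
Proof.
rewrite (sorted_pairwise box_lt_trans) pairwise_cat => /and3P[/allrelP h _ _] b b'.
exact: h.
Qed.

Lemma reading_list_prefix s1 s2 : reading_list (s1 ++ s2) -> reading_list s1.
Proof.
move=> [S C]; split.
  by move: S; rewrite !(sorted_pairwise box_lt_trans) pairwise_cat => /and3P[].
move=> r m h; have := C r m; rewrite !mem_cat h => /(_ isT) /orP[//|h2].
have := sorted_cat_lt S h h2; rewrite /box_lt /=; lia.
Qed.

Lemma reading_list_uniq bs : reading_list bs -> uniq bs.
Proof. by case=> S _; apply: sorted_uniq S; [exact: box_lt_trans | exact: box_lt_irr]. Qed.

Lemma reading_list_col bs r m r' : reading_list bs -> (r, m) \in bs -> (r' <= r)%N -> (r', m) \in bs.
Proof.
move=> [_ C]; elim: r => [|r IH] h; first by rewrite leqn0 => /eqP ->.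
by rewrite leq_eqVlt => /orP[/eqP ->|/IH] //; apply; apply: C.
Qed.

Lemma reading_list_row_lt bs r m : reading_list bs -> (r, m) \in bs -> (r < size bs)%N.
Proof.
move=> R h; have -> : r.+1 = size [seq (i, m) | i <- iota 0 r.+1].
  by rewrite size_map size_iota.
apply: uniq_leq_size; first by rewrite map_inj_uniq ?iota_uniq // => i j [].
move=> b /mapP[i]; rewrite mem_iota add0n ltnS => /andP[_ le] ->.
exact: reading_list_col h le.
Qed.

Lemma boxes_weightD s1 s2 : boxes_weight (s1 ++ s2) = (boxes_weight s1 + boxes_weight s2)%N.
Proof. by rewrite /boxes_weight big_cat. Qed.

Lemma boxes_weight_cons b bs : boxes_weight (b :: bs) = (row_weight b.1 + boxes_weight bs)%N.
Proof. by rewrite /boxes_weight big_cons. Qed.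

Lemma row_weight_gt0 r : (0 < row_weight r)%N.
Proof. by rewrite /row_weight expn_gt0. Qed.

Lemma row_weight_le r r' : (r <= r')%N -> (row_weight r' <= row_weight r)%N.
Proof. by move=> h; rewrite /row_weight leq_pexp2l // leq_sub2l. Qed.

Lemma row_weight_lt r r' : (r < r')%N -> (r' <= n)%N -> (n.+1 * row_weight r' <= row_weight r)%N.
Proof. by move=> h h'; rewrite /row_weight -expnS leq_pexp2l //; lia. Qed.

Lemma boxes_weight_le r bs : (forall b, b \in bs -> (r <= b.1)%N) -> (boxes_weight bs <= size bs * row_weight r)%N.
Proof.
elim: bs => [|b bs IH] h; first by rewrite /boxes_weight big_nil.
rewrite boxes_weight_cons /= mulSn leq_add ?IH ?row_weight_le //; first by apply: h; rewrite mem_head.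
by move=> b' hb'; apply: h; rewrite inE hb' orbT.
Qed.

Lemma tail_ge s1 d s2 b : sorted box_lt (s1 ++ d :: s2) -> b \in d :: s2 -> (d.1 <= b.1)%N.
Proof.
move=> S; rewrite inE => /orP[/eqP -> //|h].
have := @sorted_cat_lt (rcons s1 d) s2; rewrite cat_rcons => /(_ S d b).
rewrite mem_rcons mem_head => /(_ isT h); rewrite /box_lt; lia.
Qed.

(** The boxes after [d] are in the row of [d] or below. For lists of at most [n] boxes the
    right-hand side is smaller than if [d] and all that follows were replaced by one box of
    a higher row. *)
Lemma boxes_weight_tail s1 d s2 : sorted box_lt (s1 ++ d :: s2) ->
  (boxes_weight (s1 ++ d :: s2) <= boxes_weight s1 + (size s2).+1 * row_weight d.1)%N.
Proof.
move=> S; rewrite boxes_weightD leq_add2l -[(size s2).+1]/(size (d :: s2)); apply: boxes_weight_le => b hb.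
exact: tail_ge S hb.
Qed.

Lemma far_same_row m m' r : m != m' -> far (box_res (r, m)) (box_res (r, m')).
Proof.
move=> /K1 /and3P[/eqP h1 /eqP h2 /eqP h3].
by apply/and3P; split; apply/eqP=> H; [apply: h1 | apply: h2 | apply: h3];
  apply: (eq_of_subr H); rewrite /box_res /=; ring.
Qed.

(** The residues differ by [kappa m' - kappa m + 1], which is none of 1, 0, -1 because
    [kappa m] is neither equal to [kappa m'], nor greater by 1, nor, as [m] precedes [m'],
    greater by 2. *)
Lemma far_next_row m m' r : (m < m')%N -> far (box_res (r, m')) (box_res (r.+1, m)).
Proof.
move=> lt; have ne : m != m' by rewrite neq_ltn lt.
have /and3P[/eqP h1 /eqP h2 /eqP h3] := K1 ne; have h4 := K2 lt.
apply/and3P; split; apply/eqP=> H; [apply: h2 | apply: h1 | apply: h4];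
  apply: esym; apply: (eq_of_subr H); rewrite /box_res /=; ring.
Qed.

Lemma box_resS r m : box_res (r.+1, m) = box_res (r, m) - 1.
Proof. by rewrite /box_res /=; ring. Qed.

(** In row-reading order only the rest of the row of the upper box and the beginning of the
    row of the lower one come in between. This is where the order of the charges enters: a
    strand can move between two vertically adjacent boxes through all the others. *)
Lemma between_far r m b : box_lt (r, m) b -> box_lt b (r.+1, m) ->
  far (box_res b) (box_res (r, m)) /\ far (box_res b) (box_res (r.+1, m)).
Proof.
case: b => r' m'; rewrite /box_lt /= => h1 h2.
have [E|[E lt]] : (r' = r /\ (m < m')%N) \/ (r' = r.+1 /\ (m' < m)%N) by lia.
  case: E => -> lt; split; last exact: far_next_row.
  by apply: far_same_row; rewrite neq_ltn lt orbT.
rewrite E; split; first by rewrite far_sym; apply: far_next_row.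
by apply: far_same_row; rewrite neq_ltn lt.
Qed.

Lemma window_far s1 r m w s2 b :
  sorted box_lt (s1 ++ (r, m) :: w ++ (r.+1, m) :: s2) -> b \in w ->
  far (box_res b) (box_res (r, m)) /\ far (box_res b) (box_res (r.+1, m)).
Proof.
move=> S hb; apply: between_far.
  have := @sorted_cat_lt (rcons s1 (r, m)) (w ++ (r.+1, m) :: s2).
  by rewrite cat_rcons => /(_ S); apply; rewrite ?mem_rcons ?mem_head // mem_cat hb.
have := @sorted_cat_lt (s1 ++ (r, m) :: w) ((r.+1, m) :: s2).
by rewrite -catA => /(_ S); apply; rewrite ?mem_head // mem_cat inE hb !orbT.
Qed.

(** The residue [kappa m + 1] is that of a fictitious box above the first row, to which
    [far_next_row] applies after a shift by one row. *)
Lemma row0_far s1 m s2 b : sorted box_lt (s1 ++ (0%N, m) :: s2) -> b \in s1 ->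
  far (box_res b) (kappa m) /\ far (box_res b) (kappa m + 1).
Proof.
move=> S hb; have := sorted_cat_lt S hb (mem_head _ _).
case: b hb => r' m' _; rewrite /box_lt /= => h.
have [-> lt] : r' = 0%N /\ (m' < m)%N by lia.
have -> : kappa m = box_res (0%N, m) by rewrite /box_res subr0.
split; first by apply: far_same_row; rewrite neq_ltn lt.
have := far_next_row 0 lt; rewrite far_sym box_resS => /and3P[/eqP h1 /eqP h2 /eqP h3].
by apply/and3P; split; apply/eqP=> H; [apply: h1 | apply: h2 | apply: h3];
   apply: (eq_of_subr H); ring.
Qed.

Lemma last_near_box c bs : all (far c) (map box_res bs) \/
  exists s1 d s2, [/\ bs = s1 ++ d :: s2, ~~ far c (box_res d) & all (far c) (map box_res s2)].
Proof.
elim: bs => [|d bs IH]; first by left.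
case: IH => [A|[s1 [d' [s2 [-> h1 h2]]]]]; last by right; exists (d :: s1), d', s2.
case: (boolP (far c (box_res d))) => h; first by left; rewrite /= h.
by right; exists [::], d, bs.
Qed.

(** A box that can be added to the shape has its own place in the row-reading order. *)
Lemma reading_list_insert bs b : reading_list bs -> b \notin bs ->
  (forall r, b.1 = r.+1 -> (r, b.2) \in bs) ->
  exists sa sb, [/\ bs = sa ++ sb, reading_list (sa ++ b :: sb)
    & forall d, d \in sb -> box_lt b d].
Proof.
move=> [S C] nb hb.
have [sa [sb [E h1 h2]]] : exists sa sb, [/\ bs = sa ++ sb,
    forall d, d \in sa -> box_lt d b & forall d, d \in sb -> box_lt b d].
  elim: bs S nb {C hb} => [|d bs IH] S nb; first by exists [::], [::].
  case: (boolP (box_lt b d)) => bd.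
    exists [::], (d :: bs); split=> // d'; rewrite inE => /orP[/eqP -> //|h].
    move: S; rewrite /= (path_sortedE box_lt_trans) => /andP[/allP /(_ _ h) h' _].
    exact: box_lt_trans bd h'.
  have db : box_lt d b.
    move: nb bd {S IH}; rewrite inE negb_or => /andP[nb _]; case: b d nb => [r m] [r' m'].
    by rewrite xpair_eqE -val_eqE /box_lt /=; lia.
  have [|sa [sb [E h1 h2]]] := IH (path_sorted S) _.
    by move: nb; rewrite inE negb_or => /andP[].
  exists (d :: sa), sb; split; rewrite ?E // => d'; rewrite inE => /orP[/eqP -> //|].
  exact: h1.
exists sa, sb; split=> //; split.
  move: S; rewrite E !(sorted_pairwise box_lt_trans) !pairwise_cat pairwise_cons.
  case/and3P=> a1 -> ->; rewrite andbT /=; apply/andP; split; last by apply/allP => d /h2.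
  apply/allrelP=> d d' hd; rewrite inE => /orP[/eqP ->|hd']; first exact: h1.
  by move/allrelP: a1; apply.
move=> r m; have perm_mem : (sa ++ b :: sb) =i b :: bs.
  by move=> d; rewrite E !(mem_cat, inE); do !case: (_ == _) (_ \in _) => [] [].
rewrite !perm_mem !inE => /orP[/eqP Eb|/C -> //]; last by rewrite orbT.
by have := hb r; rewrite -Eb => /(_ erefl) ->; rewrite orbT.
Qed.

End Rowlists.

(** * Residue idempotents and the ideals of the shapes *)

Section Claims.
Variables (e l n : nat) (kappa : 'I_l -> 'Z_e) (R : comNzRingType) (A : pzRingType)
  (sc : R -> A) (x : 'I_l -> R) (ps : 'I_n.-1 -> A) (yy : 'I_n -> A) (ee : resseq e n -> A).
Hypothesis D : deformed_blob kappa sc x ps yy ee.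
Hypothesis K1 : forall m m', m != m' -> far (kappa m) (kappa m').
Hypothesis K2 : forall m m' : 'I_l, (m < m')%N -> kappa m <> kappa m' + 2%:R.

Local Notation box := (nat * 'I_l)%type.
Implicit Types (b d : box) (bs : seq box) (r : nat) (m : 'I_l) (s : seq 'Z_e).
Local Notation box_res := (box_res kappa).
Local Notation res := (map box_res).
Local Notation idem_seq := (idem_seq ee).
Local Notation y_defect := (y_defect sc yy ee).
Local Notation row_weight := (row_weight n).
Local Notation boxes_weight := (boxes_weight n).

Lemma kappa_adj m m' : kappa m <> kappa m' - 1.
Proof.
case: (eqVneq m m') => [->|/K1 /and3P[_ _ /eqP] //].
by move/eqP; rewrite -subr_eq0 opprB addrCA subrr addr0 oner_eq0.
Qed.

Lemma kappa_inj m m' : kappa m = kappa m' -> m = m'.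
Proof. by case: (eqVneq m m') => [//|/K1 /and3P[/eqP]]. Qed.

Section OneIdeal.
Variables (I : A -> Prop) (X : nat).
Hypothesis idI : is_ideal sc ps yy ee I.
Hypothesis HX : forall bs s, reading_list bs -> size bs + size s = n -> (X <= boxes_weight bs)%N ->
  I (idem_seq (res bs ++ s)).

(** The [y] at the strand of the box [d], placed after [bs], is a scalar modulo [I]. *)
Definition y_eigen bs d : Prop := forall s, size bs + (size s).+1 = n ->
  I (y_defect (x d.2) (size bs) (res bs ++ box_res d :: s)).

(** The box below [d] cannot be read right after [bs] while [d] itself is skipped. *)
Definition skip_kills bs d : Prop := forall s, size bs + (size s).+1 = n ->
  I (idem_seq (res bs ++ (box_res d - 1) :: s)).

(** A strand of residue [c] after [bs] moves to the left until it meets a strand of residue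
    [c], [c + 1] or [c - 1], say of the box [d]. Residue [c + 1], or the left end with [c] a
    charge: the strand belongs to an addable box and takes its place in row-reading order,
    which gives a shape of weight at least [X]; at the left end with [c] not a charge the
    idempotent is 0. Residue [c]: the nil-Hecke relation applies, by the eigenvalue of [y]
    at [d]. Residue [c - 1]: the box above [d] has residue [c], all boxes between it and [d]
    are far, and the braid relation replaces [c, c - 1, c] by a sequence with equal
    neighbours and one that skips the box above [d]; in the first row, the relation on the
    first two residues applies. *)
Lemma absorb_strand bs c s : reading_list bs -> size bs + (size s).+1 = n ->
  (forall sa b sb, bs = sa ++ sb -> reading_list (sa ++ b :: sb) -> box_res b = c ->
     (X <= boxes_weight bs + row_weight b.1)%N) ->
  (forall (s1 : seq box) d (s2 : seq box), bs = s1 ++ d :: s2 -> box_res d = c -> y_eigen s1 d /\ skip_kills s1 d) ->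
  I (idem_seq (res bs ++ c :: s)).
Proof.
move=> Rb sz hA hB.
have add b sa sb : bs = sa ++ sb -> reading_list (sa ++ b :: sb) -> box_res b = c ->
    all (far c) (res sb) -> I (idem_seq (res bs ++ c :: s)).
  move=> E Rb' Eb fsb; rewrite E map_cat -catA; apply: (far_move D idI) => //.
    by move: sz; rewrite E !size_cat /= !size_map; lia.
  have := @HX (sa ++ b :: sb) s; rewrite map_cat /= -catA /= Eb; apply=> //.
    by move: sz; rewrite E !size_cat /=; lia.
  by have := hA _ _ _ E Rb' Eb; rewrite E !boxes_weightD boxes_weight_cons; lia.
(* The last box of [bs] which the strand cannot pass. *)
have [fr|[s1 [[r m] [s2 [E nf fr]]]]] := last_near_box kappa c bs.
  case: (pickP (fun m => c == kappa m)) => [m /eqP Ec|noc].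
    have Eb : box_res (0%N, m) = c by rewrite /box_res /= subr0.
    have nb : (0%N, m) \notin bs.
      apply/negP => h; have := allP fr (box_res (0%N, m)).
      by rewrite map_f // Eb farxx => /(_ isT).
    have [|sa [sb [E Rb' _]]] := reading_list_insert Rb nb; first by [].
    apply: (add _ _ _ E Rb' Eb); apply/allP => d hd; move/allP: fr; apply.
    by rewrite E map_cat mem_cat hd orbT.
  rewrite -[res bs ++ _]cat0s; apply: (far_move D idI) => //.
    by rewrite /= size_cat size_map.
  rewrite /= (idem_head0 D) //; first exact: (ideal_mem0 idI).
    by move: sz; rewrite /= !size_cat ?size_map; lia.
  by move=> m Ec; have := noc m; rewrite Ec eqxx.
(* The box below [(r, m)] can be added, since it would be a later box that [c] cannot pass. *)
have [Ec|nEc] := eqVneq c (box_res (r, m) - 1).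
  have nb : (r.+1, m) \notin bs.
    apply/negP; rewrite E mem_cat inE => /or3P[h|/eqP[]|h]; last 1 first.
    - by have := allP fr (box_res (r.+1, m)); rewrite map_f // box_resS Ec farxx => /(_ isT).
    - case: Rb; rewrite E => S' _; have := sorted_cat_lt S' h (mem_head _ _).
      by rewrite /box_lt /=; lia.
    - by lia.
  have [r'|sa [sb [E' Rb' hsb]]] := reading_list_insert Rb nb.
    by move=> [<-]; rewrite E mem_cat mem_head orbT.
  apply: (add _ _ _ E' Rb'); first by rewrite box_resS.
  apply/allP => _ /mapP[d hd ->]; have := hsb d hd => lt.
  have : d \in bs by rewrite E' mem_cat hd orbT.
  rewrite E mem_cat inE => /or3P[h|/eqP Ed|h].
  - case: Rb; rewrite E => S' _; have := sorted_cat_lt S' h (mem_head _ _).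
    by move: lt; rewrite /box_lt /=; lia.
  - by move: lt; rewrite Ed /box_lt /=; lia.
  - by apply: (allP fr); rewrite map_f.
have Rs1 : reading_list (s1 ++ [:: (r, m)]) by move: Rb; rewrite E -cat_rcons -cats1; apply: reading_list_prefix.
have szE : size (res s1 ++ box_res (r, m) :: c :: res s2 ++ s) = n.
  by move: sz; rewrite E !size_cat /= size_cat !size_map; lia.
(* Otherwise the strand is moved until it is the right neighbour of [(r, m)]. *)
rewrite E map_cat /= -(cat_rcons (box_res (r, m))) -catA; apply: (far_move D idI) => //.
  by move: szE; rewrite !size_cat size_rcons !size_map /= size_cat !size_map /=; lia.
rewrite cat_rcons.
have {nEc} : c = box_res (r, m) \/ c = box_res (r, m) + 1.
  by case: (notfar nf) => H; [left | right | rewrite H eqxx in nEc].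
case=> Ec.
- rewrite Ec in szE *; have [hy _] := hB _ _ _ E (esym Ec).
  apply: (equal_residues_mem D idI (z := x m)) => //; rewrite size_map; apply: (hy (box_res (r, m) :: _)).
  by move: szE; rewrite !size_cat /= size_map; lia.
- case: r => [|r] in E nf Ec Rs1 szE *.
    have S0 : sorted (@box_lt l) (s1 ++ [:: (0%N, m)]) by case: Rs1.
    have Ek : box_res (0%N, m) = kappa m by rewrite /box_res /= subr0.
    rewrite Ek in Ec szE *; rewrite Ec in szE *.
    have fk : all (far (kappa m)) (res s1).
      by apply/allP => _ /mapP[b hb ->]; rewrite far_sym; case: (row0_far K1 K2 S0 hb).
    have fk1 : all (far (kappa m + 1)) (res s1).
      by apply/allP => _ /mapP[b hb ->]; rewrite far_sym; case: (row0_far K1 K2 S0 hb).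
    rewrite -[res s1 ++ _]cat0s; apply: (far_move D idI) => //.
    rewrite cat0s -cat1s; apply: (far_move D idI) => //.
      by move: szE; rewrite /= !size_cat /= !size_cat ?size_map; lia.
    rewrite /= (idem_head01 D); first exact: (ideal_mem0 idI).
    by move: szE; rewrite /= !size_cat /= !size_cat ?size_map; lia.
  have hin : (r, m) \in s1.
    case: Rs1 => S /(_ r m); rewrite !mem_cat mem_head orbT => /(_ isT).
    by rewrite inE => /orP[//|/eqP[]]; lia.
  have [t1 [w Es1]] : exists t1 w, s1 = t1 ++ (r, m) :: w.
    by case/splitPr: hin => t1 w; exists t1, w.
  have Ec' : box_res (r, m) = c by rewrite Ec box_resS subrK.
  have Eb : bs = t1 ++ (r, m) :: (w ++ (r.+1, m) :: s2) by rewrite E Es1 -catA.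
  have [hy hs] := hB _ _ _ Eb Ec'.
  have wf b : b \in w -> far (box_res b) (box_res (r, m)) /\ far (box_res b) (box_res (r.+1, m)).
    move=> hb; case: Rb => S _; move: S; rewrite E Es1 -catA => S.
    exact: (window_far K1 K2 S hb).
  have f1 : all (far (c - 1)) (res w).
    by apply/allP => _ /mapP[b /wf [_ h] ->]; rewrite far_sym -Ec' -box_resS.
  have f2 : all (far c) (res w).
    by apply/allP => _ /mapP[b /wf [h _] ->]; rewrite far_sym -Ec'.
  move: szE; rewrite Es1 map_cat box_resS /= Ec' -catA /= => szE.
  (* First the strand of [(r.+1, m)], then the strand [c] move next to that of [(r, m)]. *)
  rewrite -cat_rcons; apply: (far_move D idI) => //; first by rewrite cat_rcons.
  rewrite -cat_rcons; apply: (far_move D idI) => //.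
    by move: szE; rewrite !size_cat /= !size_cat !size_rcons /= !size_cat /= !size_map; lia.
  rewrite !cat_rcons.
  have szF : size t1 + (size w + (size s2 + size s)).+3 = n.
    by move: szE; rewrite !size_cat /= !size_cat /= !size_cat !size_map; lia.
  apply: (braid_mem D idI).
  + by rewrite !size_cat /= !size_cat !size_map.
  + apply: (equal_residues_mem D idI (z := x m)); first by rewrite !size_cat /= !size_cat !size_map.
    rewrite size_map -{1}Ec'; apply: hy => /=; rewrite !size_cat !size_map; exact: szF.
  + rewrite -{1}Ec'; apply: hs => /=; rewrite !size_cat !size_map; exact: szF.
Qed.


(** Induction on the length of [bs]. The eigenvalue: the strand of [d] moves to the left up
    to the strand of the box [d'] above it (or to the left end), where the [y] of the two
    differ by a double crossing through a sequence that skips [d']. The skipping: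
    [absorb_strand] applies, as the boxes of residue [box_res d - 1] which precede [d] or
    can be added are in rows above that of [d], and one box there weighs at least as much as
    [n.+1] boxes of the row of [d]. *)
Lemma y_eigen_and_skip bs d : reading_list (rcons bs d) -> (size bs < n)%N ->
  (X <= boxes_weight bs + n.+1 * row_weight d.1)%N -> y_eigen bs d /\ skip_kills bs d.
Proof.
have [N] := ubnP (size bs); elim: N bs d => // N IH bs [r m] bN Rb bn hX.
have Rb' : reading_list bs by move: Rb; rewrite -cats1; apply: reading_list_prefix.
have Sb : sorted (@box_lt l) (bs ++ [:: (r, m)]) by rewrite cats1; case: Rb.
have rn : (r < n)%N.
  have := reading_list_row_lt Rb; rewrite size_rcons => /(_ r m).
  by rewrite mem_rcons mem_head => /(_ isT); lia.
have Ms (s1 : seq box) d' (s2 : seq box) : bs = s1 ++ d' :: s2 -> (d'.1 < r)%N ->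
    (X <= boxes_weight s1 + n.+1 * row_weight d'.1)%N /\ reading_list (rcons s1 d').
  move=> E lt; split.
    have := @boxes_weight_tail l n s1 d' s2; rewrite -E; case: (Rb') => S _ /(_ S).
    have := row_weight_lt lt (ltnW rn); move: hX => /=; have : (size s2 < n)%N.
      by move: bn; rewrite E size_cat /=; lia.
    move=> h1 h2 h3 h4; apply: (leq_trans h2); apply: leq_trans (leq_add h4 h3) _.
    by rewrite -addnA leq_add2l -mulSnr leq_mul2r ltnS h1 orbT.
  by move: Rb'; rewrite E -cat_rcons; apply: reading_list_prefix.
have lt_rm b : b \in bs -> box_lt b (r, m).
  by move=> hb; apply: (sorted_cat_lt Sb hb); rewrite mem_head.
split; last first.
  move=> s sz; apply: absorb_strand => //.
  - move=> sa [r' m'] sb E Rsb Ec /=; apply: (leq_trans hX); rewrite leq_add2l.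
    apply: row_weight_lt; rewrite ?(ltnW rn) //= ltnNge; apply/negP => le.
    have [E0|E1] : r' = r \/ r' = r.+1 /\ (r, m') \in bs.
      case: r' => [|r'] in Rsb Ec le *; first by left; lia.
      have hb : (r', m') \in bs.
        have [_ /(_ r' m')] := Rsb; rewrite !mem_cat mem_head orbT E mem_cat => /(_ isT).
        by rewrite inE => /or3P[->|/eqP[]|->]; rewrite ?orbT //; lia.
      have := lt_rm _ hb; rewrite /box_lt /= => lt.
      have [Er|Er] : r'.+1 = r \/ r' = r by lia.
        by left.
      by right; rewrite -Er.
    + apply: (@kappa_adj m' m); apply: (eq_of_subr Ec).
      by rewrite /box_res /= E0; ring.
    + case: E1 => E1 hb; have Em : kappa m' = kappa m.
        by apply: (eq_of_subr Ec); rewrite /box_res /= E1; ring.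
      by have := lt_rm _ hb; rewrite (kappa_inj Em) box_lt_irr.
  - move=> s1 [r' m'] s2 E Ec.
    have hd : (r', m') \in bs by rewrite E mem_cat mem_head orbT.
    have [|h1 h2] := Ms _ _ _ E.
      have := lt_rm _ hd; rewrite /box_lt /= => /orP[//|/andP[/eqP Er _]].
      case: (@kappa_adj m' m); apply: (eq_of_subr Ec).
      by rewrite /box_res /= Er; ring.
    have sz1 : (size s1 < size bs)%N by rewrite E size_cat /=; lia.
    by apply: IH => //; lia.
move=> s sz; rewrite /= -[res bs ++ _]cat0s; case: r => [|r] in Rb hX Sb rn Ms lt_rm *.
  have f : all (far (box_res (0%N, m))) (res bs).
    apply/allP => _ /mapP[[r' m'] hb ->]; have := lt_rm _ hb; rewrite /box_lt /= => lt.
    have [-> lt'] : r' = 0%N /\ (m' < m)%N by lia.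
    by apply: (far_same_row K1); rewrite neq_ltn lt' orbT.
  rewrite -[size bs]add0n -(size_map box_res bs).
  apply: (far_move_y D idI (s1 := [::])) => //; first by rewrite /= size_cat size_map.
  have Ek : box_res (0%N, m) = kappa m by rewrite /box_res /= subr0.
  rewrite /= /y_defect Ek (y_at_head D) ?subrr; first exact: (ideal_mem0 idI).
  by move: sz; rewrite /= size_cat size_map; lia.
have hin : (r, m) \in bs.
  have [_ /(_ r m)] := Rb; rewrite !mem_rcons mem_head => /(_ isT).
  by rewrite inE => /orP[/eqP[]|//]; lia.
have [s1 [w E]] : exists s1 w : seq box, bs = s1 ++ (r, m) :: w.
  by case/splitPr: hin => t1 w; exists t1, w.
have [|h1 h2] := Ms _ _ _ E; first exact: ltnSn.
have sz1 : (size s1 < size bs)%N by rewrite E size_cat /=; lia.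
have [||||hy hs] := IH s1 (r, m) => //; [lia | lia |].
have fw : all (far (box_res (r.+1, m))) (res w).
  apply/allP => _ /mapP[b hb ->]; move: Sb; rewrite E -catA => Sb.
  by rewrite far_sym; case: (window_far K1 K2 Sb hb).
rewrite cat0s E map_cat size_cat /= -(cat_rcons (box_res (r, m))) -addSnnS -(size_map box_res s1).
rewrite -(size_rcons (res s1) (box_res (r, m))) -(size_map box_res w) -catA.
have szT : size s1 + (size w + size s).+2 = n by move: sz; rewrite E size_cat /=; lia.
apply: (far_move_y D idI) => //.
  by rewrite size_cat size_rcons size_cat !size_map /= -szT; lia.
rewrite size_rcons cat_rcons; apply: (adjacent_y_mem D idI).
- by rewrite !size_cat /= size_cat !size_map.
- by right; rewrite box_resS.
- by rewrite size_map; apply: hy; rewrite /= size_cat size_map -szT.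
- by rewrite box_resS; apply: hs; rewrite /= size_cat size_map -szT.
Qed.

End OneIdeal.

(** The least ideal, in the sense of [is_ideal], that contains the residue idempotents of
    the shapes of weight at least [X]. *)
Inductive cell_ideal (X : nat) : A -> Prop :=
| CellGen bs of reading_list bs & size bs = n & (X <= boxes_weight bs)%N : cell_ideal X (idem_seq (res bs))
| Cell0 : cell_ideal X 0
| CellD (a b : A) of cell_ideal X a & cell_ideal X b : cell_ideal X (a + b)
| CellL (g a : A) of is_gen sc ps yy ee g & cell_ideal X a : cell_ideal X (g * a)
| CellR (g a : A) of is_gen sc ps yy ee g & cell_ideal X a : cell_ideal X (a * g).

Lemma cell_ideal_is_ideal X : is_ideal sc ps yy ee (cell_ideal X).
Proof. by split; [apply: Cell0 | apply: CellD | apply: CellL | apply: CellR]. Qed.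

Lemma cell_ideal_mono X X' a : (X <= X')%N -> cell_ideal X' a -> cell_ideal X a.
Proof.
move=> le; elim=> {a} [bs R1 s1 h||a b _ h _ h'|g a hg _ h|g a hg _ h].
- by apply: CellGen => //; apply: leq_trans h.
- exact: Cell0.
- exact: CellD.
- exact: CellL.
- exact: CellR.
Qed.

(** A shape can also be completed by arbitrary residues. Downward induction on the weight:
    modulo the shapes heavier than [bs], the first strand after [bs] is absorbed. *)
Lemma cell_idem X bs s : reading_list bs -> size bs + size s = n -> (X <= boxes_weight bs)%N ->
  cell_ideal X (idem_seq (res bs ++ s)).
Proof.
have bnd bs' : (size bs' <= n)%N -> (boxes_weight bs' <= n * row_weight 0)%N.
  move=> h; apply: (leq_trans (@boxes_weight_le _ n 0 bs' _)) => //.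
  by rewrite leq_mul2r h orbT.
move: {2}((n * row_weight 0).+1 - X)%N (leqnn ((n * row_weight 0).+1 - X)) => k.
elim: k X bs s => [|k IH] X bs s hk Rb sz hX.
  have := bnd bs; have : (size bs <= n)%N by lia.
  by move=> h /(_ h); lia.
move: hX; rewrite leq_eqVlt => /orP[/eqP EX|lt]; last first.
  by apply: (@cell_ideal_mono X X.+1) => //; apply: IH => //; lia.
case: s => [|c s] in sz *.
  rewrite cats0; apply: CellGen => //; first by move: sz => /=; lia.
  by rewrite EX.
apply: (@cell_ideal_mono X X.+1) => //.
have idX := cell_ideal_is_ideal X.+1.
have HX bs' s' : reading_list bs' -> size bs' + size s' = n -> (X.+1 <= boxes_weight bs')%N ->
    cell_ideal X.+1 (idem_seq (res bs' ++ s')).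
  by move=> *; apply: IH => //; have := bnd bs'; lia.
apply: (absorb_strand idX HX) => //.
  by move=> sa b sb _ _ _; rewrite EX; have := row_weight_gt0 n b.1; lia.
move=> s1 d s2 E Ed; apply: (y_eigen_and_skip idX HX).
- by move: Rb; rewrite E -cat_rcons; apply: reading_list_prefix.
- by move: sz; rewrite E size_cat /=; lia.
have [S _] := Rb; have := @boxes_weight_tail l n s1 d s2; rewrite -E => /(_ S); rewrite EX => h.
apply: (leq_ltn_trans h); rewrite ltn_add2l ltn_mul2r row_weight_gt0 /=.
by move: sz; rewrite E size_cat /=; lia.
Qed.

End Claims.

(** * Shapes as lists of boxes *)

Section Shapes.
Variables (e l n : nat) (kappa : 'I_l -> 'Z_e).
Local Notation box := (nat * 'I_l)%type.
Implicit Types (lam : par1 l n) (k : 'I_n).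

Definition node_box (y : node l n) : box := (nat_of_ord y.1, y.2).

Definition init_node lam k : node l n := val (init_tab lam) k.

Definition boxes lam : seq box := [seq node_box (init_node lam k) | k <- enum 'I_n].

Definition shape_weight lam : nat := boxes_weight n (boxes lam).

Lemma res_node_box y : res kappa y = box_res kappa (node_box y).
Proof. by case: y => r m; rewrite /res /box_res /= -natr1 opprD addrA addrAC addrK. Qed.

Lemma res_parE lam k : res_par kappa lam k = box_res kappa (node_box (init_node lam k)).
Proof. by rewrite [LHS]ffunE res_node_box. Qed.

Lemma size_boxes lam : size (boxes lam) = n.
Proof. by rewrite size_map size_enum_ord. Qed.

Lemma nth_boxes lam b0 k : nth b0 (boxes lam) k = node_box (init_node lam k).
Proof. by rewrite (nth_map k) ?size_enum_ord // nth_ord_enum. Qed.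

Lemma box_lt_init lam k k' : (k < k')%N -> box_lt (node_box (init_node lam k)) (node_box (init_node lam k')).
Proof. by move/(init_tab_decr lam); rewrite /node_lt /box_lt /= -val_eqE eq_sym. Qed.

Lemma box_lt_initE lam k k' : box_lt (node_box (init_node lam k)) (node_box (init_node lam k')) = (k < k')%N.
Proof.
case: (ltngtP k k') => [/(box_lt_init lam) //|/(box_lt_init lam) h|/val_inj ->]; last exact: box_lt_irr.
by apply/negP => h'; have := box_lt_trans h h'; rewrite box_lt_irr.
Qed.

Lemma mem_boxes lam r m : ((r, m) \in boxes lam) = (r < val lam m)%N.
Proof.
have T : [set init_node lam k | k in [set: 'I_n]] = diagram lam.
  by have /andP[_ /eqP] := valP (init_tab lam).
apply/mapP/idP => [[k _ E]|lt].
  have : init_node lam k \in diagram lam by rewrite -T imset_f.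
  by rewrite inE; case: E => -> ->.
have rn : (r < n)%N by rewrite (leq_trans lt) // -ltnS.
have : (Ordinal rn, m) \in diagram lam by rewrite inE.
by rewrite -T => /imsetP[k _ E]; exists k; rewrite ?mem_enum // -E.
Qed.

Lemma boxes_reading_list lam : reading_list (boxes lam).
Proof.
split; last by move=> r m; rewrite !mem_boxes; apply: ltnW.
case: (posnP n) => [n0|n0].
  by have := size_boxes lam; rewrite n0 => /size0nil ->.
pose k0 := Ordinal n0; apply/(sortedP (node_box (init_node lam k0))) => i; rewrite size_boxes => lt.
have -> : i = Ordinal (ltnW lt) :> nat by [].
by rewrite -[i.+1]/(Ordinal lt : nat) !nth_boxes box_lt_init /=.
Qed.

Lemma res_of_boxes lam : res_of_seq n (map (box_res kappa) (boxes lam)) = res_par kappa lam.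
Proof.
apply/ffunP=> k; rewrite !ffunE (nth_map (node_box (init_node lam k))) ?size_boxes //.
by rewrite nth_boxes res_node_box /init_node /= ffunE.
Qed.

Lemma shape_weightE lam : shape_weight lam = (\sum_k row_weight n (init_node lam k).1)%N.
Proof. by rewrite /shape_weight /boxes_weight big_map big_enum. Qed.

(** The number of boxes in each component determines a reading list, since columns are
    filled from the top and the order is total. *)
Lemma reading_list_shape (bs : seq box) : reading_list bs -> size bs = n ->
  exists lam, bs = boxes lam.
Proof.
move=> Rb sz; pose rows m := [seq b.1 | b <- bs & b.2 == m].
have rowsP m r : (r \in rows m) = ((r, m) \in bs).
  apply/mapP/idP => [[[r' m']]|h]; last by exists (r, m); rewrite // mem_filter eqxx.
  by rewrite mem_filter /= => /andP[/eqP -> h] ->.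
have rows_uniq m : uniq (rows m).
  rewrite map_inj_in_uniq ?filter_uniq ?(reading_list_uniq Rb) // => -[r1 m1] [r2 m2].
  by rewrite !mem_filter /= => /andP[/eqP -> _] /andP[/eqP -> _] ->.
have rowsE m r : (r \in rows m) = (r < size (rows m))%N.
  have down i j : j \in rows m -> (i <= j)%N -> i \in rows m.
    by rewrite !rowsP => h le; apply: reading_list_col Rb h le.
  apply/idP/idP => [h|].
    rewrite -[r.+1](size_iota 0); apply: uniq_leq_size (iota_uniq _ _) _ => i.
    by rewrite mem_iota add0n ltnS => /andP[_]; apply: down.
  apply: contraLR => h; rewrite -leqNgt -[r](size_iota 0).
  apply: uniq_leq_size (rows_uniq m) _ => i hi; rewrite mem_iota add0n /=.
  by rewrite ltnNge; apply: contra h; apply: down.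
have le m : (size (rows m) < n.+1)%N by rewrite ltnS size_map size_filter -sz count_size.
pose a : {ffun 'I_l -> 'I_n.+1} := [ffun m => Ordinal (le m)].
have sa : (\sum_m (a m : nat) == n)%N.
  rewrite (eq_bigr (fun m => count (fun b : box => b.2 == m) bs)); last first.
    by move=> m _; rewrite ffunE /= size_map size_filter.
  apply/eqP; rewrite -[RHS]sz; elim: (bs) => [|b s IH] /=; first by rewrite big1.
  rewrite big_split /= IH (bigD1 b.2) //= eqxx big1 // => m.
  by rewrite eq_sym => /negbTE ->.
exists (exist _ a sa).
apply: (irr_sorted_eq (@box_lt_trans l) (@box_lt_irr l)); rewrite ?(proj1 Rb) ?(proj1 (boxes_reading_list _)) //.
by move=> [r m]; rewrite mem_boxes /= ffunE /= -rowsE rowsP.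
Qed.

Lemma shape_weight_bound lam : (shape_weight lam <= n * row_weight n 0)%N.
Proof. by have := @boxes_weight_le l n 0 (boxes lam) (fun _ _ => isT); rewrite size_boxes. Qed.

End Shapes.

(** * Tableaux and the window between two vertically adjacent boxes *)

Section Tabs.
Variables (l n : nat).
Implicit Types (lam : par1 l n) (k : 'I_n) (d : 'S_n).

Lemma tab_of_subproof lam d : is_tab lam [ffun k => init_node lam (d k)].
Proof.
have /andP[_ /eqP T] := valP (init_tab lam).
apply/andP; split.
  by apply/injectiveP=> k k'; rewrite !ffunE => /tab_inj/perm_inj.
rewrite -T; apply/eqP/setP=> y; apply/imsetP/imsetP=> -[k _ ->].
  by exists (d k); rewrite ?in_setT // [LHS]ffunE.
by exists (d^-1%g k); rewrite ?in_setT // [RHS]ffunE permKV.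
Qed.

(** The tableau with [d_perm] equal to [d]: all tableaux of a shape are parametrised by
    permutations. *)
Definition tab_of lam d : tab lam :=
  exist _ [ffun k => init_node lam (d k)] (tab_of_subproof lam d).

Lemma d_perm_tab_of lam d : d_perm (tab_of lam d) = d.
Proof.
apply/permP=> k; apply: (@tab_inj _ _ _ (init_tab lam)).
by rewrite d_permE /= ffunE.
Qed.

Lemma init_is_std lam : is_std (init_tab lam).
Proof.
apply/forallP=> k; apply/forallP=> k'; apply/implyP=> /andP[/eqP E lt].
by rewrite -(box_lt_initE lam) /box_lt /= lt.
Qed.

Lemma d_perm_init lam : d_perm (init_tab lam) = 1%g.
Proof.
by apply/permP=> k; apply: (@tab_inj _ _ _ (init_tab lam)); rewrite d_permE perm1.
Qed.

(** If an entry is larger than some entry below it in its column, then two consecutive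
    entries in between are in the wrong order. *)
Lemma nonstd_adjacent lam d : ~~ is_std (tab_of lam d) -> exists p p' r m,
  [/\ node_box (init_node lam p) = (r, m), node_box (init_node lam p') = (r.+1, m) & (d^-1%g p' < d^-1%g p)%N].
Proof.
rewrite /is_std negb_forall => /existsP[k]; rewrite negb_forall => /existsP[k'].
rewrite negb_imply /= !ffunE -leqNgt => /andP[/andP[/eqP Em lt] le].
have [p Ep] : exists p, p = d k by exists (d k).
have [p' Ep'] : exists p', p' = d k' by exists (d k').
have {le} le : (d^-1%g p' < d^-1%g p)%N.
  rewrite Ep Ep' !permK ltn_neqAle le andbT; apply/eqP=> /val_inj E.
  by rewrite E ltnn in lt.
rewrite -Ep -Ep' in Em lt; clear Ep Ep' k k'.
move: {2}((init_node lam p').1 - (init_node lam p).1)%N (leqnn ((init_node lam p').1 - (init_node lam p).1)) => N.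
elim: N p Em lt le => [|N IH] p Em lt le hN; first lia.
have [E|ne] := eqVneq (nat_of_ord (init_node lam p').1) (nat_of_ord (init_node lam p).1).+1.
  by exists p, p', (init_node lam p).1, (init_node lam p).2; rewrite /node_box E Em.
have /mapP[p1 _ E1] : ((init_node lam p).1.+1, (init_node lam p).2) \in boxes lam.
  apply: (@reading_list_col _ _ (init_node lam p').1 _ _ (boxes_reading_list lam)); last exact: lt.
  by rewrite Em; apply: map_f; rewrite mem_enum.
case: (ltnP (d^-1%g p1) (d^-1%g p)) => h.
  by exists p, p1, (init_node lam p).1, (init_node lam p).2; rewrite -E1.
case: E1 => e1 e2; apply: (IH p1); rewrite -?e1 -?e2 //; [lia | | lia].
by apply: (leq_trans le).
Qed.

End Tabs.

Section Straighten.
Variables (e l n : nat) (kappa : 'I_l -> 'Z_e) (R : comNzRingType) (A : pzRingType)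
  (sc : R -> A) (x : 'I_l -> R) (ps : 'I_n.-1 -> A) (yy : 'I_n -> A) (ee : resseq e n -> A).
Hypothesis D : deformed_blob kappa sc x ps yy ee.
Hypothesis K1 : forall m m', m != m' -> far (kappa m) (kappa m').
Hypothesis K2 : forall m m' : 'I_l, (m < m')%N -> kappa m <> kappa m' + 2%:R.
Variable red : 'S_n -> seq 'I_n.-1.
Hypothesis redP : forall w, reduced_expr w (red w).
Variable lam : par1 l n.
Implicit Types (u v : seq 'I_n.-1) (p : 'I_n) (w : 'S_n).

Definition psi_word u : A := \prod_(r <- u) ps r.
Local Notation z := (ee (res_par kappa lam)).
Local Notation J := (cell_ideal kappa sc ps yy ee (shape_weight lam).+1).
Let idJ : is_ideal sc ps yy ee J := cell_ideal_is_ideal kappa sc ps yy ee _.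

Lemma boxes_split p : exists s2, boxes lam = take p (boxes lam) ++ node_box (init_node lam p) :: s2.
Proof.
exists (drop p.+1 (boxes lam)).
by rewrite -(nth_boxes lam (node_box (init_node lam p))) -drop_nth ?cat_take_drop // size_boxes.
Qed.

(** The ideal of the shapes heavier than [lam] satisfies the bound of [y_eigen_and_skip] for
    every prefix of the boxes of [lam]. *)
Lemma init_y_eigen_and_skip p : y_eigen kappa sc x yy ee J (take p (boxes lam)) (node_box (init_node lam p)) /\
  skip_kills kappa ee J (take p (boxes lam)) (node_box (init_node lam p)).
Proof.
have [s2 E] := boxes_split p; have Rb := boxes_reading_list lam.
have sp : size (take p (boxes lam)) = p by rewrite size_takel // size_boxes ltnW.
apply: (y_eigen_and_skip D K1 K2 (X := (shape_weight lam).+1) idJ).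
- by move=> bs s; apply: (cell_idem D K1 K2).
- by move: Rb; rewrite {1}E -cat_rcons; apply: reading_list_prefix.
- by rewrite sp.
have := @boxes_weight_tail l n (take p (boxes lam)) (node_box (init_node lam p)) s2; rewrite -E.
case: (Rb) => S _ /(_ S) h; apply: (leq_ltn_trans h).
rewrite ltn_add2l ltn_mul2r row_weight_gt0 /=.
by have := size_boxes lam; rewrite E size_cat sp /=; lia.
Qed.

Lemma y_init p : J (yy p * z - sc (x (init_node lam p).2) * z).
Proof.
have [h _] := init_y_eigen_and_skip p; have [s2 E] := boxes_split p.
have sp : size (take p (boxes lam)) = p by rewrite size_takel // size_boxes ltnW.
have := h (map (box_res kappa) s2); rewrite /y_defect size_map.
have -> : map (box_res kappa) (take p (boxes lam)) ++ box_res kappa (node_box (init_node lam p)) :: map (box_res kappa) s2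
    = map (box_res kappa) (boxes lam) by rewrite [in RHS]E map_cat.
rewrite sp /idem_seq res_of_boxes y_atE; apply.
by have := size_boxes lam; rewrite E size_cat sp /=.
Qed.

Section Window.
Variables (p p' : 'I_n) (r : nat) (m : 'I_l).
Hypothesis Ep : node_box (init_node lam p) = (r, m).
Hypothesis Ep' : node_box (init_node lam p') = (r.+1, m).

(** Rearrangements of the positions from [p] to [p'], which hold two vertically adjacent
    boxes. *)
Definition window_perm (sg : 'S_n) : Prop :=
  forall k : 'I_n, (k < p)%N || (p' < k)%N -> sg k = k.

Definition z_perm (sg : 'S_n) : A := ee [ffun k => res_par kappa lam (sg k)].

Lemma window_lt : (p < p')%N.
Proof. by rewrite -(box_lt_initE lam) Ep Ep' /box_lt /= ltnSn. Qed.

Lemma window_in sg (k : 'I_n) : window_perm sg -> (p <= k <= p')%N -> (p <= sg^-1%g k <= p')%N.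
Proof.
move=> W hk; apply: contraLR isT => h; have /W : (sg^-1%g k < p)%N || (p' < sg^-1%g k)%N by lia.
by rewrite permKV => E; move: h; rewrite -E hk.
Qed.

(** If the lower box comes first, all that precedes it in the window is far from it, so it
    moves to the beginning of the window, where it follows a prefix of the boxes of [lam]
    and skips the box above it. *)
Lemma window_kill sg : window_perm sg -> (sg^-1%g p' < sg^-1%g p)%N -> J (z_perm sg).
Proof.
move=> W; set P := sg^-1%g p' => lt; have [_ hs] := init_y_eigen_and_skip p.
pose L := [seq node_box (init_node lam (sg k)) | k <- enum 'I_n].
have sL : size L = n by rewrite size_map size_enum_ord.
have nthL b0 (k : 'I_n) : nth b0 L k = node_box (init_node lam (sg k)).
  by rewrite (nth_map k) ?size_enum_ord // nth_ord_enum.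
have Pin : (p <= P)%N by have /andP[] := @window_in sg p' W ltac:(by rewrite (ltnW window_lt) /=).
have EL : L = take p L ++ drop p (take P L) ++ node_box (init_node lam p') :: drop P.+1 L.
  rewrite catA -{1}(@take_takel _ p P) // cat_take_drop.
  have -> : node_box (init_node lam p') = nth (node_box (init_node lam p')) L P by rewrite nthL permKV.
  by rewrite -drop_nth ?sL // cat_take_drop.
have Ez : z_perm sg = idem_seq ee (map (box_res kappa) L).
  rewrite /z_perm /idem_seq; congr ee; apply/ffunP=> k.
  rewrite !ffunE (nth_map (node_box (init_node lam k))) ?sL // nthL res_node_box.
  by rewrite /init_node /= !ffunE.
have tk : take p L = take p (boxes lam).
  have sp (s : seq (nat * 'I_l)) : size s = n -> size (take p s) = p.
    by move=> ss; rewrite size_takel // ss ltnW.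
  apply: (@eq_from_nth _ (node_box (init_node lam p))); first by rewrite !sp ?size_boxes.
  move=> i; rewrite sp // => ip; rewrite (nth_take _ ip) (nth_take _ ip).
  have i_n : (i < n)%N := ltn_trans ip (ltn_ord p).
  have := nthL (node_box (init_node lam p)) (Ordinal i_n); rewrite /= => ->.
  have := nth_boxes lam (node_box (init_node lam p)) (Ordinal i_n); rewrite /= => ->.
  by rewrite W //= ip.
rewrite Ez EL !map_cat /=; apply: (far_move D idJ).
- apply/allP => _ /mapP[b hb ->]; rewrite far_sym Ep'.
  have /(nthP (node_box (init_node lam p)))[i] := hb; rewrite size_drop size_takel; last by rewrite sL ltnW.
  move=> hi.
  rewrite nth_drop nth_take; last lia.
  have i_n : (p + i < n)%N by have := ltn_ord P; lia.
  have := nthL (node_box (init_node lam p)) (Ordinal i_n); rewrite /= => -> <-; set k := Ordinal i_n.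
  have vk : nat_of_ord k = (p + i)%N by [].
  have hk : (p < sg k < p')%N.
    have kin : (p <= sg k <= p')%N.
      apply: contraT => h; have : sg (sg k) = sg k by apply: W; lia.
      have /andP[_ hP] : (p <= P <= p')%N by apply: window_in; rewrite ?leqnn ?(ltnW window_lt).
      by move/perm_inj => E; move: h; rewrite E vk; lia.
    have n1 : sg k != p by apply/eqP=> E; move: lt; rewrite -E permK vk; lia.
    have n2 : sg k != p' by apply/eqP=> E; move: hi; rewrite /P -E permK vk; lia.
    by move: n1 n2; rewrite -!val_eqE /=; lia.
  have b1 : box_lt (r, m) (node_box (init_node lam (sg k))) by rewrite -Ep box_lt_initE; case/andP: hk.
  have b2 : box_lt (node_box (init_node lam (sg k))) (r.+1, m) by rewrite -Ep' box_lt_initE; case/andP: hk.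
  by case: (between_far K1 K2 b1 b2).
- by have := congr1 size EL; rewrite sL !size_cat /= !size_map => <-.
rewrite tk Ep' box_resS -Ep; apply: hs; rewrite size_cat !size_map -tk.
have := congr1 size EL; rewrite sL !size_cat /=; lia.
Qed.

(** If [w] exchanges the order of the two boxes, then some reduced word of [w] does so by
    crossings inside the window first. Induction on the length: as long as the boxes are in
    order, [w] has a descent between their positions; it is split off on the right and
    changes [sg] inside the window. *)
Lemma window_word sg w : window_perm sg -> (w (sg^-1%g p') < w (sg^-1%g p))%N ->
  exists v, [/\ word_perm v = w, size v = inversions w & J (psi_word v * z_perm sg)].
Proof.
have Jpw v a : J a -> J (psi_word v * a).
  elim: v => [|q v IH] Ja; rewrite /psi_word ?big_nil ?mul1r // big_cons -mulrA.
  by apply: CellL; [constructor | apply: IH].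
have [N] := ubnP (inversions w); elim: N sg w => // N IH sg w hN W lt.
case: (ltngtP (sg^-1%g p') (sg^-1%g p)) => [h|h|/val_inj/perm_inj E]; last first.
- by have := window_lt; rewrite E ltnn.
- have [q /andP[q1 q2] dq] := descent_between h lt.
  have inv_w := inversions_down dq.
  have win1 : window_perm (simple_refl q * sg)%g.
    move=> k hk; rewrite permM sr_out; first exact: W.
      have := @window_in sg p W; rewrite leqnn (ltnW window_lt) => /(_ isT).
      have := @window_in sg p' W; rewrite leqnn (ltnW window_lt) => /(_ isT).
      by rewrite -val_eqE /=; lia.
    have := @window_in sg p W; rewrite leqnn (ltnW window_lt) => /(_ isT).
    have := @window_in sg p' W; rewrite leqnn (ltnW window_lt) => /(_ isT).
    by rewrite -val_eqE /=; lia.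
  have sV k : (simple_refl q * sg)^-1%g k = simple_refl q (sg^-1%g k).
    by rewrite invMg permM /simple_refl tpermV.
  have [||v [Ev sv Jv]] := IH (simple_refl q * sg)%g (simple_refl q * w)%g _ win1.
  + by move: hN; rewrite inv_w; lia.
  + by rewrite !sV !permM !srK.
  exists (rcons v q); split.
  + by rewrite -cats1 word_perm_cat /= mul1g Ev mulgA /simple_refl tperm2 mul1g.
  + by rewrite size_rcons sv inv_w.
  rewrite /psi_word -cats1 big_cat /= big_seq1 -mulrA (psi_id D) mulrA.
  apply: CellR; first by constructor.
  suff -> : act_s q [ffun k => res_par kappa lam (sg k)] =
     [ffun k => res_par kappa lam ((simple_refl q * sg)%g k)] by [].
  by apply/ffunP=> k; rewrite !ffunE permM.
have [v Ev sv] := reduced_word w.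
by exists v; split=> //; apply: Jpw; apply: window_kill.
Qed.
End Window.
End Straighten.

(** * Straightening psi-words modulo heavier shapes *)

Section LeftSpan.
Variables (e l n : nat) (kappa : 'I_l -> 'Z_e) (R : comNzRingType) (A : pzRingType)
  (sc : R -> A) (x : 'I_l -> R) (ps : 'I_n.-1 -> A) (yy : 'I_n -> A) (ee : resseq e n -> A).
Hypothesis D : deformed_blob kappa sc x ps yy ee.
Hypothesis K1 : forall m m', m != m' -> far (kappa m) (kappa m').
Hypothesis K2 : forall m m' : 'I_l, (m < m')%N -> kappa m <> kappa m' + 2%:R.
Variable red : 'S_n -> seq 'I_n.-1.
Hypothesis redP : forall w, reduced_expr w (red w).
Variable lam : par1 l n.
Implicit Types (r s : 'I_n.-1) (u v : seq 'I_n.-1) (p : 'I_n) (w : 'S_n).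

Local Notation pw := (psi_word ps).
Local Notation z := (ee (res_par kappa lam)).
Local Notation J := (cell_ideal kappa sc ps yy ee (shape_weight lam).+1).

Lemma psi_word_cons r u : pw (r :: u) = ps r * pw u.
Proof. by rewrite /psi_word big_cons. Qed.

(** Modulo heavier shapes, the combinations of psi-words of length less than [N] applied to
    the idempotent of [lam]. *)
Inductive short_span (N : nat) : A -> Prop :=
| ShortJ a of J a : short_span N a
| ShortW u of (size u < N)%N : short_span N (pw u * z)
| ShortD (a b : A) of short_span N a & short_span N b : short_span N (a + b)
| ShortS c (a : A) of short_span N a : short_span N (sc c * a).

Lemma short_mono N M a : (N <= M)%N -> short_span N a -> short_span M a.
Proof.
move=> le; elim=> {a} [a|u lt|a b _ h _ h'|c a _ h].
- exact: ShortJ.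
- by apply: ShortW; apply: leq_trans le.
- exact: ShortD.
- exact: ShortS.
Qed.

Lemma short_psi N r a : short_span N a -> short_span N.+1 (ps r * a).
Proof.
elim=> {a} [a Ja|u lt|a b _ h _ h'|c a _ h].
- by apply: ShortJ; apply: CellL => //; constructor.
- by rewrite mulrA -psi_word_cons; apply: ShortW.
- by rewrite mulrDr; apply: ShortD.
- by rewrite mulrA -(scC D) -mulrA; apply: ShortS.
Qed.

Lemma short_opp N a : short_span N a -> short_span N (- a).
Proof. by move=> h; rewrite -mulN1r -(sc1 D) -(scN D); apply: ShortS. Qed.

Lemma short_sub N a b : short_span N a -> short_span N b -> short_span N (a - b).
Proof. by move=> h h'; apply: ShortD h _; apply: short_opp. Qed.

Lemma short0 N : short_span N 0.
Proof. by apply: ShortJ; apply: Cell0. Qed.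

Lemma short_bool N (b : bool) a : short_span N a -> short_span N (b%:R * a).
Proof. by case: b => h; rewrite ?mul1r // mul0r; apply: short0. Qed.

Lemma psi_word_idem u : exists i, pw u * z = ee i * (pw u * z).
Proof.
elim: u => [|r u [i E]].
  by exists (res_par kappa lam); rewrite /psi_word big_nil mul1r (idM D) eqxx.
by exists (act_s r i); rewrite psi_word_cons -mulrA {1}E !mulrA (psi_id D).
Qed.

(** A dot slides through the word towards the idempotent, at the price of shorter words, and
    there it acts as a scalar. *)
Lemma short_y p u : short_span (size u).+1 (yy p * (pw u * z)).
Proof.
elim: u p => [|r u IH] p.
  rewrite -[yy p * _](subrK (sc (x (init_node lam p).2) * z)); apply: ShortD.
    by apply: ShortJ; rewrite /psi_word big_nil mul1r; apply: (y_init D K1 K2).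
  by apply: ShortS; have := @ShortW 1 [::] isT; rewrite /psi_word big_nil mul1r.
have [i E] := psi_word_idem u; rewrite psi_word_cons -mulrA.
have lu : short_span (size u).+2 (pw u * z) by apply: ShortW; rewrite ltnS leqnSn.
move: (pw u * z) E lu IH => X E lu IH.
have [->|ne1] := eqVneq p (hi r).
  rewrite E !mulrA (y_hi_psi D) -mulrA -E mulrBl.
  by apply: short_sub; [rewrite -mulrA; apply: short_psi | apply: short_bool].
have [->|ne2] := eqVneq p (lo r).
  have := psi_y_hi D r i => /(congr1 (fun a => a * X)).
  rewrite -!mulrA -E mulrBl -mulrA => E2.
  have -> : yy (lo r) * (ps r * X) = ps r * (yy (hi r) * X) + (i (lo r) == i (hi r))%:R * X.
    by rewrite E2 subrK.
  by apply: ShortD; [apply: short_psi | apply: short_bool].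
rewrite mulrA -(psi_y D); [|by apply/eqP..].
by rewrite -mulrA; apply: short_psi.
Qed.

(** [psi_r^2] is a polynomial of degree at most one in the dots, so the two letters can be
    traded for at most one dot. *)
Lemma short_sq r u : short_span (size u).+2 (ps r * (ps r * (pw u * z))).
Proof.
have [i E] := psi_word_idem u.
have lu : short_span (size u).+2 (pw u * z) by apply: ShortW; rewrite ltnS leqnSn.
have ly p : short_span (size u).+2 (yy p * (pw u * z)).
  by apply: short_mono (short_y p u).
move: (pw u * z) E lu ly => X E lu ly.
rewrite E !mulrA; have [h1|/eqP h1] := eqVneq (i (lo r)) (i (hi r)).
  by rewrite (sq_eq D) // mul0r; apply: short0.
have [h2|/eqP h2] := eqVneq (i (hi r)) (i (lo r) + 1).
  by rewrite (sq_up D) // -mulrA -E mulrBl; apply: short_sub.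
have [h3|/eqP h3] := eqVneq (i (hi r)) (i (lo r) - 1).
  by rewrite (sq_down D) // -mulrA -E mulrBl; apply: short_sub.
rewrite (sq_far D) -?E // => h; first by apply: h3; rewrite h addrK.
by apply: h2; rewrite h subrK.
Qed.

(** The relation to which [matsumoto] is applied: braid moves change a psi-word by shorter
    words only. *)
Definition word_equiv u v : Prop := size u = size v /\ short_span (size u) (pw u * z - pw v * z).

Lemma word_equiv_reduced u v : word_perm u = word_perm v ->
  size u = inversions (word_perm u) -> size v = inversions (word_perm v) -> word_equiv u v.
Proof.
apply: matsumoto.
- by move=> {}u; split; rewrite ?subrr //; apply: short0.
- move=> {}u {}v [E h]; split; first by rewrite E.
  by rewrite -E -[_ - _]opprB; apply: short_opp.
- move=> {}u {}v w [E1 h1] [E2 h2]; split; first by rewrite E1.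
  rewrite -E1 in h2.
  by rewrite -(subrK (pw v * z) (pw u * z)) -addrA; apply: ShortD.
- move=> r {}u {}v [E h]; split; rewrite /= ?E //.
  by rewrite !psi_word_cons -!mulrA -mulrBr -E; apply: short_psi.
- move=> r s {}u far; split=> //; rewrite !psi_word_cons !mulrA (psi_psi D far) subrr.
  exact: short0.
move=> r s {}u sr; split=> //; have [i E] := psi_word_idem u.
rewrite !psi_word_cons -!mulrA E.
have -> : ps r * (ps s * (ps r * (ee i * (pw u * z)))) =
    ps r * ps s * ps r * ee i * (pw u * z) by rewrite !mulrA.
rewrite (braid D i sr) mulrDl mulrDl -!mulrA addrAC subrr add0r -E /braid_sign.
have lu : short_span (size [:: r, s, r & u]) (pw u * z) by apply: ShortW => /=; lia.
case: ifP => _; last case: ifP => _.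
- by rewrite mulN1r; apply: short_opp.
- by rewrite mul1r.
- by rewrite mul0r; apply: short0.
Qed.

(** By the exchange condition, a reduced word that stops being reduced when [r] is put in
    front can be chosen to begin with [r], and then [short_sq] applies. *)
Lemma short_nonreduced u : size u <> inversions (word_perm u) -> short_span (size u) (pw u * z).
Proof.
elim: u => [|r u IH] h; first by case: h; rewrite /= inversions1.
rewrite psi_word_cons -mulrA /=.
have [su|/eqP nsu] := eqVneq (size u) (inversions (word_perm u)); last by apply: short_psi; apply: IH.
set w := word_perm u in su.
case: (ltngtP (w^-1%g (lo r)) (w^-1%g (hi r))) => [lt|lt|].
- by case: h; rewrite /= (inversions_upl lt) su.
- have [v Ev sv] := reduced_word (w * simple_refl r)%g.
  have Ew := inversions_downl lt; have Erv : word_perm (r :: v) = w.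
    by rewrite /= Ev -mulgA /simple_refl tperm2 mulg1.
  have [//||s2 hl] := @word_equiv_reduced u (r :: v) (esym Erv).
    by rewrite Erv /= sv -Ew.
  have -> : ps r * (pw u * z) =
      ps r * (pw u * z - pw (r :: v) * z) + ps r * (ps r * (pw v * z)).
    by rewrite mulrBr psi_word_cons -!mulrA subrK.
  apply: ShortD; first exact: short_psi.
  by rewrite s2 /=; apply: short_sq.
by move/val_inj/perm_inj => E; have := lo_neq_hi r; rewrite E eqxx.
Qed.

(** Modulo heavier shapes, the combinations of the elements [psi_{d(t)}^* e(i^lam)] for
    standard [t]; reversing a word is what the anti-involution does to it. *)
Inductive left_span : A -> Prop :=
| LeftJ a of J a : left_span a
| LeftT (t : std lam) : left_span (pw (rev (red (d_perm (val t)))) * z)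
| LeftD (a b : A) of left_span a & left_span b : left_span (a + b)
| LeftS c (a : A) of left_span a : left_span (sc c * a).

(** Induction on the length. Up to shorter words only the permutation of [u] matters. If it
    belongs to a standard tableau, the chosen reduced word can be taken; if not, two
    vertically adjacent boxes are reversed, and the word provided by [window_word] is in the
    ideal of heavier shapes. *)
Lemma left_span_word u : left_span (pw u * z).
Proof.
have [N] := ubnP (size u); elim: N u => // N IH u uN.
have shortL a : short_span (size u) a -> left_span a.
  elim=> {a} [a|v lt|a b _ h _ h'|c a _ h].
  - exact: LeftJ.
  - by apply: IH; lia.
  - exact: LeftD.
  - exact: LeftS.
have [su|/eqP nsu] := eqVneq (size u) (inversions (word_perm u)); last by apply/shortL/short_nonreduced.
have via v : word_perm v = word_perm u -> size v = inversions (word_perm v) ->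
    left_span (pw v * z) -> left_span (pw u * z).
  move=> E sv h; have [_ hl] := @word_equiv_reduced u v (esym E) su sv.
  by rewrite -(subrK (pw v * z) (pw u * z)); apply: LeftD h; apply: shortL.
pose d := (word_perm u)^-1%g; have dV : d^-1%g = word_perm u by rewrite invgK.
have [st|/nonstd_adjacent[p [p' [r [m [Ep Ep' lt]]]]]] := boolP (is_std (tab_of lam d)).
  pose t : std lam := exist _ (tab_of lam d) st.
  have [E _] := redP d.
  apply: (via (rev (red d))).
  - by rewrite word_perm_rev E dV.
  - by rewrite size_rev word_perm_rev E dV -su (size_reduced (redP d)) -inversionsV dV su.
  by have := LeftT t; rewrite /= d_perm_tab_of.
have W1 : window_perm p p' (1 : 'S_n)%g by move=> k _; rewrite perm1.
rewrite dV in lt.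
have lt1 : (word_perm u ((1 : 'S_n)^-1%g p') < word_perm u ((1 : 'S_n)^-1%g p))%N by rewrite invg1 !perm1.
have [v [Ev sv Jv]] := window_word D K1 K2 Ep Ep' W1 lt1.
apply: (via v) => //; first by rewrite Ev.
apply: LeftJ; move: Jv; rewrite /z_perm.
by congr (J (_ * ee _)); apply/ffunP=> k; rewrite !ffunE perm1.
Qed.

Lemma left_span_gen g u : is_gen sc ps yy ee g -> left_span (g * (pw u * z)).
Proof.
have shortL N a : short_span N a -> left_span a.
  elim=> {a} [a|v lt|a b _ h _ h'|c a _ h].
  - exact: LeftJ.
  - exact: left_span_word.
  - exact: LeftD.
  - exact: LeftS.
case=> [r|p|i|c].
- by rewrite mulrA -psi_word_cons; apply: left_span_word.
- exact: shortL (short_y p u).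
- have [j E] := psi_word_idem u; rewrite E mulrA (idM D); case: eqP => [->|_].
    by rewrite -E; apply: left_span_word.
  by rewrite mul0r; apply: LeftJ; apply: Cell0.
- by apply: LeftS; apply: left_span_word.
Qed.

End LeftSpan.

(** * Spanning *)

Section Spanning.
Variables (e l n : nat) (kappa : 'I_l -> 'Z_e) (R : comNzRingType) (A : pzRingType)
  (sc : R -> A) (x : 'I_l -> R) (ps : 'I_n.-1 -> A) (yy : 'I_n -> A) (ee : resseq e n -> A).
Hypothesis D : deformed_blob kappa sc x ps yy ee.
Hypothesis K1 : forall m m', m != m' -> far (kappa m) (kappa m').
Hypothesis K2 : forall m m' : 'I_l, (m < m')%N -> kappa m <> kappa m' + 2%:R.
Variable red : 'S_n -> seq 'I_n.-1.
Hypothesis redP : forall w, reduced_expr w (red w).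
Implicit Types (lam : par1 l n) (u : seq 'I_n.-1).

Local Notation pw := (psi_word ps).
Local Notation z lam := (ee (res_par kappa lam)).
Local Notation J lam := (cell_ideal kappa sc ps yy ee (shape_weight lam).+1).

Lemma cell_ideal_op X a :
  @cell_ideal e l n kappa R A^c sc ps yy ee X a -> cell_ideal kappa sc ps yy ee X a.
Proof.
have G g : @is_gen e n R A^c sc ps yy ee g -> is_gen sc ps yy ee g by case; constructor.
elim=> {a} [bs R1 s1 h||a b _ h _ h'|g a /G hg _ h|g a /G hg _ h].
- exact: CellGen.
- exact: Cell0.
- exact: CellD.
- exact: CellR.
- exact: CellL.
Qed.

Lemma psi_word_op u : @psi_word n A^c ps u = pw (rev u).
Proof.
elim: u => [|r u IH]; first by rewrite /psi_word /rev !big_nil.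
by rewrite psi_word_cons IH rev_cons /psi_word -cats1 big_cat /= big_seq1.
Qed.

(** The mirror image of [left_span]; it is reached through the opposite ring. *)
Inductive right_span lam : A -> Prop :=
| RightJ a of J lam a : right_span lam a
| RightT (t : std lam) : right_span lam (z lam * pw (red (d_perm (val t))))
| RightD (a b : A) of right_span lam a & right_span lam b : right_span lam (a + b)
| RightS c (a : A) of right_span lam a : right_span lam (sc c * a).

Lemma right_span_gen lam g u : is_gen sc ps yy ee g -> right_span lam (z lam * pw u * g).
Proof.
move=> hg; have hg' : @is_gen e n R A^c sc ps yy ee g by case: hg; constructor.
have := left_span_gen (deformed_blob_op D) K1 K2 redP lam (rev u) hg'.
have -> : (g : A^c) * (@psi_word n A^c ps (rev u) * z lam) = z lam * pw u * g :> A.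
  by rewrite psi_word_op revK.
elim=> {g hg hg'} [a /cell_ideal_op Ja|t|a b _ h _ h'|c a _ h].
- exact: RightJ.
- by have := RightT t; rewrite psi_word_op revK.
- exact: RightD.
- by have := RightS c h; rewrite (scC D).
Qed.

(** The elements [m_st], for any elements that satisfy the deformed relations. *)
Definition cell_elt lam (s t : tab lam) : A :=
  pw (rev (red (d_perm s))) * z lam * pw (red (d_perm t)).

Inductive cell_span (X : nat) : A -> Prop :=
| SpanM lam (s t : std lam) of (X <= shape_weight lam)%N : cell_span X (cell_elt (val s) (val t))
| Span0 : cell_span X 0
| SpanD (a b : A) of cell_span X a & cell_span X b : cell_span X (a + b)
| SpanS c (a : A) of cell_span X a : cell_span X (sc c * a).

Lemma cell_span_mono X X' a : (X <= X')%N -> cell_span X' a -> cell_span X a.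
Proof.
move=> le; elim=> {a} [lam s t h||a b _ h _ h'|c a _ h].
- by apply: SpanM; apply: leq_trans h.
- exact: Span0.
- exact: SpanD.
- exact: SpanS.
Qed.

Lemma red_id : red 1%g = [::].
Proof. by apply: size0nil; rewrite (size_reduced (redP _)) inversions1. Qed.

Lemma ideal_pwl X u a : cell_ideal kappa sc ps yy ee X a ->
  cell_ideal kappa sc ps yy ee X (pw u * a).
Proof.
move=> Ja; elim: u => [|r u IH]; first by rewrite /psi_word big_nil mul1r.
by rewrite psi_word_cons -mulrA; apply: CellL => //; constructor.
Qed.

Lemma ideal_pwr X u a : cell_ideal kappa sc ps yy ee X a ->
  cell_ideal kappa sc ps yy ee X (a * pw u).
Proof.
elim: u a => [|r u IH] a Ja; first by rewrite /psi_word big_nil mulr1.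
by rewrite psi_word_cons mulrA; apply: IH; apply: CellR => //; constructor.
Qed.

(** Downward induction on the weight [X], then on the construction of the element: a
    generator that multiplies [m_st] on the left changes only [s], by [left_span_gen], and
    on the right only [t], up to the ideal of heavier shapes, which is spanned by induction. *)
Lemma cell_ideal_span X a : cell_ideal kappa sc ps yy ee X a -> cell_span X a.
Proof.
have bnd := @shape_weight_bound l n.
move: {2}((n * row_weight n 0).+1 - X)%N (leqnn ((n * row_weight n 0).+1 - X)) => k.
elim: k X a => [|k IH] X a hk.
  elim=> {a} [bs Rb sb hX||a b _ h _ h'|g a hg _ h|g a hg _ h].
  - by have [lam E] := reading_list_shape Rb sb; move: hX (bnd lam); rewrite E /shape_weight; lia.
  - exact: Span0.
  - exact: SpanD.
  - elim: h => {a} [lam s t h||a b _ h _ h'|c a _ h].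
    + by have := bnd lam; lia.
    + by rewrite mulr0; apply: Span0.
    + by rewrite mulrDr; apply: SpanD.
    + by rewrite mulrA -(scC D) -mulrA; apply: SpanS.
  - elim: h => {a} [lam s t h||a b _ h _ h'|c a _ h].
    + by have := bnd lam; lia.
    + by rewrite mul0r; apply: Span0.
    + by rewrite mulrDl; apply: SpanD.
    + by rewrite -mulrA; apply: SpanS.
have next lam b : (X <= shape_weight lam)%N -> J lam b -> cell_span X b.
  move=> le Jb; apply: (@cell_span_mono X (shape_weight lam).+1); first exact: leqW.
  by apply: IH Jb; lia.
elim=> {a} [bs Rb sb hX||a b _ h _ h'|g a hg _ h|g a hg _ h].
- have [lam E] := reading_list_shape Rb sb.
  pose t0 : std lam := exist _ (init_tab lam) (init_is_std lam).
  have := @SpanM X lam t0 t0; rewrite /cell_elt /= d_perm_init red_id /psi_word !big_nil mul1r mulr1.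
  by rewrite /idem_seq E res_of_boxes; apply; rewrite /shape_weight -E.
- exact: Span0.
- exact: SpanD.
- elim: h => {a} [lam s t hX||a b _ h _ h'|c a _ h].
  + rewrite /cell_elt mulrA; have := left_span_gen D K1 K2 redP lam (rev (red (d_perm (val s)))) hg.
    elim=> [b Jb|s'|b b' _ h _ h'|c b _ h].
    * by apply: (next lam) => //; apply: ideal_pwr.
    * exact: SpanM.
    * by rewrite mulrDl; apply: SpanD.
    * by rewrite -mulrA; apply: SpanS.
  + by rewrite mulr0; apply: Span0.
  + by rewrite mulrDr; apply: SpanD.
  + by rewrite mulrA -(scC D) -mulrA; apply: SpanS.
elim: h => {a} [lam s t hX||a b _ h _ h'|c a _ h].
- rewrite /cell_elt -!mulrA [z lam * _]mulrA; have := right_span_gen lam (red (d_perm (val t))) hg.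
  elim=> [b Jb|t'|b b' _ h _ h'|c b _ h].
  + by apply: (next lam) => //; apply: ideal_pwl.
  + by rewrite mulrA; apply: SpanM.
  + by rewrite mulrDr; apply: SpanD.
  + by rewrite mulrA -(scC D) -mulrA; apply: SpanS.
- by rewrite mul0r; apply: Span0.
- by rewrite mulrDl; apply: SpanD.
- by rewrite -mulrA; apply: SpanS.
Qed.

(** The empty list of boxes may be continued by any residue sequence, so [cell_idem] puts
    all idempotents into the lowest ideal. *)
Lemma one_cell_ideal : cell_ideal kappa sc ps yy ee 0 1.
Proof.
rewrite -(id1 D).
elim/big_ind: _ => [||i _]; [exact: Cell0 | exact: CellD |].
have -> : ee i = idem_seq ee (map (box_res kappa) [::] ++ [seq i k | k <- enum 'I_n]).
  rewrite /idem_seq /=; congr ee; apply/ffunP=> k.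
  by rewrite ffunE (nth_map k) ?size_enum_ord // nth_ord_enum.
by apply: (cell_idem D K1 K2); rewrite // size_map size_enum_ord.
Qed.

(** Converts the inductive span into the form of the definition of a basis. *)
Lemma cell_span_sum a : cell_span 0 a -> exists c : C_index l n -> R,
  a = \sum_i sc (c i) * cell_elt (val (tagged i).1) (val (tagged i).2).
Proof.
elim=> {a} [lam s t _||a b _ [c ->] _ [c' ->]|d a _ [c ->]].
- pose j : C_index l n := Tagged (fun lam => (std lam * std lam)%type) (s, t).
  exists (fun i => (i == j)%:R).
  rewrite (bigD1 j) //= eqxx (sc1 D) mul1r big1 ?addr0 // => i /negbTE ->.
  by rewrite (sc0 D) mul0r.
- by exists (fun=> 0); rewrite big1 // => i _; rewrite (sc0 D) mul0r.
- exists (fun i => c i + c' i); rewrite -big_split; apply: eq_bigr => i _ /=.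
  by rewrite (scD D) mulrDl.
- exists (fun i => d * c i); rewrite mulr_sumr; apply: eq_bigr => i _.
  by rewrite (scM D) mulrA.
Qed.

End Spanning.

(** * A representation on words in the components *)

Section FunctionMatrices.
Variables (W : finType) (K : fieldType).
Implicit Types (X Y : 'M[K]_#|W|) (f : {ffun W -> K}) (u v : W).

(** Matrices indexed by a finite type [W] are compared through their action on the functions
    on [W], where products of sparse operators can be computed pointwise. *)
Definition mxapp X f : {ffun W -> K} :=
  [ffun u => \sum_v X (enum_rank u) (enum_rank v) * f v].

Definition delta v : {ffun W -> K} := [ffun u => (u == v)%:R].

Lemma deltaE v u : delta v u = (u == v)%:R.
Proof. exact: ffunE. Qed.

Definition op_mx (op : {ffun W -> K} -> {ffun W -> K}) : 'M[K]_#|W| :=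
  \matrix_(i, j) op (delta (enum_val j)) (enum_val i).

Lemma mxappM X Y f : mxapp (X * Y) f = mxapp X (mxapp Y f).
Proof.
apply/ffunP=> u; rewrite !ffunE.
under eq_bigr => v _ do rewrite mxE mulr_suml.
rewrite exchange_big (reindex (@enum_rank W)) /=; last first.
  by apply: onW_bij; apply: enum_rank_bij.
apply: eq_bigr => v _; rewrite ffunE mulr_sumr.
by apply: eq_bigr => w _; rewrite mulrA.
Qed.

Lemma mxappD X Y f u : mxapp (X + Y) f u = mxapp X f u + mxapp Y f u.
Proof. by rewrite !ffunE -big_split; apply: eq_bigr => v _; rewrite mxE mulrDl. Qed.

Lemma mxappN X f u : mxapp (- X) f u = - mxapp X f u.
Proof. by rewrite !ffunE -sumrN; apply: eq_bigr => v _; rewrite mxE mulNr. Qed.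

Lemma mxapp_scalar (c : K) f u : mxapp (c%:M) f u = c * f u.
Proof.
rewrite ffunE (bigD1 u) //= mxE eqxx big1 ?addr0 // => v ne.
by rewrite mxE (inj_eq enum_rank_inj) eq_sym (negbTE ne) mul0r.
Qed.

Lemma mxapp1 f u : mxapp 1 f u = f u.
Proof. by rewrite mxapp_scalar mul1r. Qed.

Lemma mxapp0 f u : mxapp 0 f u = 0.
Proof. by rewrite ffunE big1 // => v _; rewrite mxE mul0r. Qed.

Lemma mxapp_delta X u v : mxapp X (delta v) u = X (enum_rank u) (enum_rank v).
Proof.
rewrite ffunE (bigD1 v) //= ffunE eqxx mulr1 big1 ?addr0 // => w ne.
by rewrite ffunE (negbTE ne) mulr0.
Qed.

Lemma mxapp_inj X Y : (forall f u, mxapp X f u = mxapp Y f u) -> X = Y.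
Proof.
move=> H; apply/matrixP=> i j.
by have := H (delta (enum_val j)) (enum_val i); rewrite !mxapp_delta !enum_valK.
Qed.

(** All operators of the representation combine the value at a point with the value at one
    other point. *)
Lemma mxapp_two (a b : W -> K) (s : W -> W) f :
  mxapp (op_mx (fun g => [ffun u => a u * g (s u) + b u * g u])) f =
  [ffun u => a u * f (s u) + b u * f u].
Proof.
apply/ffunP=> u; rewrite !ffunE.
under eq_bigr => v _ do rewrite mxE !enum_rankK !ffunE mulrDl -!mulrA.
rewrite big_split /= -!mulr_sumr; congr (_ * _ + _ * _).
  by rewrite (bigD1 (s u)) //= eqxx mul1r big1 ?addr0 // => v /negbTE; rewrite eq_sym => ->; rewrite mul0r.
by rewrite (bigD1 u) //= eqxx mul1r big1 ?addr0 // => v /negbTE; rewrite eq_sym => ->; rewrite mul0r.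
Qed.

End FunctionMatrices.

Section Words.
Variables (e l n : nat) (kappa : 'I_l -> 'Z_e) (K : fieldType) (xv : 'I_l -> K).
Hypothesis K1 : forall m m', m != m' -> far (kappa m) (kappa m').
Hypothesis two_neq0 : (2%:R : 'Z_e) != 0.
Hypothesis xv_inj : injective xv.

Notation W := {ffun 'I_n -> 'I_l}.
Implicit Types (u v : W) (r s : 'I_n.-1) (p q : 'I_n).

(** A word in the components is built up letter by letter like a tableau: the letter at [p]
    adds a box at the bottom of the column [u p]. The words are the paths in the lattice of
    shapes, with the box in row [row_of u p] added at step [p]. *)
Definition row_of u p : nat := #|[set q : 'I_n | (q < p)%N && (u q == u p)]|.
Definition word_res u p : 'Z_e := kappa (u p) - (row_of u p)%:R.
Definition word_res_seq u : resseq e n := [ffun p => word_res u p].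
Definition swap_word r u : W := [ffun p => u (simple_refl r p)].

Lemma swap_word_lo r u : swap_word r u (lo r) = u (hi r).
Proof. by rewrite ffunE sr_lo. Qed.
Lemma swap_word_hi r u : swap_word r u (hi r) = u (lo r).
Proof. by rewrite ffunE sr_hi. Qed.
Lemma swap_word_out r u p : p != lo r -> p != hi r -> swap_word r u p = u p.
Proof. by move=> h1 h2; rewrite ffunE sr_out. Qed.
Lemma swap_wordK r : involutive (swap_word r).
Proof. by move=> u; apply/ffunP=> p; rewrite !ffunE srK. Qed.

Lemma swap_word_eq r u : u (lo r) = u (hi r) -> swap_word r u = u.
Proof.
move=> E; apply/ffunP=> p; rewrite ffunE.
have [->|h1] := eqVneq p (lo r); first by rewrite sr_lo.
by have [->|h2] := eqVneq p (hi r); rewrite ?sr_hi // sr_out.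
Qed.

Lemma row_of_swap r u p : u (lo r) != u (hi r) -> row_of (swap_word r u) p = row_of u (simple_refl r p).
Proof.
move=> ne; rewrite /row_of -(card_imset _ (inv_inj (srK r))); congr #|pred_of_set _|.
apply/setP=> q; rewrite -[q in LHS](srK r) (mem_imset _ _ (inv_inj (srK r))) !inE !ffunE !srK.
case: (eqVneq (u q) _) => [E|]; last by rewrite !andbF.
rewrite !andbT; apply/idP/idP => lt.
  rewrite -[q](srK r); apply: sr_lt lt _; apply/eqP=> -[h1 h2].
  by move: ne E; rewrite -[q](srK r) h1 h2 sr_lo sr_hi => /eqP ne E; case: ne.
rewrite -[p](srK r); apply: sr_lt lt _; apply/eqP=> -[h1 h2].
by move: ne; rewrite -h1 -h2 E eqxx.
Qed.

Lemma row_of_eq r u : u (lo r) = u (hi r) -> row_of u (hi r) = (row_of u (lo r)).+1.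
Proof.
move=> E; rewrite /row_of (cardsD1 (lo r)) !inE E eqxx lo_lt_hi add1n; congr _.+1.
apply/eq_card => q; rewrite !inE; case: (u q == u (hi r)); rewrite ?andbF // !andbT.
by rewrite -val_eqE /=; lia.
Qed.

Lemma word_res_swap r u p : u (lo r) != u (hi r) -> word_res (swap_word r u) p = word_res u (simple_refl r p).
Proof. by move=> ne; rewrite /word_res row_of_swap // ffunE. Qed.

Lemma word_res_seq_swap r u : u (lo r) != u (hi r) -> word_res_seq (swap_word r u) = act_s r (word_res_seq u).
Proof. by move=> ne; apply/ffunP=> p; rewrite !ffunE word_res_swap. Qed.

Lemma word_res_eq r u : u (lo r) = u (hi r) -> word_res u (hi r) = word_res u (lo r) - 1.
Proof. by move=> E; rewrite /word_res row_of_eq // E -natr1 opprD addrA. Qed.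

(** The value of [psi_r f] at a word with letters [a], [b] at [r], [r + 1] combines the
    values of [f] at the word with [a] and [b] exchanged and at the word itself, with the
    coefficients [swap_coef] and [stay_coef]; [i] and [j] are the residues of the two boxes
    and [xv] gives the eigenvalues of [y]. For equal residues this is the difference
    quotient, as the nil-Hecke relation demands; the product of the two coefficients for
    adjacent residues is the difference of the eigenvalues, as the quadratic relation
    demands. Two boxes of one column cannot be exchanged, so equal letters give 0. *)
Definition swap_coef (a : 'I_l) (i : 'Z_e) (b : 'I_l) (j : 'Z_e) : K :=
  if a == b then 0 else if i == j then (xv a - xv b)^-1
  else if j == i + 1 then xv b - xv a else 1.
Definition stay_coef (a : 'I_l) (i : 'Z_e) (b : 'I_l) (j : 'Z_e) : K :=
  if (a != b) && (i == j) then (xv a - xv b)^-1 else 0.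

Definition ca r u : K := swap_coef (u (lo r)) (word_res u (lo r)) (u (hi r)) (word_res u (hi r)).
Definition cb r u : K := stay_coef (u (lo r)) (word_res u (lo r)) (u (hi r)) (word_res u (hi r)).

Definition psi_mx r : 'M[K]_#|{: W}| :=
  op_mx (fun g => [ffun u : W => ca r u * g (swap_word r u) + cb r u * g u]).
Definition y_mx p : 'M[K]_#|{: W}| :=
  op_mx (fun g => [ffun u : W => 0 * g u + xv (u p) * g u]).
Definition idem_mx (i : resseq e n) : 'M[K]_#|{: W}| :=
  op_mx (fun g => [ffun u : W => 0 * g u + (word_res_seq u == i)%:R * g u]).

Lemma mxapp_psi r f u : mxapp (psi_mx r) f u = ca r u * f (swap_word r u) + cb r u * f u.
Proof. by rewrite mxapp_two ffunE. Qed.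
Lemma mxapp_y p f u : mxapp (y_mx p) f u = xv (u p) * f u.
Proof. by rewrite (@mxapp_two _ _ (fun=> 0) _ id) ffunE mul0r add0r. Qed.
Lemma mxapp_id i f u : mxapp (idem_mx i) f u = (word_res_seq u == i)%:R * f u.
Proof. by rewrite (@mxapp_two _ _ (fun=> 0) _ id) ffunE mul0r add0r. Qed.

Lemma xv_neq a b : a != b -> xv a - xv b != 0.
Proof. by rewrite subr_eq0 (inj_eq xv_inj). Qed.

Lemma stay_coef_opp a i b j : stay_coef b j a i = - stay_coef a i b j.
Proof.
rewrite /stay_coef eq_sym (eq_sym j); case: ifP; rewrite ?oppr0 // => /andP[/xv_neq h _].
by rewrite -[xv b - _]opprB invrN.
Qed.

Lemma swap_coef_eq a i b : a != b -> swap_coef a i b i = (xv a - xv b)^-1.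
Proof. by rewrite /swap_coef => /negbTE ->; rewrite eqxx. Qed.

Lemma stay_coef_eq a i b : a != b -> stay_coef a i b i = (xv a - xv b)^-1.
Proof. by rewrite /stay_coef => ->; rewrite eqxx. Qed.

Lemma stay_coef_ne a i b j : i != j -> stay_coef a i b j = 0.
Proof. by rewrite /stay_coef => /negbTE ->; rewrite andbF. Qed.

Lemma swap_coef_same a i j : swap_coef a i a j = 0.
Proof. by rewrite /swap_coef eqxx. Qed.

Lemma stay_coef_same a i j : stay_coef a i a j = 0.
Proof. by rewrite /stay_coef eqxx. Qed.

Lemma add1_neq (i : 'Z_e) : i != i + 1.
Proof. by rewrite -subr_eq0 opprD addrA subrr sub0r oppr_eq0 oner_eq0. Qed.

Lemma sub1_neq (i : 'Z_e) : i != i - 1.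
Proof. by rewrite -subr_eq0 opprB addrCA subrr addr0 oner_eq0. Qed.

Lemma sub1_neq_add1 (i : 'Z_e) : i - 1 != i + 1.
Proof.
rewrite -subr_eq0 opprD addrACA subrr add0r -opprD oppr_eq0.
by rewrite -[1 + 1]/(2%:R).
Qed.

Lemma sub2_neq (i : 'Z_e) : i - 1 - 1 != i.
Proof.
rewrite -subr_eq0 addrAC [i - 1]addrC addrK -opprD oppr_eq0.
by rewrite -[1 + 1]/(2%:R).
Qed.

(** Matches the quadratic relation for adjacent residues, where [y] has the eigenvalues [xv
    a] and [xv b]. *)
Lemma swap_coef_up a i b : a != b -> swap_coef a i b (i + 1) * swap_coef b (i + 1) a i = xv b - xv a.
Proof.
move=> ne; rewrite /swap_coef (negbTE ne) [b == a]eq_sym (negbTE ne) (negbTE (add1_neq i)) eqxx.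
rewrite [i + 1 == i]eq_sym (negbTE (add1_neq i)).
case: eqP => [/eqP h|_]; last by rewrite mulr1.
by move: h two_neq0; rewrite -subr_eq0 -addrA opprD addrA subrr sub0r oppr_eq0 => ->.
Qed.

Lemma swap_coef_far a i b j : a != b -> far i j -> swap_coef a i b j * swap_coef b j a i = 1.
Proof.
rewrite /swap_coef => ne /and3P[h1 h2 h3]; rewrite (negbTE ne) [b == a]eq_sym (negbTE ne) (negbTE h1).
rewrite [j == i]eq_sym (negbTE h1) (negbTE h2) mulr1; case: eqP => // h.
by move: h3; rewrite h addrK eqxx.
Qed.

Section Braid.
Variables r s : 'I_n.-1.
Hypothesis sr : s = r.+1 :> nat.

(** The letters and residues at three consecutive positions: these are all the data on which
    the braid relation depends. *)
Definition three_strands u a i b j c k : Prop :=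
  [/\ u (lo r) = a, u (hi r) = b & u (hi s) = c] /\
  [/\ word_res u (lo r) = i, word_res u (hi r) = j & word_res u (hi s) = k].

Lemma hi_lo : lo s = hi r.
Proof. by apply: val_inj; rewrite /= sr. Qed.

Lemma sr_fix : simple_refl r (hi s) = hi s.
Proof. by apply: sr_out; rewrite -val_eqE /=; lia. Qed.

Lemma ss_fix : simple_refl s (lo r) = lo r.
Proof. by apply: sr_out; rewrite -val_eqE /=; lia. Qed.

Lemma three_strands_r u a i b j c k : three_strands u a i b j c k -> a != b -> three_strands (swap_word r u) b j a i c k.
Proof.
case=> -[E1 E2 E3] [F1 F2 F3] ne; have ne' : u (lo r) != u (hi r) by rewrite E1 E2.
by split; split; rewrite ?word_res_swap ?ffunE // ?sr_lo ?sr_hi ?sr_fix.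
Qed.

Lemma three_strands_s u a i b j c k : three_strands u a i b j c k -> b != c -> three_strands (swap_word s u) a i c k b j.
Proof.
case=> -[E1 E2 E3] [F1 F2 F3] ne; have ne' : u (lo s) != u (hi s) by rewrite hi_lo E2 E3.
by split; split; rewrite ?word_res_swap ?ffunE -?hi_lo // ?sr_lo ?sr_hi ?ss_fix ?hi_lo.
Qed.

Lemma psi_r u a i b j c k (f : {ffun W -> K}) : three_strands u a i b j c k ->
  mxapp (psi_mx r) f u = swap_coef a i b j * f (swap_word r u) + stay_coef a i b j * f u.
Proof. by case=> -[E1 E2 E3] [F1 F2 F3]; rewrite mxapp_psi /ca /cb E1 E2 F1 F2. Qed.

Lemma psi_s u a i b j c k (f : {ffun W -> K}) : three_strands u a i b j c k ->
  mxapp (psi_mx s) f u = swap_coef b j c k * f (swap_word s u) + stay_coef b j c k * f u.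
Proof. by case=> -[E1 E2 E3] [F1 F2 F3]; rewrite mxapp_psi /ca /cb hi_lo E2 E3 F2 F3. Qed.

Lemma psi_r0 u a i j c k (f : {ffun W -> K}) : three_strands u a i a j c k -> mxapp (psi_mx r) f u = 0.
Proof. by move=> h; rewrite (psi_r f h) swap_coef_same stay_coef_same !mul0r addr0. Qed.

Lemma psi_s0 u a i b j k (f : {ffun W -> K}) : three_strands u a i b j b k -> mxapp (psi_mx s) f u = 0.
Proof. by move=> h; rewrite (psi_s f h) swap_coef_same stay_coef_same !mul0r addr0. Qed.

Lemma swap_word_braid u : swap_word s (swap_word r (swap_word s u)) = swap_word r (swap_word s (swap_word r u)).
Proof. by apply/ffunP=> p; rewrite !ffunE (@sr_braid _ r s). Qed.

Definition ksign (i j k : 'Z_e) : K :=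
  if (k == i) && (i == j - 1) then -1 else if (k == i) && (i == j + 1) then 1 else 0.

(** Away from equal letters the relation is an identity of rational functions in the three
    eigenvalues, by cases on which residues coincide. If the outer residues agree and the
    middle one is adjacent to them, the correction term is the difference of two double
    crossings divided by the difference of the outer eigenvalues. *)
Lemma braid_distinct u a i b j c k (g : {ffun W -> K}) : three_strands u a i b j c k ->
  a != b -> b != c -> a != c ->
  mxapp (psi_mx r) (mxapp (psi_mx s) (mxapp (psi_mx r) g)) u =
  mxapp (psi_mx s) (mxapp (psi_mx r) (mxapp (psi_mx s) g)) u + ksign i j k * g u.
Proof.
move=> D0 ab bc ac; have ba : b != a by rewrite eq_sym.
have cb_ : c != b by rewrite eq_sym.
have D1 := three_strands_r D0 ab; have D2 := three_strands_s D0 bc.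
have D12 := three_strands_s D1 ac; have D21 := three_strands_r D2 ac.
have := xv_neq ab; have := xv_neq bc; have := xv_neq ac => hac hbc hab.
rewrite !(psi_r _ D0, psi_s _ D0, psi_r _ D1, psi_s _ D1, psi_r _ D2, psi_s _ D2,
  psi_r _ D12, psi_s _ D21, psi_s _ D12, psi_r _ D21) !swap_wordK swap_word_braid.
move: (g u) (g (swap_word r u)) (g (swap_word s u)) (g (swap_word s (swap_word r u))) (g (swap_word r (swap_word s u)))
  (g (swap_word r (swap_word s (swap_word r u)))) => g0 g1 g2 g12 g21 g121 {D0 D1 D2 D12 D21}.
(* Without equal outer residues, both sides expand to the same terms. *)
have [ik|ik] := eqVneq i k; last first.
  have -> : ksign i j k = 0 by rewrite /ksign eq_sym (negbTE ik).
  have [ij|ij] := eqVneq i j.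
    have jk : j != k by rewrite -ij.
    by rewrite !(stay_coef_ne _ _ ik) !(stay_coef_ne _ _ jk) ij (swap_coef_eq j ab) (stay_coef_eq j ab); ring.
  have [jk|jk] := eqVneq j k.
    by rewrite !(stay_coef_ne _ _ ij) !(stay_coef_ne _ _ ik) jk (swap_coef_eq k bc) (stay_coef_eq k bc); ring.
  by rewrite !(stay_coef_ne _ _ ij) !(stay_coef_ne _ _ ik) !(stay_coef_ne _ _ jk); ring.
rewrite -{}ik; have [ij|ij] := eqVneq i j.
  rewrite -ij /ksign eqxx (negbTE (sub1_neq i)) (negbTE (add1_neq i)) /=.
  have hba := xv_neq ba; have hcb := xv_neq cb_.
  rewrite (swap_coef_eq i ab) (stay_coef_eq i ab) (swap_coef_eq i ac) (stay_coef_eq i ac) (swap_coef_eq i bc) (stay_coef_eq i bc).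
  rewrite (swap_coef_eq i ba) (stay_coef_eq i ba) (swap_coef_eq i cb_) (stay_coef_eq i cb_).
  by field; rewrite hab hac hbc hba hcb.
have ji : j != i by rewrite eq_sym.
rewrite !(stay_coef_ne _ _ ij) !(stay_coef_ne _ _ ji) (swap_coef_eq i ac) (stay_coef_eq i ac).
have E : (swap_coef a i b j * swap_coef b j a i - swap_coef b j c i * swap_coef c i b j) * (xv a - xv c)^-1 = ksign i j i.
  have [f|/notfar nf] := boolP (far i j).
    rewrite (swap_coef_far ab f) [swap_coef b j c i * _](swap_coef_far bc) ?subrr ?mul0r /ksign ?eqxx /=.
      by case/and3P: f => _ /negbTE -> /negbTE ->.
    by rewrite far_sym.
  case: nf => [h|h|h]; first by rewrite h eqxx in ij.
    rewrite h mulrC [swap_coef a _ _ _ * _]mulrC (swap_coef_up j ba) (swap_coef_up j bc) /ksign eqxx /=.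
    have /negbTE -> : j + 1 != j - 1 by rewrite eq_sym sub1_neq_add1.
    by field.
  have hj : j = i + 1 by rewrite h subrK.
  rewrite hj (swap_coef_up i ab) [swap_coef b _ _ _ * _]mulrC (swap_coef_up i cb_) /ksign eqxx addrK eqxx /=.
  by field.
apply/eqP; rewrite -subr_eq0 -E; apply/eqP; ring.
Qed.

(** If letters coincide, the residues of the corresponding boxes differ by the distance in
    their column, and most terms vanish. *)
Lemma braid_words u (g : {ffun W -> K}) :
  mxapp (psi_mx r) (mxapp (psi_mx s) (mxapp (psi_mx r) g)) u =
  mxapp (psi_mx s) (mxapp (psi_mx r) (mxapp (psi_mx s) g)) u +
  ksign (word_res u (lo r)) (word_res u (hi r)) (word_res u (hi s)) * g u.
Proof.
have : three_strands u (u (lo r)) (word_res u (lo r)) (u (hi r)) (word_res u (hi r)) (u (hi s)) (word_res u (hi s)) by [].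
have Rr : u (lo r) = u (hi r) -> word_res u (hi r) = word_res u (lo r) - 1 by exact: word_res_eq.
have Rs : u (hi r) = u (hi s) -> word_res u (hi s) = word_res u (hi r) - 1.
  by rewrite -hi_lo; exact: word_res_eq.
have Rrs : u (lo r) = u (hi s) -> u (lo r) != u (hi r) -> word_res u (hi s) = word_res u (lo r) - 1.
  move=> E ne; have E' : swap_word s u (lo r) = swap_word s u (hi r).
    by rewrite -hi_lo swap_word_lo -E ffunE ss_fix.
  have ne' : u (lo s) != u (hi s) by rewrite hi_lo -E eq_sym.
  by have := word_res_eq E'; rewrite !word_res_swap // ss_fix -hi_lo sr_lo.
move: (u (lo r)) (u (hi r)) (u (hi s)) (word_res u (lo r)) (word_res u (hi r)) (word_res u (hi s)) Rr Rs Rrs.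
move=> a b c i j k Rr Rs Rrs D0.
have [ab|ab] := eqVneq a b; have [bc|bc] := eqVneq b c.
- rewrite -bc -ab in D0; have k2 : k = i - 1 - 1 by rewrite Rs // Rr.
  rewrite (psi_r0 _ D0) (psi_s0 _ D0) add0r /ksign.
  have /negbTE -> : k != i; last by rewrite mul0r.
  by rewrite k2 sub2_neq.
- rewrite -ab in D0 bc; have jE := Rr ab.
  have D2 := three_strands_s D0 bc; have D21 := three_strands_r D2 bc.
  rewrite (psi_r0 _ D0) (psi_s _ D0) (psi_r0 _ D0) mulr0 addr0 (psi_r _ D2).
  rewrite (psi_s0 _ D21) mulr0 add0r (psi_s _ D2) swap_wordK.
  have [ik|ik] := eqVneq i k; last first.
    by rewrite (stay_coef_ne _ _ ik) !mul0r mulr0 add0r /ksign eq_sym (negbTE ik) mul0r.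
  rewrite -ik jE in D0 * => {D2 D21}.
  have ne : i != i - 1 := sub1_neq i.
  rewrite (stay_coef_ne _ _ ne) mul0r addr0 (stay_coef_eq i bc) /ksign eqxx /= subrK eqxx.
  have /negbTE -> : i != i - 1 - 1.
    by rewrite eq_sym sub2_neq.
  have := swap_coef_up (i - 1) bc; rewrite subrK => E.
  have h := xv_neq bc; apply/eqP; rewrite eq_sym addr_eq0; apply/eqP.
  have -> : swap_coef a (i - 1) c i * ((xv a - xv c)^-1 * (swap_coef c i a (i - 1) * g u)) =
    (swap_coef a (i - 1) c i * swap_coef c i a (i - 1)) * (xv a - xv c)^-1 * g u by ring.
  by rewrite E; field.
- rewrite -bc in D0; have kE := Rs bc; have ba : b != a by rewrite eq_sym.
  have D1 := three_strands_r D0 ab; have D12 := three_strands_s D1 ab.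
  rewrite [RHS]addrC (psi_s0 _ D0) addr0 (psi_r _ D0) (psi_s0 _ D0) mulr0 addr0.
  rewrite (psi_s _ D1) (psi_r0 _ D12) mulr0 add0r (psi_r _ D1) swap_wordK.
  have [ik|ik] := eqVneq i k; last first.
    by rewrite (stay_coef_ne _ _ ik) !mul0r mulr0 /ksign eq_sym (negbTE ik) mul0r.
  rewrite -ik in kE *; have jE : j = i + 1 by rewrite kE subrK.
  have ne : j != i by rewrite jE eq_sym add1_neq.
  rewrite (stay_coef_ne _ _ ne) mul0r addr0 (stay_coef_eq i ab) /ksign eqxx /= -kE eqxx.
  have E := swap_coef_up i ab; rewrite -jE in E.
  have h := xv_neq ab.
  have -> : swap_coef a i b j * ((xv a - xv b)^-1 * (swap_coef b j a i * g u)) =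
    (swap_coef a i b j * swap_coef b j a i) * (xv a - xv b)^-1 * g u by ring.
  by rewrite E; field.
have [ac|ac] := eqVneq a c; last exact: (braid_distinct g D0 ab bc ac).
rewrite -ac in D0 bc; have kE := Rrs ac ab.
have D1 := three_strands_r D0 ab; have D2 := three_strands_s D0 bc.
have -> : mxapp (psi_mx r) (mxapp (psi_mx s) (mxapp (psi_mx r) g)) u =
    stay_coef a i b j * (stay_coef b j a k * mxapp (psi_mx r) g u).
  by rewrite (psi_r _ D0) (psi_s0 _ D1) mulr0 add0r (psi_s _ D0) (psi_r0 _ D2) mulr0 add0r.
have -> : mxapp (psi_mx s) (mxapp (psi_mx r) (mxapp (psi_mx s) g)) u =
    stay_coef b j a k * (stay_coef a i b j * mxapp (psi_mx s) g u).
  by rewrite (psi_s _ D0) (psi_r0 _ D2) mulr0 add0r (psi_r _ D0) (psi_s0 _ D1) mulr0 add0r.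
have ki : k != i by rewrite kE eq_sym sub1_neq.
rewrite /ksign (negbTE ki) mul0r addr0.
have [ij|ij] := eqVneq i j; last by rewrite (stay_coef_ne _ _ ij) !mul0r mulr0.
have jk : j != k by rewrite -ij eq_sym.
by rewrite (stay_coef_ne _ _ jk) !mul0r mulr0.
Qed.

End Braid.

Lemma row_of0 u p : p = 0%N :> nat -> row_of u p = 0%N.
Proof. by move=> p0; apply/eqP; rewrite cards_eq0; apply/eqP/setP=> q; rewrite !inE p0. Qed.

Lemma stay_coef_neq0 a i b j : stay_coef a i b j != 0 -> i = j.
Proof. by rewrite /stay_coef; case: ifP; rewrite ?eqxx // => /andP[_ /eqP]. Qed.

Lemma act_s_id r (i : resseq e n) : i (lo r) = i (hi r) -> act_s r i = i.
Proof.
move=> h; apply/ffunP=> p; rewrite ffunE.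
have [->|h1] := eqVneq p (lo r); first by rewrite sr_lo.
by have [->|h2] := eqVneq p (hi r); rewrite ?sr_hi // sr_out.
Qed.

Lemma cb0 r u : u (lo r) = u (hi r) -> cb r u = 0.
Proof. by move=> E; rewrite /cb E stay_coef_same. Qed.

Lemma ca0 r u : u (lo r) = u (hi r) -> ca r u = 0.
Proof. by move=> E; rewrite /ca E swap_coef_same. Qed.

Lemma word_resE r u i : word_res_seq u = i -> word_res u (lo r) = i (lo r) /\ word_res u (hi r) = i (hi r).
Proof. by move=> <-; rewrite !ffunE. Qed.

Lemma letters_of_res r u : word_res u (hi r) != word_res u (lo r) - 1 -> u (lo r) != u (hi r).
Proof. by apply: contra => /eqP /word_res_eq ->. Qed.

Lemma mxapp_sq r (f : {ffun W -> K}) u : mxapp (psi_mx r) (mxapp (psi_mx r) f) u =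
  (ca r u * ca r (swap_word r u) + cb r u * cb r u) * f u.
Proof.
rewrite !mxapp_psi swap_wordK.
have [ab|ab] := eqVneq (u (lo r)) (u (hi r)); first by rewrite (ca0 ab) (cb0 ab); ring.
have -> : cb r (swap_word r u) = - cb r u.
  by rewrite /cb swap_word_lo swap_word_hi !word_res_swap // sr_lo sr_hi stay_coef_opp.
by ring.
Qed.

Variables (R : comNzRingType) (tau : {rmorphism R -> K}) (x : 'I_l -> R).
Hypothesis xvE : forall m, xv m = tau (x m).

Definition scalar_of (c : R) : 'M[K]_#|{: W}| := (tau c)%:M.

Lemma mxapp_sc c f u : mxapp (scalar_of c) f u = tau c * f u.
Proof. exact: mxapp_scalar. Qed.

Lemma mxapp_bool (b : bool) (f : {ffun W -> K}) u : mxapp b%:R f u = b%:R * f u.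
Proof. by case: b; rewrite ?mxapp1 ?mxapp0 ?mul1r ?mul0r. Qed.

Lemma mxapp_sum (J : finType) (X : J -> 'M[K]_#|{: W}|) f u :
  mxapp (\sum_j X j) f u = \sum_j mxapp (X j) f u.
Proof.
apply: (big_morph (fun Y => mxapp Y f u)) => [Y Z|]; [exact: mxappD | exact: mxapp0].
Qed.

(** A relation multiplied by [e(i)] has to be checked only on words of residue sequence [i]. *)
Lemma mxapp_id_eq i f u (c d : K) :
  (word_res_seq u = i -> c = d) -> c * mxapp (idem_mx i) f u = d * mxapp (idem_mx i) f u.
Proof. by rewrite mxapp_id => h; case: eqP => [/h ->|] //; rewrite !mul0r !mulr0. Qed.

Lemma stay_delta r i f u : cb r u * (xv (u (lo r)) - xv (u (hi r))) * mxapp (idem_mx i) f u =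
  (i (lo r) == i (hi r))%:R * mxapp (idem_mx i) f u.
Proof.
apply: mxapp_id_eq => /(@word_resE r) [<- <-].
have [E|ne] := eqVneq (word_res u (lo r)) (word_res u (hi r)); last by rewrite /cb stay_coef_ne // mul0r.
have ab : u (lo r) != u (hi r) by apply: letters_of_res; rewrite -E sub1_neq.
by rewrite /cb -E stay_coef_eq // mulVf // xv_neq.
Qed.

(** The words give a representation of the deformed relations as soon as the [x m] are
    distinct in a field. The relations on the first two residues hold since the first two
    boxes of a path are in the first row or in one column. *)
Lemma matrix_deformed : deformed_blob kappa scalar_of x psi_mx y_mx idem_mx.
Proof.
split.
- by rewrite /scalar_of rmorph1.
- by move=> a b; rewrite /scalar_of rmorphD raddfD.
- by move=> a b; rewrite /scalar_of rmorphM scalar_mxM.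
- by move=> c a; apply/esym/scalar_mxC.
- move=> i j; apply: mxapp_inj => f u; rewrite mxappM !mxapp_id.
  case: (eqVneq i j) => [->|ne]; first by rewrite mxapp_id; case: eqP => _; rewrite ?mul0r ?mul1r.
  rewrite mxapp0; case: eqP => [->|]; last by rewrite mul0r.
  by rewrite (negbTE ne) mul0r mulr0.
- apply: mxapp_inj => f u; rewrite mxapp_sum mxapp1 (bigD1 (word_res_seq u)) //= mxapp_id eqxx mul1r.
  by rewrite big1 ?addr0 // => i; rewrite mxapp_id eq_sym => /negbTE ->; rewrite mul0r.
- move=> i k k0 ne; apply: mxapp_inj => f u; rewrite mxapp_id mxapp0.
  case: eqP => [E|]; last by rewrite mul0r.
  by case: (ne (u k)); rewrite -E ffunE /word_res row_of0 // subr0.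
- move=> i k k' m k0 k1 ik ik'; apply: mxapp_inj => f u; rewrite mxapp_id mxapp0.
  case: eqP => [E|]; last by rewrite mul0r.
  have r_lt : (0 < n.-1)%N by have := ltn_ord k'; rewrite k1; lia.
  pose r := Ordinal r_lt; have Ek : k = lo r by apply: val_inj; rewrite /= k0.
  have Ek' : k' = hi r by apply: val_inj; rewrite /= k1.
  move: ik'; rewrite -E !ffunE Ek Ek'.
  have [ab|ab] := eqVneq (u (lo r)) (u (hi r)).
    by rewrite (word_res_eq ab) => /eqP; rewrite (negbTE (sub1_neq_add1 _)).
  rewrite /word_res (@row_of0 u (lo r)) // subr0 [row_of u (hi r)](_ : _ = 0%N) ?subr0.
    by move=> h; have := K1 ab; rewrite far_sym => /and3P[_ /eqP].
  apply/eqP; rewrite cards_eq0; apply/eqP/setP=> q; rewrite !inE /=.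
  apply/negbTE/negP => /andP[q1 /eqP Eq]; case/eqP: ab; rewrite -Eq; congr (u _).
  by apply: val_inj => /=; lia.
- move=> i k m k0 ik; apply: mxapp_inj => f u; rewrite !mxappM mxapp_y mxapp_sc.
  apply: mxapp_id_eq => E; move: ik; rewrite -E ffunE /word_res row_of0 // subr0 => h.
  rewrite -xvE; congr xv; apply/eqP; apply: contraT => /K1 /and3P[/eqP]; by rewrite h.
- by move=> k i; apply: mxapp_inj => f u; rewrite !mxappM !mxapp_y !mxapp_id mxapp_y mulrCA.
- move=> r i; apply: mxapp_inj => f u; rewrite !mxappM !mxapp_psi !mxapp_id mxapp_psi.
  have [ab|ab] := eqVneq (u (lo r)) (u (hi r)); first by rewrite (ca0 ab) (cb0 ab); ring.
  have act_eq (j j' : resseq e n) : (act_s r j == j') = (j == act_s r j').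
    by rewrite -(inj_eq (inv_inj (@act_sK e n r))) act_sK.
  rewrite word_res_seq_swap // act_eq.
  have [->|/stay_coef_neq0 h] := eqVneq (cb r u) 0; first by ring.
  have -> : (word_res_seq u == i) = (word_res_seq u == act_s r i) by rewrite -act_eq act_s_id // !ffunE.
  by ring.
- move=> r k h1 h2; apply: mxapp_inj => f u; rewrite !mxappM mxapp_psi !mxapp_y mxapp_psi.
  by rewrite swap_word_out; [ring | apply/eqP..].
- move=> r s h; apply: mxapp_inj => f u; rewrite !mxappM !mxapp_psi.
  have H (r' s' : 'I_n.-1) : ((r'.+1 < s') || (s'.+1 < r'))%N ->
      ca s' (swap_word r' u) = ca s' u /\ cb s' (swap_word r' u) = cb s' u.
    move=> h'; rewrite /ca /cb.
    have o1 : simple_refl r' (lo s') = lo s' by apply: sr_out; rewrite -val_eqE /=; lia.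
    have o2 : simple_refl r' (hi s') = hi s' by apply: sr_out; rewrite -val_eqE /=; lia.
    have [ab|ab] := eqVneq (u (lo r')) (u (hi r')); first by rewrite swap_word_eq.
    by rewrite !word_res_swap // !ffunE o1 o2.
  have [-> ->] := H r s h; have [|-> ->] := H s r; first by rewrite orbC.
  have -> : swap_word s (swap_word r u) = swap_word r (swap_word s u) by apply/ffunP=> p; rewrite !ffunE sr_comm.
  by ring.
- move=> r i; apply: mxapp_inj => f u; rewrite !mxappM mxappD mxappN !mxappM.
  rewrite mxapp_psi !mxapp_y mxapp_psi mxapp_bool swap_word_hi -(stay_delta r i f u); ring.
- move=> r i; apply: mxapp_inj => f u; rewrite !mxappM mxappD mxappN !mxappM.
  rewrite !mxapp_y !mxapp_psi !mxapp_y mxapp_bool swap_word_lo -(stay_delta r i f u); ring.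
- move=> r i h; apply: mxapp_inj => f u; rewrite !mxappM mxapp_sq mxapp0.
  rewrite -[RHS](mul0r (mxapp (idem_mx i) f u)); apply: mxapp_id_eq => /(@word_resE r) [E1 E2].
  have E : word_res u (lo r) = word_res u (hi r) by rewrite E1 E2 h.
  have ab : u (lo r) != u (hi r) by apply: letters_of_res; rewrite -E sub1_neq.
  have ba : u (hi r) != u (lo r) by rewrite eq_sym.
  rewrite /ca /cb swap_word_lo swap_word_hi !word_res_swap // sr_lo sr_hi -E (swap_coef_eq _ ab) (swap_coef_eq _ ba) (stay_coef_eq _ ab).
  have h1 := xv_neq ab; have h2 := xv_neq ba.
  by field; rewrite h1 h2.
- move=> r i h1 h2 h3; apply: mxapp_inj => f u; rewrite !mxappM mxapp_sq.
  rewrite -[RHS]mul1r; apply: mxapp_id_eq => /(@word_resE r) [E1 E2].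
  have fr : far (word_res u (lo r)) (word_res u (hi r)) by rewrite E1 E2; apply/and3P; split; apply/eqP.
  have ab : u (lo r) != u (hi r).
    apply: letters_of_res; rewrite E1 E2; apply/eqP => h; apply: h2; by rewrite h subrK.
  rewrite /ca /cb swap_word_lo swap_word_hi !word_res_swap // sr_lo sr_hi swap_coef_far //.
  by rewrite stay_coef_ne ?mulr0 ?addr0 //; case/and3P: fr.
- move=> r i h; apply: mxapp_inj => f u; rewrite !mxappM mxapp_sq mxappD mxappN !mxapp_y.
  rewrite -mulrBl; apply: mxapp_id_eq => /(@word_resE r) [E1 E2].
  have E : word_res u (hi r) = word_res u (lo r) + 1 by rewrite E1 E2 h.
  have ab : u (lo r) != u (hi r) by apply: letters_of_res; rewrite E eq_sym sub1_neq_add1.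
  rewrite /ca /cb swap_word_lo swap_word_hi !word_res_swap // sr_lo sr_hi E swap_coef_up //.
  by rewrite stay_coef_ne ?mulr0 ?addr0 // add1_neq.
- move=> r i h; apply: mxapp_inj => f u; rewrite !mxappM mxapp_sq mxappD mxappN !mxapp_y.
  rewrite -mulrBl; apply: mxapp_id_eq => /(@word_resE r) [E1 E2].
  have [ab|ab] := eqVneq (u (lo r)) (u (hi r)).
    by rewrite (ca0 ab) (cb0 ab) ab; ring.
  have ba : u (hi r) != u (lo r) by rewrite eq_sym.
  have E : word_res u (lo r) = word_res u (hi r) + 1 by rewrite E1 E2 h subrK.
  rewrite /ca /cb swap_word_lo swap_word_hi !word_res_swap // sr_lo sr_hi E mulrC swap_coef_up //.
  by rewrite stay_coef_ne ?mulr0 ?addr0 // eq_sym add1_neq.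
move=> r s i sr; apply: mxapp_inj => f u; rewrite !mxappM mxappD !mxappM braid_words //.
congr (_ + _); rewrite mxapp_id.
have -> : mxapp (braid_sign 'M[K]_#|{: W}| i r s) (mxapp (idem_mx i) f) u =
    ksign (i (lo r)) (i (hi r)) (i (hi s)) * mxapp (idem_mx i) f u.
  rewrite /braid_sign /ksign; case: ifP => _; last case: ifP => _.
  - by rewrite mxappN mxapp1 mulN1r.
  - by rewrite mxapp1 mul1r.
  - by rewrite mxapp0 mul0r.
by rewrite -mxapp_id; apply: mxapp_id_eq => <-; rewrite !ffunE.
Qed.

End Words.

(** * The words of tableaux *)

(** Look at an index of maximal rank with a nonzero coefficient. *)
Lemma triangular_indep (I : finType) (K : fieldType) (T : I -> I -> K) (rk : I -> nat)
  (c : I -> K) :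
  (forall i, T i i != 0) -> (forall i j, T i j != 0 -> i != j -> (rk j < rk i)%N) ->
  (forall j, \sum_i c i * T i j = 0) -> forall i, c i = 0.
Proof.
move=> Td Tt S i0; apply/eqP; apply: contraT => ci0.
have [i ci max] := @arg_maxnP _ i0 (fun i => c i != 0) rk ci0; have := S i; rewrite (bigD1 i) //= big1 ?addr0.
  by move/eqP; rewrite mulf_eq0 (negbTE ci) (negbTE (Td i)).
move=> j ji; have [->|cj] := eqVneq (c j) 0; first by rewrite mul0r.
have [->|tj] := eqVneq (T j i) 0; first by rewrite mulr0.
by have := Tt _ _ tj ji; have := max j cj; lia.
Qed.

Section TableauWords.
Variables (e l n : nat) (kappa : 'I_l -> 'Z_e).
Hypothesis K1 : forall m m', m != m' -> far (kappa m) (kappa m').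
Notation W := {ffun 'I_n -> 'I_l}.
Implicit Types (u v : W) (lam : par1 l n) (p q : 'I_n).

Definition tab_word lam (t : tab lam) : W := [ffun p => (val t p).2].

Definition word_box u p : nat * 'I_l := (row_of u p, u p).

Definition word_inversions u : nat := count_inversions (fun b b' : nat * 'I_l => box_lt b' b) (word_box u).

Definition word_weight u : nat := (\sum_p row_weight n (row_of u p))%N.

Definition content u : {ffun 'I_l -> nat} := [ffun m => #|[set p | u p == m]|].

Lemma tab_mem lam (t : tab lam) y : (y \in [set val t p | p in [set: 'I_n]]) = (y.1 < val lam y.2)%N.
Proof. by have /andP[_ /eqP ->] := valP t; rewrite inE. Qed.

(** In a standard tableau the entries of a component fill its column in increasing order, so
    the path of its word adds exactly its boxes. *)
Lemma row_of_std lam (t : std lam) p : row_of (tab_word (val t)) p = (val (val t) p).1.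
Proof.
set T := val t; have inj := @tab_inj _ _ _ T.
have stP q q' : (val T q).2 = (val T q').2 -> ((val T q).1 < (val T q').1)%N -> (q < q')%N.
  move=> E lt; have /forallP/(_ q)/forallP/(_ q')/implyP := valP t; apply.
  by rewrite E eqxx lt.
rewrite -[RHS](card_ord (val T p).1) /row_of -(card_imset _ inj).
pose h (i : 'I_(val T p).1) : node l n := (widen_ord (ltnW (ltn_ord (val T p).1)) i, (val T p).2).
have hI : injective h by move=> i j [E]; apply: val_inj.
rewrite -[RHS](card_imset _ hI); congr #|pred_of_set _|; apply/setP=> y.
apply/imsetP/imsetP => [[q]|[i _ ->]].
  rewrite inE !ffunE => /andP[qp /eqP E] ->.
  have lt : ((val T q).1 < (val T p).1)%N.
    case: (ltngtP (val T q).1 (val T p).1) => // [gt|/val_inj E1].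
      by have := stP p q (esym E) gt; lia.
    have /inj Eq : val T q = val T p by case: (val T q) (val T p) E E1 => [a b] [c d] /= -> ->.
    by rewrite Eq ltnn in qp.
  exists (Ordinal lt) => //; rewrite /h -E; case: (val T q) lt => a b lt /=.
  by congr (_, _); apply: val_inj.
have : h i \in [set val T p | p in [set: 'I_n]].
  rewrite tab_mem /=; apply: (ltn_trans (ltn_ord i)).
  by rewrite -(tab_mem T); apply: imset_f.
case/imsetP=> q _ E; exists q => //; rewrite inE !ffunE -E /= eqxx andbT.
by apply: stP; rewrite -E //=.
Qed.

Lemma word_box_std lam (t : std lam) p : word_box (tab_word (val t)) p = node_box (init_node lam (d_perm (val t) p)).
Proof. by rewrite /word_box row_of_std ffunE /init_node d_permE. Qed.

Lemma word_inversions_std lam (t : std lam) : word_inversions (tab_word (val t)) = inversions (d_perm (val t)).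
Proof.
rewrite /word_inversions /inversions /count_inversions; apply: eq_card => -[p q].
by rewrite !inE !word_box_std box_lt_initE.
Qed.

Lemma tab_word_inj lam (s t : std lam) : tab_word (val s) = tab_word (val t) -> s = t.
Proof.
move=> E; apply/val_inj/val_inj/ffunP=> p.
have := congr1 (fun u => word_box u p) E; rewrite /= /word_box !row_of_std !ffunE.
by case: (val (val s) p) (val (val t) p) => [a b] [c d] [/val_inj -> ->].
Qed.

Lemma content_std lam (t : std lam) m : content (tab_word (val t)) m = val lam m.
Proof.
rewrite ffunE; set T := val t; have inj := @tab_inj _ _ _ T.
have le : (val lam m <= n)%N by rewrite -ltnS.
pose h (i : 'I_(val lam m)) : node l n := (widen_ord le i, m).
have hI : injective h by move=> i j [E]; apply: val_inj.
rewrite -[RHS]card_ord -[RHS](card_imset _ hI) -(card_imset _ inj).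
congr #|pred_of_set _|; apply/setP=> y; apply/imsetP/imsetP => [[q]|[i _ ->]].
  rewrite inE ffunE => /eqP E ->; have lt : ((val T q).1 < val lam m)%N.
    by rewrite -E -(tab_mem T) imset_f.
  exists (Ordinal lt) => //; rewrite /h [LHS]surjective_pairing E.
  by congr (_, _); apply: val_inj.
have : h i \in [set val T p | p in [set: 'I_n]] by rewrite tab_mem /=.
by case/imsetP=> q _ E; exists q; rewrite // inE ffunE -E.
Qed.

Lemma word_weight_std lam (t : std lam) : word_weight (tab_word (val t)) = shape_weight lam.
Proof.
rewrite shape_weightE (reindex_inj (@perm_inj _ (d_perm (val t)))) /=.
by apply: eq_bigr => p _; rewrite row_of_std /init_node d_permE.
Qed.

Definition init_std lam : std lam := exist _ (init_tab lam) (init_is_std lam).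
Definition init_word lam : W := tab_word (init_tab lam).

Lemma row_of_init lam p : row_of (init_word lam) p = (init_node lam p).1.
Proof. exact: row_of_std (init_std lam) p. Qed.

Lemma init_wordE lam p : init_word lam p = (init_node lam p).2.
Proof. by rewrite [LHS]ffunE. Qed.

Lemma res_init_word lam : word_res_seq kappa (init_word lam) = res_par kappa lam.
Proof. by apply/ffunP=> p; rewrite res_parE [LHS]ffunE /word_res row_of_init init_wordE. Qed.

Lemma word_res_box lam u p : word_res_seq kappa u = res_par kappa lam ->
  kappa (u p) - (row_of u p)%:R = kappa (init_node lam p).2 - (init_node lam p).1%:R.
Proof. by move/(congr1 (fun f : resseq e n => f p)); rewrite res_parE [LHS]ffunE. Qed.

Lemma row_of_pred u p c : row_of u p = c.+1 -> exists2 q : 'I_n, (q < p)%N & u q = u p /\ row_of u q = c.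
Proof.
move=> E; have : (0 < row_of u p)%N by rewrite E.
rewrite card_gt0 => /set0Pn[q0]; rewrite inE => hq0.
have [q hq max] := @arg_maxnP _ q0 (fun q => (q < p)%N && (u q == u p)) (fun q => q : nat) hq0.
have /andP[qp /eqP uq] := hq; exists q => //; split=> //.
move: E; rewrite /row_of (cardsD1 q) inE hq add1n => -[<-]; apply: eq_card => q'.
rewrite !inE uq; case: (eqVneq (u q') (u p)) => [Eq|]; rewrite ?andbF // !andbT.
apply/idP/andP => [lt|[ne lt]]; first by split; [rewrite -val_eqE /=|]; lia.
have := max q'; rewrite lt Eq eqxx => /(_ isT); move: ne; rewrite -val_eqE /=; lia.
Qed.

Lemma init_row_mono lam p q : (p <= q)%N -> ((init_node lam p).1 <= (init_node lam q).1)%N.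
Proof.
rewrite leq_eqVlt => /orP[/eqP/val_inj -> //|/(box_lt_init lam)]; rewrite /box_lt /=; lia.
Qed.

(** The path of [lam] by rows adds the boxes as high up as possible: induction on the
    position. If the box added at [p] by [u] were lower than that of [lam], the box above it
    would have been added earlier, in a row that [lam] has not left; then the two boxes at
    [p] are one row apart, and equal residues would make two charges adjacent. *)
Lemma row_of_le lam u p : word_res_seq kappa u = res_par kappa lam -> (row_of u p <= (init_node lam p).1)%N.
Proof.
move=> E; have rsP q := word_res_box q E.
have [N] := ubnP (nat_of_ord p); elim: N p => // N IH p pN.
rewrite leqNgt; apply/negP => lt; case Ec: (row_of u p) lt => [//|c]; rewrite ltnS => lt.
have [q qp [uq Eq]] := row_of_pred Ec.
have h1 : (c <= (init_node lam q).1)%N by rewrite -Eq; apply: IH; lia.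
have h2 := @init_row_mono lam q p (ltnW qp).
have Ecr : c = (init_node lam p).1 by lia.
have := rsP p; rewrite Ec Ecr => h.
apply: (@kappa_adj _ _ _ K1 (init_node lam p).2 (u p)); apply: esym.
apply: (eq_of_subr h); rewrite -natr1; ring.
Qed.

(** Boxes in higher rows are heavier; this is one half of the triangularity: [e(i^lam)]
    annihilates all words of shapes lighter than [lam]. *)
Lemma word_weight_ge lam u : word_res_seq kappa u = res_par kappa lam -> (shape_weight lam <= word_weight u)%N.
Proof.
move=> E; rewrite shape_weightE; apply: leq_sum => p _; apply: row_weight_le; exact: row_of_le.
Qed.

(** Equal weight forces equal rows, and in a given row the residue determines the component. *)
Lemma word_weight_eq lam u : word_res_seq kappa u = res_par kappa lam -> word_weight u = shape_weight lam ->
  u = init_word lam.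
Proof.
move=> E Ew; have rows p : row_of u p = (init_node lam p).1.
  have le q := @row_of_le lam u q E; have n0 : (0 < n)%N by case: (n) p => // -[].
  apply/eqP; rewrite eqn_leq le /= leqNgt; apply/negP => lt.
  have : (shape_weight lam < word_weight u)%N; last by rewrite Ew ltnn.
  rewrite shape_weightE /word_weight (bigD1 p) //= [X in (_ < X)%N](bigD1 p) //= -addSn leq_add //.
    by rewrite /row_weight ltn_exp2l //; have := ltn_ord (init_node lam p).1; lia.
  by apply: leq_sum => q _; apply: row_weight_le.
apply/ffunP=> p; have h := word_res_box p E; rewrite rows in h.
by rewrite init_wordE; apply: (@kappa_inj _ _ _ K1); apply: (addIr _ h).
Qed.

Lemma word_weight_swap r u : word_weight (swap_word r u) = word_weight u.
Proof.
have [ab|ab] := eqVneq (u (lo r)) (u (hi r)); first by rewrite swap_word_eq.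
rewrite /word_weight [RHS](reindex_inj (inv_inj (srK r))) /=.
by apply: eq_bigr => p _; rewrite row_of_swap.
Qed.

Lemma content_swap r u : content (swap_word r u) = content u.
Proof.
apply/ffunP=> m; rewrite !ffunE -(card_imset _ (inv_inj (srK r))).
apply: eq_card => p; rewrite -[p](srK r) (mem_imset _ _ (inv_inj (srK r))).
by rewrite !inE !ffunE srK.
Qed.

Lemma word_inversions_swap r u : (word_inversions (swap_word r u) <= (word_inversions u).+1)%N.
Proof.
have [ab|ab] := eqVneq (u (lo r)) (u (hi r)); first by rewrite swap_word_eq.
have ba : swap_word r u (lo r) != swap_word r u (hi r) by rewrite swap_word_lo swap_word_hi eq_sym.
have E v : v (lo r) != v (hi r) -> word_box (swap_word r v) =1 word_box v \o simple_refl r.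
  by move=> ne p; rewrite /word_box /= row_of_swap // ffunE.
have tot : box_lt (word_box u (hi r)) (word_box u (lo r)) = ~~ box_lt (word_box u (lo r)) (word_box u (hi r)).
  by move: ab; rewrite -val_eqE /box_lt /word_box /=; lia.
have [lt|lt] := boolP (box_lt (word_box u (lo r)) (word_box u (hi r))).
  rewrite /word_inversions (eq_count_inversions _ (E u ab)) count_inversions_swap //; first by rewrite tot lt.
have -> : word_inversions u = (word_inversions (swap_word r u)).+1; last by rewrite leqW.
rewrite -{1}[u](swap_wordK r) /word_inversions (eq_count_inversions _ (E _ ba)) count_inversions_swap //.
  by rewrite !(E u ab) /= sr_lo sr_hi; apply/negbTE.
by rewrite !(E u ab) /= sr_lo sr_hi tot.
Qed.

Lemma init_word_inversions lam : word_inversions (init_word lam) = 0%N.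
Proof. by rewrite (word_inversions_std (init_std lam)) d_perm_init inversions1. Qed.

Section Transitions.
Variables (K : fieldType) (al be : 'I_n.-1 -> W -> K) (g : seq 'I_n.-1 -> W -> K) (v0 : W).
Hypothesis g0 : forall v, g [::] v = (v == v0)%:R.
Hypothesis gS : forall r s v, g (r :: s) v = al r v * g s (swap_word r v) + be r v * g s v.
Hypothesis al_neq0 : forall r v, v (lo r) != v (hi r) -> al r v != 0.

(** Here [g s v] stands for a matrix coefficient, between the words [v0] and [v], of the
    product of the [psi_r] along [s]. *)
Lemma transition_inv (T : Type) (h : W -> T) s v : (forall r u, h (swap_word r u) = h u) ->
  g s v != 0 -> h v = h v0.
Proof.
move=> hI; elim: s v => [|r s IH] v; first by rewrite g0; case: (v =P v0) => [-> //|_]; rewrite eqxx.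
rewrite gS; have [->|/IH <-] := eqVneq (g s v) 0; last by [].
rewrite mulr0 addr0 mulf_eq0 negb_or => /andP[_ /IH]; by rewrite hI.
Qed.

Fixpoint word_path (s : seq 'I_n.-1) : W := if s is r :: s' then swap_word r (word_path s') else v0.

Hypothesis len0 : word_inversions v0 = 0%N.

(** Each letter of [s] raises the number of inversions by at most one. *)
Lemma transition_inversions s v : g s v != 0 -> (word_inversions v <= size s)%N.
Proof.
elim: s v => [|r s IH] v; first by rewrite g0; case: (v =P v0) => [->|_]; rewrite ?len0 ?eqxx.
rewrite gS; have [->|/IH h _] := eqVneq (g s v) 0; last exact: leqW.
rewrite mulr0 addr0 mulf_eq0 negb_or => /andP[_ /IH h].
by have := word_inversions_swap r (swap_word r v); rewrite swap_wordK /=; lia.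
Qed.

Lemma word_path_inversions s : (word_inversions (word_path s) <= size s)%N.
Proof.
elim: s => [|r s IH] /=; first by rewrite len0.
by apply: leq_trans (word_inversions_swap _ _) _.
Qed.

(** The maximal number of inversions is reached only if each letter exchanges two letters of
    the word, so the result is unique and its coefficient is a product of the [al]. *)
Lemma transition_top s v : word_inversions v = size s -> (g s v != 0) = (v == word_path s).
Proof.
elim: s v => [|r s IH] v /=; first by rewrite g0; case: (v =P v0) => _; rewrite ?eqxx ?oner_eq0.
(* The remaining letters cannot reach so many inversions without the first one. *)
move=> lv; rewrite gS; have -> : g s v = 0.
  by apply/eqP; apply: contraT => /transition_inversions; rewrite lv ltnn.
rewrite mulr0 addr0 mulf_eq0 negb_or.
have ne : word_inversions (swap_word r v) = size s -> v (lo r) != v (hi r).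
  by move=> h; apply/eqP => ab; move: h; rewrite swap_word_eq // lv; lia.
have step := word_inversions_swap r (swap_word r v); rewrite swap_wordK lv ltnS in step.
apply/andP/eqP => [[_ h]|E].
  have ls : word_inversions (swap_word r v) = size s by apply/eqP; rewrite eqn_leq step (transition_inversions h).
  by move: h; rewrite (IH _ ls) => /eqP <-; rewrite swap_wordK.
have Es : swap_word r v = word_path s by rewrite E swap_wordK.
have ls : word_inversions (swap_word r v) = size s by apply/eqP; rewrite eqn_leq step Es word_path_inversions.
by rewrite (IH _ ls) Es eqxx; split=> //; apply/al_neq0/ne.
Qed.

End Transitions.

Lemma word_pathE v0 s p : word_path v0 s p = v0 (word_perm (rev s) p).
Proof.
elim: s p => [|r s IH] p; first by rewrite /= perm1.
by rewrite /= ffunE IH rev_cons -cats1 word_perm_cat /= mul1g permM.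
Qed.

Lemma word_path_std lam (t : std lam) s : word_perm s = d_perm (val t) ->
  word_path (init_word lam) (rev s) = tab_word (val t).
Proof.
by move=> E; apply/ffunP=> p; rewrite word_pathE revK E init_wordE [RHS]ffunE /init_node d_permE.
Qed.

End TableauWords.

(** * Triangularity and independence over a field *)

Section MatrixIndependence.
Variables (e l n : nat) (kappa : 'I_l -> 'Z_e) (K : fieldType) (xv : 'I_l -> K).
Hypothesis K1 : forall m m', m != m' -> far (kappa m) (kappa m').
Hypothesis xv_inj : injective xv.
Variable red : 'S_n -> seq 'I_n.-1.
Hypothesis redP : forall w, reduced_expr w (red w).
Notation W := {ffun 'I_n -> 'I_l}.
Implicit Types (u v w : W) (lam : par1 l n) (s : seq 'I_n.-1).

Local Notation psi_mx := (@psi_mx e l n kappa K xv).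
Local Notation idem_mx := (@idem_mx e l n kappa K).
Local Notation mst := (cell_elt kappa psi_mx idem_mx red).
Local Notation word_res_seq := (word_res_seq kappa).

Lemma ca_neq0 r v : v (lo r) != v (hi r) -> ca kappa xv r v != 0.
Proof.
move=> ab; have ba : v (hi r) != v (lo r) by rewrite eq_sym.
rewrite /ca /swap_coef (negbTE ab); case: ifP => _; first by rewrite invr_eq0 xv_neq.
by case: ifP => _; rewrite ?xv_neq ?oner_eq0.
Qed.

Lemma pw_rcons (s : seq 'I_n.-1) r : psi_word psi_mx (rcons s r) = psi_word psi_mx s * psi_mx r.
Proof. by rewrite /psi_word -cats1 big_cat /= big_seq1. Qed.

Lemma pw_actS v0 r s v : mxapp (psi_word psi_mx (r :: s)) (delta K v0) v =
  ca kappa xv r v * mxapp (psi_word psi_mx s) (delta K v0) (swap_word r v) +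
  cb kappa xv r v * mxapp (psi_word psi_mx s) (delta K v0) v.
Proof. by rewrite psi_word_cons mxappM mxapp_psi. Qed.

Lemma pw_act0 v0 v : mxapp (psi_word psi_mx [::]) (delta K v0) v = (v == v0)%:R.
Proof. by rewrite /psi_word big_nil mxapp1 ffunE. Qed.

Lemma mxapp_comb (X : 'M[K]_#|{: W}|) (a b : K) (f g : {ffun W -> K}) u :
  mxapp X [ffun w => a * f w + b * g w] u = a * mxapp X f u + b * mxapp X g u.
Proof.
rewrite !ffunE !mulr_sumr -big_split; apply: eq_bigr => w _.
by rewrite ffunE /=; ring.
Qed.

Lemma mxapp_ext (X : 'M[K]_#|{: W}|) (f g : {ffun W -> K}) u :
  f =1 g -> mxapp X f u = mxapp X g u.
Proof. by move/ffunP=> ->. Qed.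

(** The row of a product of [psi_r] at a fixed word satisfies the same kind of recursion as
    the column, with the letters read from the other end. *)
Lemma wp_actS v0 r s v : mxapp (psi_word psi_mx (rev (r :: s))) (delta K v) v0 =
  ca kappa xv r (swap_word r v) * mxapp (psi_word psi_mx (rev s)) (delta K (swap_word r v)) v0 +
  cb kappa xv r v * mxapp (psi_word psi_mx (rev s)) (delta K v) v0.
Proof.
(* A column of [psi_mx r] has its entries at [v] and at the exchanged word only. *)
rewrite rev_cons pw_rcons mxappM -mxapp_comb; apply: mxapp_ext => w.
rewrite mxapp_psi !ffunE; congr (_ + _).
  have -> : (swap_word r w == v) = (w == swap_word r v) by rewrite -(inj_eq (inv_inj (@swap_wordK l n r))) swap_wordK.
  by case: eqP => [->|]; rewrite ?mulr0.
by case: eqP => [->|]; rewrite ?mulr0.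
Qed.

Lemma wp_act0 v0 v : mxapp (psi_word psi_mx (rev [::])) (delta K v) v0 = (v == v0)%:R.
Proof. by rewrite pw_act0 eq_sym. Qed.

Lemma ca_sw_neq0 r v : v (lo r) != v (hi r) -> ca kappa xv r (swap_word r v) != 0.
Proof. by move=> ab; apply: ca_neq0; rewrite swap_word_lo swap_word_hi eq_sym. Qed.

(** The matrix of [m_st] on words of shape [lam] is the product of this column and of the
    row below, since the idempotent of [lam] picks out the word of the initial tableau. *)
Definition col lam (s : std lam) (u : W) : K :=
  mxapp (psi_word psi_mx (rev (red (d_perm (val s))))) (delta K (init_word lam)) u.
Definition row lam (t : std lam) (v : W) : K :=
  mxapp (psi_word psi_mx (red (d_perm (val t)))) (delta K v) (init_word lam).

Lemma row_rev lam (t : std lam) v :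
  row t v = mxapp (psi_word psi_mx (rev (rev (red (d_perm (val t)))))) (delta K v) (init_word lam).
Proof. by rewrite revK. Qed.

Lemma size_red lam (t : std lam) : size (rev (red (d_perm (val t)))) = word_inversions (tab_word (val t)).
Proof. by rewrite size_rev (size_reduced (redP _)) word_inversions_std. Qed.

Lemma path_red lam (t : std lam) : word_path (init_word lam) (rev (red (d_perm (val t)))) = tab_word (val t).
Proof. by apply: word_path_std; case: (redP (d_perm (val t))). Qed.

Lemma col_len lam (s : std lam) u : col s u != 0 -> (word_inversions u <= word_inversions (tab_word (val s)))%N.
Proof.
rewrite -size_red; exact: (transition_inversions (pw_act0 (init_word lam)) (pw_actS (init_word lam)) (init_word_inversions lam)).
Qed.

Lemma col_top lam (s : std lam) u : word_inversions u = word_inversions (tab_word (val s)) ->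
  (col s u != 0) = (u == tab_word (val s)).
Proof.
rewrite -size_red -path_red => h.
exact: (transition_top (pw_act0 (init_word lam)) (pw_actS (init_word lam)) ca_neq0 (init_word_inversions lam) h).
Qed.

Lemma row_len lam (t : std lam) v : row t v != 0 -> (word_inversions v <= word_inversions (tab_word (val t)))%N.
Proof.
rewrite -size_red row_rev.
exact: (transition_inversions (wp_act0 (init_word lam)) (wp_actS (init_word lam)) (init_word_inversions lam)).
Qed.

Lemma row_top lam (t : std lam) v : word_inversions v = word_inversions (tab_word (val t)) ->
  (row t v != 0) = (v == tab_word (val t)).
Proof.
rewrite -size_red -path_red row_rev => h.
exact: (transition_top (wp_act0 (init_word lam)) (wp_actS (init_word lam)) ca_sw_neq0 (init_word_inversions lam) h).
Qed.

Section Entry.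
Variables (lam : par1 l n) (s t : std lam).

Definition mid_part v : {ffun W -> K} :=
  mxapp (idem_mx (res_par kappa lam)) (mxapp (psi_word psi_mx (red (d_perm (val t)))) (delta K v)).

Lemma mst_act v u : mxapp (mst (val s) (val t)) (delta K v) u =
  mxapp (psi_word psi_mx (rev (red (d_perm (val s))))) (mid_part v) u.
Proof. by rewrite /cell_elt !mxappM. Qed.

Lemma mid_part_neq0 v w : mid_part v w != 0 ->
  [/\ word_res_seq w = res_par kappa lam, word_weight w = word_weight v & content w = content v].
Proof.
rewrite /mid_part mxapp_id mulf_eq0 negb_or; case: (word_res_seq w =P res_par kappa lam) => [E|]; last by rewrite eqxx.
move=> /andP[_ h]; split=> //.
  by apply: (transition_inv (pw_act0 v) (pw_actS v)) h => r u; apply: word_weight_swap.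
by apply: (transition_inv (pw_act0 v) (pw_actS v)) h => r u; apply: content_swap.
Qed.

Lemma mxapp_neq0 (X : 'M[K]_#|{: W}|) (f : {ffun W -> K}) u :
  mxapp X f u != 0 -> exists w, f w != 0.
Proof.
move=> h; apply/existsP; apply: contraT; rewrite negb_exists => /forallP f0.
move: h; rewrite ffunE big1 ?eqxx // => w _.
by have := f0 w; rewrite negbK => /eqP ->; rewrite mulr0.
Qed.

(** On the words of [t'] the right factor of [m_st] is followed by [e(i^lam)], which leaves
    only words at least as heavy as [lam]; equality is possible for the initial word of
    [lam] only, whose content is [lam]. *)
Lemma entry_other mu (t' : std mu) u :
  mxapp (mst (val s) (val t)) (delta K (tab_word (val t'))) u != 0 ->
  lam = mu \/ (shape_weight lam < shape_weight mu)%N.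
Proof.
rewrite mst_act => /mxapp_neq0[w /mid_part_neq0[E wE cE]].
have := word_weight_ge K1 E; rewrite wE word_weight_std leq_eqVlt => /orP[/eqP Ew|]; last by right.
left; apply/val_inj/ffunP=> m; apply: val_inj.
have Ew0 : w = init_word lam by apply: (word_weight_eq K1 E); rewrite wE word_weight_std.
have := congr1 (fun f : {ffun 'I_l -> nat} => f m) cE.
by rewrite Ew0 (content_std (init_std lam)) content_std.
Qed.

(** On words of shape [lam] the idempotent of [lam] is the projection to one word, so [m_st]
    acts with rank one. *)
Lemma entry_same (t' : std lam) u :
  mxapp (mst (val s) (val t)) (delta K (tab_word (val t'))) u = col s u * row t (tab_word (val t')).
Proof.
rewrite mst_act mulrC -[RHS]addr0 -[X in _ + X](mul0r (col s u)) -mxapp_comb.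
apply: mxapp_ext => w; rewrite [RHS]ffunE mul0r addr0.
have [->|ne] := eqVneq w (init_word lam).
  by rewrite /mid_part mxapp_id res_init_word eqxx mul1r deltaE eqxx mulr1.
rewrite deltaE (negbTE ne) mulr0; apply/eqP; apply: contraT => /mid_part_neq0[E wE _].
by case/eqP: ne; apply: (word_weight_eq K1 E); rewrite wE word_weight_std.
Qed.
End Entry.

Definition cell_mx (i : C_index l n) : 'M[K]_#|{: W}| :=
  mst (val (tagged i).1) (val (tagged i).2).

Lemma word_inversions_bound u : (word_inversions u <= #|{: 'I_n * 'I_n}|)%N.
Proof. exact: max_card. Qed.

(** Pair [m_st] with the matrix entry at the words of [s] and [t]. The result is triangular:
    shapes are ordered by their weight, by [entry_other], and within a shape the number of
    inversions of [s] and [t] decides. *)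
Lemma matrix_indep (c : C_index l n -> K) :
  \sum_i (c i)%:M * cell_mx i = 0 -> forall i, c i = 0.
Proof.
move=> S0.
pose T (i j : C_index l n) : K :=
  mxapp (cell_mx i) (delta K (tab_word (val (tagged j).2))) (tab_word (val (tagged j).1)).
pose top := (n * row_weight n 0)%N.
(* [B] exceeds the sum of two inversion numbers, so that the weight decides first. *)
pose B := (2 * #|{: 'I_n * 'I_n}|).+1%N.
pose lens (i : C_index l n) :=
  (word_inversions (tab_word (val (tagged i).1)) + word_inversions (tab_word (val (tagged i).2)))%N.
pose rk i := ((top - shape_weight (tag i)) * B + lens i)%N.
apply: (@triangular_indep _ K T rk c).
- move=> [lam [s t]]; rewrite /T /cell_mx /= entry_same mulf_neq0 //.
    by rewrite col_top.
  by rewrite row_top.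
- move=> [lam [s t]] [mu [s' t']]; rewrite /T /cell_mx /= => h ne.
  have lensB i : (lens i < B)%N.
    by rewrite /lens /B; have := word_inversions_bound (tab_word (val (tagged i).1));
      have := word_inversions_bound (tab_word (val (tagged i).2)); lia.
  have wtop := @shape_weight_bound l n.
  case: (entry_other h) => [E|lt].
    subst mu; move: h; rewrite entry_same mulf_eq0 negb_or => /andP[h1 h2].
    have l1 := col_len h1; have l2 := row_len h2.
    rewrite /rk ltn_add2l /lens /= ltn_neqAle leq_add // andbT; apply/eqP => E.
    have {}l1 : (word_inversions (tab_word (val s')) <= word_inversions (tab_word (val s)))%N := l1.
    have {}E : (word_inversions (tab_word (val s')) + word_inversions (tab_word (val t')) =
                word_inversions (tab_word (val s)) + word_inversions (tab_word (val t)))%N := E.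
    have E1 : word_inversions (tab_word (val s')) = word_inversions (tab_word (val s)) by lia.
    have E2 : word_inversions (tab_word (val t')) = word_inversions (tab_word (val t)) by lia.
    move: h1 h2; rewrite (col_top E1) (row_top E2) => /eqP/tab_word_inj e1 /eqP/tab_word_inj e2.
    by case/eqP: ne; rewrite e1 e2.
  have h1 := lensB (existT _ mu (s', t')); have h2 := wtop mu.
  have : ((top - shape_weight mu).+1 * B <= (top - shape_weight lam) * B)%N.
    by rewrite leq_mul2r; apply/orP; right; rewrite /top; lia.
  rewrite mulSn => h3; apply: leq_trans (leq_addr _ _); apply: leq_trans h3.
  by rewrite /rk /= addnC -addSn leq_add2r.
move=> j; have := congr1 (fun X => mxapp X (delta K (tab_word (val (tagged j).2))) (tab_word (val (tagged j).1))) S0.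
rewrite mxapp0 mxapp_sum => E; rewrite -[RHS]E; apply: eq_bigr => i _.
by rewrite mxappM mxapp_scalar.
Qed.

End MatrixIndependence.

(** * Evaluation of noncommutative polynomials *)

Section Evaluation.
Variables (F : fieldType) (X : choiceType) (S : pzRingType) (sc : F -> S) (h : X -> S).
Hypothesis sc1 : sc 1 = 1.
Hypothesis scD : forall a b, sc (a + b) = sc a + sc b.
Hypothesis scM : forall a b, sc (a * b) = sc a * sc b.
Hypothesis scC : forall c a, sc c * a = a * sc c.
Implicit Types (g : freeAlg F X) (w : word X).

Definition ev_word w : S := \prod_(a <- w) h a.
(** Evaluation of noncommutative polynomials at [h], with values in a ring that may be
    trivial. *)
Definition ev g : S := \sum_(w <- msupp g) sc g@_w * ev_word w.

Lemma ev_sc0 : sc 0 = 0.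
Proof. by apply: (addrI (sc 0)); rewrite -scD !addr0. Qed.

Lemma evEw (d : {fset word X}) g : (msupp g `<=` d)%fset ->
  ev g = \sum_(w <- d) sc g@_w * ev_word w.
Proof.
move=> le; rewrite /ev (big_fset_incl _ le) //= => w _ /mcoeff_outdom ->.
by rewrite ev_sc0 mul0r.
Qed.

Lemma evD g g' : ev (g + g') = ev g + ev g'.
Proof.
rewrite (evEw (msuppD_le g g')) (evEw (fsubsetUl (msupp g) (msupp g'))).
rewrite (evEw (fsubsetUr (msupp g) (msupp g'))) -big_split; apply: eq_bigr => w _ /=.
by rewrite mcoeffD scD mulrDl.
Qed.

Lemma ev0 : ev 0 = 0.
Proof. by rewrite /ev msupp0 big_seq_fset0. Qed.

Lemma evU c w : ev << c *g w >> = sc c * ev_word w.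
Proof. by rewrite (evEw msuppU_le) big_seq_fset1 mcoeffUU. Qed.

Lemma ev_sum I (r : seq I) (f : I -> freeAlg F X) :
  ev (\sum_(i <- r) f i) = \sum_(i <- r) ev (f i).
Proof. exact: (big_morph ev evD ev0). Qed.

Lemma evM g g' : ev (g * g') = ev g * ev g'.
Proof.
rewrite [g]monalgE mulr_suml !ev_sum mulr_suml; apply: eq_bigr => u _.
rewrite [g']monalgE mulr_sumr !ev_sum mulr_sumr; apply: eq_bigr => v _.
rewrite malgM_def fgmulUU !evU scM /ev_word big_cat /=.
by rewrite -!mulrA; congr (_ * _); rewrite !mulrA scC.
Qed.

Lemma evN g : ev (- g) = - ev g.
Proof. by apply/eqP; rewrite -addr_eq0 -evD addNr ev0. Qed.

Lemma evZ c g : ev (c *: g) = sc c * ev g.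
Proof.
by rewrite -mul_malgC evM; congr (_ * _); rewrite evU /ev_word big_nil mulr1.
Qed.

Lemma ev1 : ev 1 = 1.
Proof. by rewrite evU sc1 /ev_word big_nil mulr1. Qed.

Lemma ev_letter a : ev (letter F a) = h a.
Proof. by rewrite letter.unlock evU sc1 mul1r /ev_word big_seq1. Qed.

Lemma ev_nat m : ev m%:R = m%:R.
Proof. by elim: m => [|m IH]; rewrite ?ev0 // -!natr1 evD IH ev1. Qed.

End Evaluation.

(** * The charges *)

Section ChargeFacts.
Variables (e l n : nat) (khat : 'I_l -> int).

Lemma charge_far m m' : strongly_adjacency_free e n khat -> m != m' ->
  far (charge e khat m) (charge e khat m').
Proof.
case=> _ h _ _ /h [h1 h2 h3]; apply/and3P; split; apply/eqP => E.
- by apply: h1; rewrite E subrr.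
- by apply: h2; rewrite E addrAC subrr add0r.
- by apply: h3; rewrite E addrAC subrr add0r.
Qed.

End ChargeFacts.

Lemma val_ZpD e (a b : 'Z_e.+2) : nat_of_ord (a + b) = ((a + b) %% e.+2)%N.
Proof. by []. Qed.

Lemma val_Zp1 e : nat_of_ord (1 : 'Z_e.+2) = 1%N.
Proof. by []. Qed.

Lemma val_Zp2 e : nat_of_ord (2%:R : 'Z_e.+3) = 2%N.
Proof. by []. Qed.

(** In terms of representatives, two charges are at distance at least two on the cycle of
    residues, in both directions. *)
Lemma charge_gap e l n (khat : 'I_l -> int) (i j : 'I_l) :
  strongly_adjacency_free e.+2 n khat -> (i < j)%N ->
  (charge e.+2 khat i + 1 < charge e.+2 khat j)%N /\
  (charge e.+2 khat j < charge e.+2 khat i + e.+1)%N.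
Proof.
move=> saf ij; have [_ _ _ h] := saf; have lt := h _ _ ij.
have /and3P[_ /eqP a1 /eqP a2] : far (charge e.+2 khat j) (charge e.+2 khat i).
  by apply: (charge_far saf); rewrite neq_ltn ij orbT.
move: lt a1 a2; set a := charge _ _ i; set b := charge _ _ j => lt a1 a2.
have bl : (b < e.+2)%N := ltn_ord b; split.
  rewrite ltn_neqAle addn1 lt andbT; apply/eqP=> E; apply: a1; apply: ord_inj.
  by rewrite val_ZpD val_Zp1 addn1 E modn_small.
rewrite ltnNge; apply/negP => le; apply: a2.
have [b1 a0] : nat_of_ord b = e.+1 /\ nat_of_ord a = 0%N by lia.
have -> : a = b + 1; last by rewrite addrK.
by apply: ord_inj; rewrite val_ZpD val_Zp1 b1 a0 addn1 modnn.
Qed.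

(** With all gaps at least two on the cycle, [charge m] can be 2 more than [charge m'] only
    if the cycle closes between them, that is for the first and the last charge, which is
    excluded separately. *)
Lemma charge_neq_add2 e l n (khat : 'I_l -> int) (m m' : 'I_l) : (1 < e)%N ->
  strongly_adjacency_free e n khat -> (m < m')%N ->
  charge e khat m <> charge e khat m' + 2%:R.
Proof.
case: e => [//|[//|e]] _ saf lt; have [_ _ h3 _] := saf.
have [g1 g2] := charge_gap saf lt.
have al : (charge e.+2 khat m < e.+2)%N := ltn_ord _.
have bl : (charge e.+2 khat m' < e.+2)%N := ltn_ord _.
case: e => [|e] in saf h3 g1 g2 al bl *; first by lia.
move=> E; have V : (charge e.+3 khat m + e.+3 = charge e.+3 khat m' + 2)%N.
  have := congr1 (@nat_of_ord _) E; rewrite val_ZpD val_Zp2.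
  case: (ltnP (charge e.+3 khat m' + 2) e.+3) => h; first by rewrite modn_small //; lia.
  rewrite -{1}(subnK h) modnDr modn_small; lia.
have lm : (l.-1 < l)%N by have := ltn_ord m; lia.
have [ml|ml] := eqVneq (m'.+1) l; last first.
  have lt2 : (m' < Ordinal lm)%N by rewrite /=; have := ltn_ord m'; lia.
  have [k1 _] := charge_gap saf lt2; have : (charge e.+3 khat (Ordinal lm) < e.+3)%N := ltn_ord _.
  by lia.
case: (posnP m) => [m0|m_gt0]; first exact: (h3 m m').
have l0 : (0 < l)%N by lia.
have lt3 : (Ordinal l0 < m)%N by [].
by have [k1 _] := charge_gap saf lt3; have [_ k2] := charge_gap saf (ltn_trans lt3 lt); lia.
Qed.

(** Two charges at distance at least two in both directions do not fit into a cycle of two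
    residues. *)
Lemma charge_two_neq0 e l n (khat : 'I_l -> int) : (1 < e)%N -> (1 < l)%N ->
  strongly_adjacency_free e n khat -> (2%:R : 'Z_e) != 0.
Proof.
case: e => [//|[//|e]] _ l1 saf; have l0 : (0 < l)%N by lia.
have [g1 _] := charge_gap saf (ltnSn 0 : (Ordinal l0 < Ordinal l1)%N).
have bl : (charge e.+2 khat (Ordinal l1) < e.+2)%N := ltn_ord _.
by case: e => [|e] in khat saf g1 bl *; [lia | rewrite -val_eqE].
Qed.

(** * Evaluation at elements that satisfy the deformed relations *)

Section Generators.
Variables (e l n : nat) (kappa : 'I_l -> 'Z_e) (F : fieldType) (R : comNzRingType)
  (A : pzRingType) (sc : R -> A) (x : 'I_l -> R) (ps : 'I_n.-1 -> A) (yy : 'I_n -> A)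
  (ee : resseq e n -> A).
Hypothesis D : deformed_blob kappa sc x ps yy ee.
Variable iota : {rmorphism F -> R}.

Definition gen_map (a : blob_gen e n) : A :=
  match a with inl (inl r) => ps r | inl (inr p) => yy p | inr i => ee i end.

Definition blob_ev (g : freeAlg F (blob_gen e n)) : A := ev (sc \o iota) gen_map g.

Let sc1' : (sc \o iota) 1 = 1. Proof. by rewrite /= rmorph1 (sc1 D). Qed.
Let scD' a b : (sc \o iota) (a + b) = (sc \o iota) a + (sc \o iota) b.
Proof. by rewrite /= rmorphD (scD D). Qed.
Let scM' a b : (sc \o iota) (a * b) = (sc \o iota) a * (sc \o iota) b.
Proof. by rewrite /= rmorphM (scM D). Qed.
Let scC' c a : (sc \o iota) c * a = a * (sc \o iota) c.
Proof. exact: (scC D). Qed.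

Lemma blob_evD g g' : blob_ev (g + g') = blob_ev g + blob_ev g'.
Proof. exact: evD. Qed.
Lemma blob_evN g : blob_ev (- g) = - blob_ev g.
Proof. exact: evN. Qed.
Lemma blob_ev0 : blob_ev 0 = 0.
Proof. exact: ev0. Qed.
Lemma blob_ev1 : blob_ev 1 = 1.
Proof. exact: ev1. Qed.
Lemma blob_evM g g' : blob_ev (g * g') = blob_ev g * blob_ev g'.
Proof. exact: evM. Qed.
Lemma blob_evZ c g : blob_ev (c *: g) = sc (iota c) * blob_ev g.
Proof. exact: (evZ (sc := sc \o iota)). Qed.
Lemma blob_ev_letter a : blob_ev (letter F a) = gen_map a.
Proof. exact: ev_letter. Qed.
Lemma blob_ev_psi r : blob_ev (letter F (inl (inl r) : blob_gen e n)) = ps r.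
Proof. exact: blob_ev_letter. Qed.
Lemma blob_ev_y k : blob_ev (letter F (inl (inr k) : blob_gen e n)) = yy k.
Proof. exact: blob_ev_letter. Qed.
Lemma blob_ev_idem i : blob_ev (letter F (inr i : blob_gen e n)) = ee i.
Proof. exact: blob_ev_letter. Qed.
Lemma blob_ev_nat m : blob_ev m%:R = m%:R.
Proof. exact: ev_nat. Qed.
Lemma blob_ev_sum I (r : seq I) (f : I -> freeAlg F (blob_gen e n)) :
  blob_ev (\sum_(i <- r) f i) = \sum_(i <- r) blob_ev (f i).
Proof. exact: ev_sum. Qed.
Lemma blob_ev_prod I (r : seq I) (f : I -> freeAlg F (blob_gen e n)) :
  blob_ev (\prod_(i <- r) f i) = \prod_(i <- r) blob_ev (f i).
Proof. exact: (big_morph blob_ev blob_evM blob_ev1). Qed.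

Lemma gen_map_gen a : is_gen sc ps yy ee (gen_map a).
Proof. by case: a => [[r|p]|i]; constructor. Qed.

(** The image of an element of the free algebra lies in the subalgebra generated by the
    generators and scalars, so it preserves the ideals in use. *)
Lemma ideal_evl I g a : is_ideal sc ps yy ee I -> I a -> I (blob_ev g * a).
Proof.
move=> idI Ia; rewrite /blob_ev /ev mulr_suml; elim/big_ind: _ => [||w _].
- exact: (ideal_mem0 idI).
- by move=> u v hu hv; apply: (ideal_memD idI).
rewrite -mulrA; apply: (ideal_memZ idI); rewrite /ev_word.
elim: (w : seq _) => [|b v IH]; first by rewrite big_nil mul1r.
by rewrite big_cons -mulrA; case: idI => _ _ h _; apply: h => //; apply: gen_map_gen.
Qed.

Lemma ideal_evr I g a : is_ideal sc ps yy ee I -> I a -> I (a * blob_ev g).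
Proof.
move=> idI Ia; rewrite /blob_ev /ev mulr_sumr; elim/big_ind: _ => [||w _].
- exact: (ideal_mem0 idI).
- by move=> u v hu hv; apply: (ideal_memD idI).
rewrite mulrA -(scC D) -mulrA; apply: (ideal_memZ idI); rewrite /ev_word.
elim: (w : seq _) a Ia => [|b v IH] a Ia; first by rewrite big_nil mulr1.
rewrite big_cons mulrA; apply: IH; case: idI => _ _ _ h; apply: h => //; exact: gen_map_gen.
Qed.

Variable red : 'S_n -> seq 'I_n.-1.

Definition lift_word (u : seq 'I_n.-1) : freeAlg F (blob_gen e n) :=
  \prod_(r <- u) letter F (inl (inl r) : blob_gen e n).

(** The element [m_st] in the free algebra. *)
Definition lift lam (s t : tab lam) : freeAlg F (blob_gen e n) :=
  lift_word (rev (red (d_perm s))) *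
  letter F (inr (res_par kappa lam) : blob_gen e n) * lift_word (red (d_perm t)).

Lemma ev_lift lam (s t : tab lam) : blob_ev (lift s t) = cell_elt kappa ps ee red s t.
Proof.
rewrite /lift !blob_evM blob_ev_letter /lift_word !blob_ev_prod.
by congr (_ * _ * _); apply: eq_bigr => r _; rewrite blob_ev_letter.
Qed.

Lemma ev_braid_coef i r s : blob_ev (braid_coef F i r s) = braid_sign A i r s.
Proof.
rewrite /braid_coef /braid_sign; case: ifP => _; last case: ifP => _.
- by rewrite blob_evN blob_ev1.
- exact: blob_ev1.
- exact: blob_ev0.
Qed.

End Generators.

(** * The blob algebra as an instance of the deformed relations *)

Section BlobAlgebraFacts.
Variables (F : fieldType) (e l n : nat) (kappa : 'I_l -> 'Z_e).
Local Notation B := (blobAlg F n kappa).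
Local Notation p := (pr (blob_rel kappa)).

(** The scalars of the blob algebra, as central elements. *)
Definition bsc (c : F) : B := c *: (1 : B).

Lemma bscE c (a : B) : bsc c * a = c *: a.
Proof. by rewrite /bsc -presAlg_scalerAl mul1r. Qed.

Lemma bscEr c (a : B) : a * bsc c = c *: a.
Proof. by rewrite /bsc -(presAlg_scalerAr (@freeAlg_scalerAr F _)) mulr1. Qed.

Lemma blob_deformed : deformed_blob kappa bsc (fun=> 0) (psi F kappa) (y F kappa) (idem F kappa).
Proof.
have pE := (prM, prB, prD).
split.
- by rewrite /bsc scale1r.
- by move=> a b; rewrite /bsc scalerDl.
- by move=> a b; rewrite bscE /bsc scalerA.
- by move=> c a; rewrite bscE bscEr.
- move=> i j; rewrite /idem -prM (pr_rel (RelEE F kappa i j)); by case: eqP => // _; rewrite pr0.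
- rewrite -pr1 -(pr_rel (RelE1 F n kappa)); symmetry; apply: (big_morph p (prD _)); exact: pr0.
- by move=> i k k0 h; rewrite /idem (pr_rel (RelE0 F k0 h)) pr0.
- by move=> i k k' m k0 k1 h h'; rewrite /idem (pr_rel (RelE01 F k0 k1 h h')) pr0.
- move=> i k m k0 h; rewrite /idem /y -prM (pr_rel (RelYE0 F k0 h)) pr0.
  by rewrite bscE scale0r.
- by move=> k i; rewrite /y /idem -!prM (pr_rel (RelYE F kappa k i)).
- by move=> r i; rewrite /psi /idem -!prM (pr_rel (RelPsiE F kappa r i)).
- by move=> r k h1 h2; rewrite /psi /y -!prM (pr_rel (RelPsiY F kappa h1 h2)).
- by move=> r s h; rewrite /psi -!prM (pr_rel (RelPsiPsi F kappa h)).
- move=> r i; rewrite /psi /y /idem -!prM (pr_rel (RelPsiYhi F kappa r i)) !pE.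
  by rewrite pr_nat.
- move=> r i; rewrite /psi /y /idem -!prM (pr_rel (RelYhiPsi F kappa r i)) !pE.
  by rewrite pr_nat.
- by move=> r i h; have := pr_rel (RelSqEq F kappa h); rewrite expr2 !pE pr0.
- by move=> r i h1 h2 h3; have := pr_rel (RelSqFar F kappa h1 h2 h3); rewrite expr2 !pE.
- by move=> r i h; have := pr_rel (RelSqUp F kappa h); rewrite expr2 !pE.
- by move=> r i h; have := pr_rel (RelSqDown F kappa h); rewrite expr2 !pE.
move=> r s i sr; have := pr_rel (RelBraid F kappa i sr); rewrite !pE => ->.
congr ((_ + _) * _); rewrite /braid_coef /braid_sign; case: ifP => _; last case: ifP => _.
- by rewrite prN pr1.
- exact: pr1.
- exact: pr0.
Qed.

Local Notation blob_eval_pr :=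
  (blob_ev bsc (psi F kappa) (y F kappa) (idem F kappa) (@idfun F : {rmorphism F -> F})).

Lemma blob_ev_pr (g : freeAlg F (blob_gen e n)) : blob_eval_pr g = p g.
Proof.
have Eletter a : gen_map (psi F kappa) (y F kappa) (idem F kappa) a = p (letter F a).
  by case: a => [[r|k]|i].
have word_cons a (w : word (blob_gen e n)) :
    << (a :: w : word _) >> = letter F a * << w >> :> freeAlg F _.
  by rewrite letter.unlock malgM_def fgmulUU mulr1.
rewrite {2}[g]monalgE (big_morph p (prD _) (pr0 _)); apply: eq_bigr => w _.
have -> : << g@_w *g w >> = g@_w *: << w >> :> freeAlg F (blob_gen e n).
  by apply/malgP => v; rewrite mcoeffZ !mcoeffU mulr_natr.
rewrite prZ -bscE; congr (_ * _); elim: (w : seq _) => [|a v IH].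
  by rewrite /ev_word big_nil.
by rewrite word_cons prM -IH /ev_word big_cons Eletter.
Qed.

Lemma star_prod (u : seq 'I_n.-1) :
  star (\prod_(r <- u) psi F kappa r) = \prod_(r <- rev u) psi F kappa r.
Proof.
elim: u => [|r u IH]; first by rewrite /rev !big_nil star1.
by rewrite big_cons star_anti star_psi IH rev_cons -cats1 big_cat /= big_seq1.
Qed.

Variable red : 'S_n -> seq 'I_n.-1.

Lemma C_family_mst (i : C_index l n) : @C_family F e l n kappa red i =
  cell_elt kappa (psi F kappa) (idem F kappa) red (val (tagged i).1) (val (tagged i).2).
Proof. by rewrite /C_family /m_elt /psi_perm star_prod. Qed.

Hypothesis K1 : forall m m', m != m' -> far (kappa m) (kappa m').
Hypothesis K2 : forall m m' : 'I_l, (m < m')%N -> kappa m <> kappa m' + 2%:R.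
Hypothesis redP : forall w, reduced_expr w (red w).

Lemma C_family_spans (a : B) : exists c : C_index l n -> F,
  a = \sum_i c i *: @C_family F e l n kappa red i.
Proof.
have [g ->] := pr_surj a; rewrite -blob_ev_pr -[blob_eval_pr g]mulr1.
have D := blob_deformed; have h1 := one_cell_ideal D K1 K2.
have hg := ideal_evl (@idfun F : {rmorphism F -> F}) g (cell_ideal_is_ideal _ _ _ _ _ _) h1.
have [c Ec] := cell_span_sum D (cell_ideal_span D K1 K2 redP hg).
exists c; rewrite Ec; apply: eq_bigr => i _.
by rewrite C_family_mst bscE.
Qed.

End BlobAlgebraFacts.

(** * Specialisation *)

Section Specialisation.
Variables (F K : fieldType) (frac : {rmorphism {poly F} -> K}).
Hypothesis frac_eq0 : forall g, frac g = 0 -> g = 0.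
Variables (e l n : nat) (kappa : 'I_l -> 'Z_e).
Hypothesis K1 : forall m m', m != m' -> far (kappa m) (kappa m').
Hypothesis K2 : forall m m' : 'I_l, (m < m')%N -> kappa m <> kappa m' + 2%:R.
Hypothesis two_neq0 : (2%:R : 'Z_e) != 0.
Variable red : 'S_n -> seq 'I_n.-1.
Hypothesis redP : forall w, reduced_expr w (red w).

(** Any family of distinct multiples of [X] would do: distinct for the representation, zero
    at [X = 0] for the blob algebra. *)
Definition param (m : 'I_l) : {poly F} := 'X^(m.+1).
Definition fparam (m : 'I_l) : K := frac (param m).

Lemma fparam_inj : injective fparam.
Proof.
move=> a b /eqP; rewrite -subr_eq0 -rmorphB => /eqP/frac_eq0/eqP; rewrite subr_eq0.
by move/eqP/(congr1 (fun g : {poly F} => size g)); rewrite !size_polyXn => -[/val_inj].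
Qed.

Local Notation sc := (@scalar_of l n K {poly F} frac).
Local Notation psi_mx := (@psi_mx e l n kappa K fparam).
Local Notation y_mx := (@y_mx l n K fparam).
Local Notation idem_mx := (@idem_mx e l n kappa K).
Local Notation mev :=
  (blob_ev sc psi_mx y_mx idem_mx (@polyC F : {rmorphism F -> {poly F}})).
Local Notation L := (cell_ideal kappa sc psi_mx y_mx idem_mx 0).

Lemma mat_deformed : deformed_blob kappa sc param psi_mx y_mx idem_mx.
Proof. by apply: matrix_deformed => //; exact: fparam_inj. Qed.

(** The matrices satisfy all relations of the blob algebra but [y_1 e(i) = 0], whose failure
    is a multiple of [X]. *)
Lemma rel_divisible u v : blob_rel kappa u v -> exists2 a, L a & mev u - mev v = sc 'X * a.
Proof.
have D := mat_deformed; have idL := cell_ideal_is_ideal kappa sc psi_mx y_mx idem_mx 0.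
have triv (a b : 'M[K]_#|{: {ffun 'I_n -> 'I_l}}|) :
    a = b -> exists2 c, L c & a - b = sc 'X * c.
  by move=> ->; exists 0; [apply: Cell0 | rewrite subrr mulr0].
have eM g g' : mev (g * g') = mev g * mev g' := blob_evM D _ g g'.
have eD g g' : mev (g + g') = mev g + mev g' := blob_evD D _ g g'.
have eN g : mev (- g) = - mev g := blob_evN D _ g.
have eP r : mev (letter F (inl (inl r) : blob_gen e n)) = psi_mx r := blob_ev_psi D _ r.
have eY k : mev (letter F (inl (inr k) : blob_gen e n)) = y_mx k := blob_ev_y D _ k.
have eE i : mev (letter F (inr i : blob_gen e n)) = idem_mx i := blob_ev_idem D _ i.
have e0 : mev 0 = 0 := blob_ev0 _ _ _ _ _.
have eN' m : mev m%:R = m%:R := blob_ev_nat D _ m.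
have evE := (eM, eD, eN, eP, eY, eE, e0, eN').
case=> {u v}.
- move=> i j; apply: triv.
  rewrite !evE (idM D i j).
  by case: eqP => _; rewrite !evE.
- apply: triv.
  by rewrite (blob_ev1 D) -(id1 D) (blob_ev_sum D); apply: eq_bigr => i _; rewrite !evE.
- move=> i k k0 h; apply: triv.
  by rewrite !evE (id0 D k0 h).
- move=> i k k' m k0 k1 h h'; apply: triv.
  by rewrite !evE (id01 D k0 k1 h h').
- move=> i k m k0 h; exists (sc 'X^m * idem_mx i).
    by apply: (ideal_memZ idL); rewrite -[idem_mx i]mulr1; case: idL => _ _ hl _; apply: hl;
      [constructor | apply: (one_cell_ideal D)].
  by rewrite !evE subr0 (y_id0 D k0 h) mulrA -(scM D) /param exprS.
- move=> k i; apply: triv.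
  by rewrite !evE (y_id D k i).
- move=> r i; apply: triv.
  by rewrite !evE (psi_id D r i).
- move=> k k'; apply: triv.
  rewrite !evE.
  by apply: mxapp_inj => f u; rewrite !mxappM !mxapp_y mulrCA.
- move=> r k h1 h2; apply: triv.
  by rewrite !evE (psi_y D h1 h2).
- move=> r s h; apply: triv.
  by rewrite !evE (psi_psi D h).
- move=> r i; apply: triv.
  by rewrite !evE (psi_y_hi D r i).
- move=> r i; apply: triv.
  by rewrite !evE (y_hi_psi D r i).
- move=> r i h; apply: triv.
  by rewrite expr2 !evE (sq_eq D h).
- move=> r i h1 h2 h3; apply: triv.
  by rewrite expr2 !evE (sq_far D h1 h2 h3).
- move=> r i h; apply: triv.
  by rewrite expr2 !evE (sq_up D h).
- move=> r i h; apply: triv.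
  by rewrite expr2 !evE (sq_down D h).
move=> r s i sr; apply: triv.
by rewrite !evE (ev_braid_coef D) (braid D i sr).
Qed.

Lemma ideal_divisible u : in_ideal (@blob_rel F e l n kappa) u -> exists2 a, L a & mev u = sc 'X * a.
Proof.
have D := mat_deformed; have idL := cell_ideal_is_ideal kappa sc psi_mx y_mx idem_mx 0.
elim=> {u} [u v /rel_divisible[a La E]||u v _ [a La Ea] _ [b Lb Eb]|g u _ [a La Ea]|g u _ [a La Ea]].
- by exists a; rewrite // (blob_evD D) (blob_evN D).
- by exists 0; [apply: Cell0 | rewrite blob_ev0 mulr0].
- by exists (a + b); [apply: CellD | rewrite (blob_evD D) Ea Eb mulrDr].
- exists (mev g * a); first exact: (ideal_evl _ g idL La).
  by rewrite (blob_evM D) Ea !mulrA (scC D).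
- exists (a * mev g); first exact: (ideal_evr D _ g idL La).
  by rewrite (blob_evM D) Ea mulrA.
Qed.

(** A relation with coefficients [c i] in [F], lifted to the free algebra, takes in the
    matrices a value which is [X] times a combination of the matrices of the [m_st] with
    coefficients [b i] in [F[X]]. Independence over the fraction field gives [c i = X * b
    i], hence [c i = 0] at [X = 0]. *)
Lemma C_family_indep : lin_indep (@C_family F e l n kappa red).
Proof.
move=> c S0 i0; have D := mat_deformed.
pose G := \sum_i c i *: lift kappa F red (val (tagged i).1) (val (tagged i).2).
have pG : pr (blob_rel kappa) G = pr (blob_rel kappa) 0.
  rewrite pr0 -S0 (big_morph _ (prD (blob_rel kappa)) (pr0 _)); apply: eq_bigr => i _.
  by rewrite prZ C_family_mst -(ev_lift (blob_deformed F n kappa) (@idfun F : {rmorphism F -> F}))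
    blob_ev_pr.
have [a La] := ideal_divisible (proj1 (prP _ _ _) pG); rewrite subr0.
have [b ->] := cell_span_sum D (cell_ideal_span D K1 K2 redP La).
rewrite (blob_ev_sum D) mulr_sumr => /eqP; rewrite -subr_eq0 -sumrB => /eqP E.
have := @matrix_indep e l n kappa K fparam K1 fparam_inj red redP
  (fun i => frac ((c i)%:P - 'X * b i)).
move=> /(_ _ i0) H; have : frac ((c i0)%:P - 'X * b i0) = 0.
  apply: H; rewrite -[RHS]E; apply: eq_bigr => i _.
  rewrite (blob_evZ D (@polyC F : {rmorphism F -> {poly F}})).
  rewrite (ev_lift D (@polyC F : {rmorphism F -> {poly F}})).
  rewrite [sc 'X * _]mulrA -(scM D) -mulrBl; congr (_ * _).
  by rewrite /scalar_of rmorphB raddfB.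
move/frac_eq0/(congr1 (fun g : {poly F} => g`_0)).
by rewrite coefB coefC eqxx coefXM eqxx subr0 coef0.
Qed.

End Specialisation.

Theorem theorem30 (F : fieldType) (e l n : nat) (q : F) (khat : 'I_l -> int)
    (red : 'S_n -> seq 'I_n.-1) :
  (1 < e)%N -> (1 < l)%N -> (1 < n)%N ->
  q != 1 -> e.-primitive_root q ->
  strongly_adjacency_free e n khat ->
  (forall w : 'S_n, reduced_expr w (red w)) ->
  lin_indep (@C_family F e l n (@charge e l khat) red) /\
  is_basis (@C_family F e l n (@charge e l khat) red).
Proof.
move=> e1 l1 _ _ _ saf redP.
have K1 m m' := @charge_far e l n khat m m' saf.
have K2 m m' := @charge_neq_add2 e l n khat m m' e1 saf.
have indep : lin_indep (@C_family F e l n (@charge e l khat) red).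
  apply: (@C_family_indep F {fraction {poly F}} (@tofrac {poly F})) => //.
    by move=> g /eqP; rewrite tofrac_eq0 => /eqP.
  exact: charge_two_neq0 saf.
by split=> //; split=> // a; apply: C_family_spans.
Qed.
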